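(* Let $N\ge1$, $u_0,\ldots,u_N\in\mathbb{C}$ with all arguments below avoiding $\Lambda_\tau$, $u=u_0+\cdots+u_N$. Then (i) $[\delta_{jk}\zeta_N^{k}]_{j,k=0}^{N-1}M_N(u_0+1,u_1,\ldots,u_N;\tau)=-M_N(u_0,\ldots,u_N;\tau)$; (ii) $e^{-2\pi iu/N}q^{-1/(2N)}P\,M_N(u_0+\tau,u_1,\ldots,u_N;\tau)=-M_N(u_0,\ldots,u_N;\tau)-(-i)^Ne^{-\pi iu}q^{-N/8}\,{}^t(1,0,\ldots,0)$, where $P$ is the $N\times N$ cyclic permutation matrix with $(PV)_0=V_{N-1}$ and $(PV)_j=V_{j-1}$ for $1\le j\le N-1$; (iii) for $z$ with $z-u_0,z+u_1\notin\Lambda_\tau$: $M_N(u_0-z,u_1+z,u_2,\ldots,u_N;\tau)-M_N(u_0,\ldots,u_N;\tau)=\Phi_N(u_0,\ldots,u_N;z;\tau)$; (iv) $M_N(u_0,\ldots,u_N;\tau)=M_N(u_{\sigma(0)},\ldots,u_{\sigma(N)};\tau)$ for every permutation $\sigma$ of $\{0,\ldots,N\}$; (v) for $r\ne s$, $M_N(\ldots,u_r-\tau,\ldots,u_s+\tau,\ldots;\tau)=M_N(\ldots,u_r,\ldots,u_s,\ldots;\tau)$.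
   Context: Fix $\tau$ with $\operatorname{Im}\tau>0$, $q=e^{2\pi i\tau}$, $q^c:=e^{2\pi ic\tau}$, $\Lambda_\tau=\mathbb{Z}+\tau\mathbb{Z}$, $\zeta_N=e^{2\pi i/N}$. $\vartheta(u)=\vartheta(u;\tau)=\sum_{\nu\in\mathbb{Z}+1/2}e^{2\pi i\nu(u+1/2)}q^{\nu^2/2}$; $\eta(\tau)=q^{1/24}\prod_{j\ge1}(1-q^j)$. $|n|$ = sum of entries of $n$. Zwegers' multivariable $\mu$-function: $\mu_N(u_0,\ldots,u_N;\tau)=\sum_{n\in\mathbb{Z}^N}\frac{e^{\pi iu_0}}{1-e^{2\pi iu_0}q^{|n|}}\prod_{j=1}^N\frac{(-1)^{n_j}e^{-2\pi in_ju_j}q^{n_j(n_j+1)/2}}{\vartheta(u_j;\tau)}$. The column vector $M_N(u_0,\ldots,u_N;\tau)=\big[(-1)^ke^{-2\pi iku/N-\pi ik^2\tau/N}\mu_N(u_0+k\tau,u_1,\ldots,u_N;\tau)\big]_{k=0}^{N-1}$. $\widehat S$ is the $(N-1)\times(N-1)$ matrix with entries $1+\delta_{jk}$; $v_j=u_0+u_1-u_{j+1}$ ($1\le j\le N-1$), $v={}^t(v_1,\ldots,v_{N-1})$, $e_k={}^t(k/N,\ldots,k/N)\in\mathbb{Q}^{N-1}$, and $\nu_{N,k}(u_0,\ldots,u_N;\tau)=\sum_{n\in\mathbb{Z}^{N-1}+e_k}\exp(\pi i\,{}^tn\widehat Sn\,\tau+2\pi i(v,n))$ (equal to $1$ if $N=1$).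 Finally $\Phi_N(u_0,\ldots,u_N;z;\tau)=\frac{i\eta(\tau)^3\vartheta(z)\vartheta(z-u_0+u_1)}{\vartheta(z-u_0)\vartheta(z+u_1)\vartheta(u_0)\cdots\vartheta(u_N)}\big[\nu_{N,k}(u_0,\ldots,u_N;\tau)\big]_{k=0}^{N-1}$. *)

(* Defs.v *)
From Stdlib Require Import Reals ZArith List Lra.
From Coquelicot Require Import Coquelicot.
Import ListNotations.
Open Scope R_scope.
Open Scope C_scope.

Definition Cexp (z : C) : C :=
  (exp (Re z) * cos (Im z), exp (Re z) * sin (Im z))%R.

Fixpoint Cpown (z : C) (n : nat) : C :=
  match n with O => 1 | S m => z * Cpown z m end.

(* limit of a complex sequence (componentwise; meaningful when it converges) *)
Definition Clim (s : nat -> C) : C :=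
  (real (Lim_seq (fun M => Re (s M))), real (Lim_seq (fun M => Im (s M)))).

Definition Csum {A} (l : list A) (f : A -> C) : C :=
  fold_right (fun a acc => f a + acc) 0 l.
Definition Cprod {A} (l : list A) (f : A -> C) : C :=
  fold_right (fun a acc => f a * acc) 1 l.

Definition zrange (M : nat) : list Z :=
  map (fun i => (Z.of_nat i - Z.of_nat M)%Z) (seq 0 (2 * M + 1)).

Fixpoint zbox (n M : nat) : list (list Z) :=
  match n with
  | O => [ [] ]
  | S n' => flat_map (fun z => map (cons z) (zbox n' M)) (zrange M)
  end.

(* sum over Z^n, as the limit of symmetric box partial sums
   (all series used below converge absolutely) *)
Definition zsum (n : nat) (f : list Z -> C) : C :=
  Clim (fun M => Csum (zbox n M) f).

Definition twopii : C := 2 * PI * Ci.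

Definition qpow (tau : C) (c : R) : C := Cexp (twopii * RtoC c * tau).

Definition in_lattice (tau w : C) : Prop :=
  exists a b : Z, w = RtoC (IZR a) + RtoC (IZR b) * tau.

Definition theta (u tau : C) : C :=
  zsum 1 (fun m => let nu := (IZR (nth 0 m 0%Z) + / 2)%R in
            Cexp (twopii * RtoC nu * (u + RtoC (/ 2))) * qpow tau (nu ^ 2 / 2)).

Definition eta (tau : C) : C :=
  qpow tau (/ 24) *
  Clim (fun M => Cprod (seq 1 M) (fun j => 1 - qpow tau (INR j))).

Definition zabs (n : list Z) : Z := fold_right Z.add 0%Z n.

(* Zwegers' multivariable mu-function; u j is u_j, j = 0..N;
   the j-th entry n_j (1 <= j <= N) of n is nth (j-1) n 0 *)
Definition mu (N : nat) (u : nat -> C) (tau : C) : C :=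
  zsum N (fun n =>
    Cexp (PI * Ci * u 0%nat) / (1 - Cexp (twopii * u 0%nat) * qpow tau (IZR (zabs n)))
    * Cprod (seq 1 N) (fun j =>
        let nj := nth (j - 1) n 0%Z in
        RtoC (powerRZ (-1) nj) * Cexp (- twopii * RtoC (IZR nj) * u j)
        * qpow tau (IZR (nj * (nj + 1)) / 2) / theta (u j) tau)).

Definition usum (N : nat) (u : nat -> C) : C := Csum (seq 0 (S N)) u.

Definition upd (u : nat -> C) (r : nat) (w : C) : nat -> C :=
  fun j => if Nat.eqb j r then w else u j.

Definition Mvec (N : nat) (u : nat -> C) (tau : C) (k : nat) : C :=
  RtoC ((-1) ^ k) *
  Cexp (- twopii * RtoC (INR k) * usum N u / RtoC (INR N)
        - PI * Ci * RtoC (INR k ^ 2) * tau / RtoC (INR N))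
  * mu N (upd u 0 (u 0%nat + RtoC (INR k) * tau)) tau.

(* nu_{N,k}: sum over n in Z^{N-1} + e_k of
   exp(pi i tn S n tau + 2 pi i (v,n)),  S = (1 + delta_jk), v_j = u_0+u_1-u_{j+1};
   tn S n = sum_j n_j^2 + (sum_j n_j)^2.  Equal to 1 if N = 1. *)
Definition nuN (N : nat) (u : nat -> C) (tau : C) (k : nat) : C :=
  if Nat.eqb N 1 then 1 else
  zsum (N - 1) (fun m =>
    let n := fun j : nat => (IZR (nth (j - 1) m 0%Z) + INR k / INR N)%R in
    let js := seq 1 (N - 1) in
    let quad := (fold_right (fun j acc => n j ^ 2 + acc) 0 js
                 + (fold_right (fun j acc => n j + acc) 0 js) ^ 2)%R in
    Cexp (PI * Ci * RtoC quad * tau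
          + twopii * Csum js (fun j => (u 0%nat + u 1%nat - u (S j)) * RtoC (n j)))).

Definition PhiN (N : nat) (u : nat -> C) (z tau : C) (k : nat) : C :=
  Ci * Cpown (eta tau) 3 * theta z tau * theta (z - u 0%nat + u 1%nat) tau
  / (theta (z - u 0%nat) tau * theta (z + u 1%nat) tau
     * Cprod (seq 0 (S N)) (fun j => theta (u j) tau))
  * nuN N u tau k.

Definition zetaN (N : nat) : C := Cexp (twopii / RtoC (INR N)).

(* Main.v *)
(* Write e(z) = exp(2 pi i z) and T(v) = sum_n (-1)^n e(nv) q^{n(n+1)/2}, a constant times e(-v/2)
   theta(v).  Grouping the terms of mu_N by m = |n| turns the multiple sum into f(0) for the Laurent
   series f(v) = sum_m c_m e(mv) / (1 - e(u_0) q^m), where sum_m c_m e(mv) is the product F(v) of the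
   T(v - u_j) over j >= 1; this f is the solution of f(v) - e(u_0) f(v + tau) = F(v).  An entire
   1-periodic G with G(v + tau) = -e(-v - tau - b) G(v) is a multiple of T(v + b), because its Laurent
   coefficients satisfy a first-order recursion.

   If two parameter vectors have proportional products of all the T(v - u_j), 0 <= j <= N, the
   difference of the two T(v - u_0) f(v) is such a G with b = 0; as T(0) = 0 it vanishes at 0.  This
   makes mu_N symmetric and invariant under u_r - tau, u_s + tau.  For (iii), G(v) = f'(v) T(v - u_1) -
   f(v) T(v - u_1 - z), with f' belonging to (u_0 - z, u_1 + z), is a multiple of T(v + u_0 - u_1 - z);
   the multiple is read off at v = u_1, where summing over n_1 first reduces f(u_1) to nu_N times the
   one-variable sum E(u) = sum_n (-1)^n q^{n(n+1)/2} / (1 - e(u) q^n).  The case N = 1 of the same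
   argument shows that e(u) E(u) T(u) is constant; letting u tend to 0 identifies the constant as
   -sum_k k (-1)^k q^{k(k+1)/2}, which is minus the cube of the Euler product by the finite Jacobi triple
   product and its derivative at 1. *)

Require Import Defs.
From Stdlib Require Import Reals ZArith List Lra Lia Permutation FunctionalExtensionality.
From Coquelicot Require Import Coquelicot.
Import ListNotations.
Open Scope R_scope.
Open Scope C_scope.

(** The analysis is done on coefficients. An entire 1-periodic function is a two-sided sequence
    decaying faster than every geometric one ([RD]), products are convolutions, and coefficients are
    recovered from values by averaging over roots of unity, so neither integrals nor derivatives of
    series occur. Since [Clim] and division are total, series come with geometric majorants and
    theta denominators with a proof that they are nonzero: T does not vanish off the lattice because
    the finite triple products converging to it have bounded inverses.

    Entry k of M_N carries u_0 + k tau. For (iv) and (v) this shift only multiplies the product of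
    the T(v - u_j) by a constant times e(kv), whichever slot takes it. For (iii) it becomes the
    coset shift e_k: the cross term of the quadratic form at m + e_k is k tau |m|. For (ii) all
    entries but one are renumbered; the wrap-around needs mu_N at u_0 + N tau, and as F has exactly
    N factors, F(v + tau) is a constant times e(-Nv) F(v), so that c_m q^m is a constant times
    c_{m+N}. The correction term in (ii) is F(0) up to the theta normalisation. *)

Lemma Csum_plus {A} (l : list A) (f g : A -> C) :
  Csum l (fun a => f a + g a) = Csum l f + Csum l g.
Proof. induction l as [|a l IH]; simpl; [ring | rewrite IH; ring]. Qed.

Lemma Csum_scal {A} (l : list A) (c : C) (f : A -> C) :
  Csum l (fun a => c * f a) = c * Csum l f.
Proof. induction l as [|a l IH]; simpl; [ring | rewrite IH; ring]. Qed.

Lemma Csum_ext {A} (l : list A) (f g : A -> C) :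
  (forall a, In a l -> f a = g a) -> Csum l f = Csum l g.
Proof.
  induction l as [|a l IH]; simpl; intros H; auto.
  rewrite H, IH; auto.
Qed.

Lemma Csum_app {A} (l m : list A) (f : A -> C) :
  Csum (l ++ m) f = Csum l f + Csum m f.
Proof. induction l as [|a l IH]; simpl; [ring | rewrite IH; ring]. Qed.

Lemma Csum_map {A B} (l : list A) (h : A -> B) (f : B -> C) :
  Csum (map h l) f = Csum l (fun a => f (h a)).
Proof. induction l as [|a l IH]; simpl; congruence. Qed.

Lemma Csum_flat_map {A B} (l : list A) (h : A -> list B) (f : B -> C) :
  Csum (flat_map h l) f = Csum l (fun a => Csum (h a) f).
Proof. induction l as [|a l IH]; simpl; auto. rewrite Csum_app, IH; auto. Qed.

Lemma Cprod_ext {A} (l : list A) (f g : A -> C) :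
  (forall a, In a l -> f a = g a) -> Cprod l f = Cprod l g.
Proof.
  induction l as [|a l IH]; simpl; intros H; auto.
  rewrite H, IH; auto.
Qed.

Lemma Cprod_mult {A} (l : list A) (f g : A -> C) :
  Cprod l (fun a => f a * g a) = Cprod l f * Cprod l g.
Proof. induction l as [|a l IH]; simpl; [ring | rewrite IH; ring]. Qed.

Lemma Cprod_map {A B} (l : list A) (h : A -> B) (f : B -> C) :
  Cprod (map h l) f = Cprod l (fun a => f (h a)).
Proof. induction l as [|a l IH]; simpl; congruence. Qed.

Lemma Cprod_neq0 {A} (l : list A) (f : A -> C) :
  (forall a, In a l -> f a <> 0) -> Cprod l f <> 0.
Proof.
  induction l as [|a l IH]; simpl; intros H; [exact C1_nz|].
  apply Cmult_neq_0; auto.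
Qed.

Lemma Csum_perm {A} (l m : list A) (f : A -> C) :
  Permutation l m -> Csum l f = Csum m f.
Proof.
  induction 1; simpl; try congruence; ring.
Qed.

Lemma Cprod_perm {A} (l m : list A) (f : A -> C) :
  Permutation l m -> Cprod l f = Cprod m f.
Proof.
  induction 1; simpl; try congruence; ring.
Qed.

Lemma Cprod_change {A} (l : list A) (r : A) (k : C) (f g : A -> C) :
  NoDup l -> In r l -> (forall j, j <> r -> g j = f j) -> g r = k * f r ->
  Cprod l g = k * Cprod l f.
Proof.
  intros Hl Hr Hj Hk; induction Hl as [|a l Ha Hl IH]; simpl; [easy|].
  destruct Hr as [->|Hr].
  - rewrite (Cprod_ext l g f), Hk; [ring|].
    intros b Hb; apply Hj; congruence.
  - rewrite IH, Hj by congruence; ring.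
Qed.

Lemma Csum_change {A} (l : list A) (r : A) (k : C) (f g : A -> C) :
  NoDup l -> In r l -> (forall j, j <> r -> g j = f j) -> g r = k + f r ->
  Csum l g = k + Csum l f.
Proof.
  intros Hl Hr Hj Hk; induction Hl as [|a l Ha Hl IH]; simpl; [easy|].
  destruct Hr as [->|Hr].
  - rewrite (Csum_ext l g f), Hk; [ring|].
    intros b Hb; apply Hj; congruence.
  - rewrite IH, Hj by congruence; ring.
Qed.

(** * Convergence of complex sequences in modulus *)

Definition Ccv (s : nat -> C) (l : C) : Prop :=
  is_lim_seq (fun n => Cmod (s n - l)) 0.

Lemma Cmod_sub_sym (x y : C) : Cmod (x - y) = Cmod (y - x).
Proof. rewrite <- (Cmod_opp (x - y)); f_equal; ring. Qed.

Lemma Ccv_squeeze (s : nat -> C) (l : C) (e : nat -> R) :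
  (forall n, (Cmod (s n - l) <= e n)%R) -> is_lim_seq e 0 -> Ccv s l.
Proof.
  intros H He; apply is_lim_seq_le_le with (fun _ => 0%R) e; auto.
  - intros n; split; [apply Cmod_ge_0 | apply H].
  - apply is_lim_seq_const.
Qed.

Lemma is_lim_seq_plus0 (u v : nat -> R) :
  is_lim_seq u 0 -> is_lim_seq v 0 -> is_lim_seq (fun n => u n + v n)%R 0.
Proof.
  intros Hu Hv; replace (Finite 0) with (Finite (0 + 0)) by (f_equal; ring).
  apply is_lim_seq_plus'; auto.
Qed.

Lemma is_lim_seq_scal0 (u : nat -> R) (c : R) :
  is_lim_seq u 0 -> is_lim_seq (fun n => c * u n)%R 0.
Proof.
  intros Hu; replace (Finite 0) with (Rbar_mult c 0) by (simpl; f_equal; ring).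
  apply is_lim_seq_scal_l; auto.
Qed.

Lemma Ccv_const (l : C) : Ccv (fun _ => l) l.
Proof.
  apply Ccv_squeeze with (fun _ => 0%R); [|apply is_lim_seq_const].
  intros _; replace (l - l) with (RtoC 0) by ring; rewrite Cmod_0; lra.
Qed.

Lemma Ccv_ext (s t : nat -> C) (l : C) :
  (forall n, s n = t n) -> Ccv s l -> Ccv t l.
Proof.
  intros H; apply is_lim_seq_ext; intros n; rewrite H; auto.
Qed.

Lemma Ccv_ext_loc (s t : nat -> C) (l : C) (n0 : nat) :
  (forall n, (n0 <= n)%nat -> s n = t n) -> Ccv s l -> Ccv t l.
Proof.
  intros H; apply is_lim_seq_ext_loc; exists n0; intros n Hn; rewrite H; auto.
Qed.

Lemma Ccv_plus (s t : nat -> C) (l m : C) :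
  Ccv s l -> Ccv t m -> Ccv (fun n => s n + t n) (l + m).
Proof.
  intros Hs Ht.
  apply Ccv_squeeze with (fun n => Cmod (s n - l) + Cmod (t n - m))%R;
    [|apply is_lim_seq_plus0; auto].
  intros n; replace (s n + t n - (l + m)) with ((s n - l) + (t n - m)) by ring.
  apply Cmod_triangle.
Qed.

Lemma Ccv_mult (s t : nat -> C) (l m : C) :
  Ccv s l -> Ccv t m -> Ccv (fun n => s n * t n) (l * m).
Proof.
  intros Hs Ht.
  apply Ccv_squeeze with (fun n => Cmod (s n - l) * Cmod (t n - m)
     + (Cmod l * Cmod (t n - m) + Cmod m * Cmod (s n - l)))%R.
  - intros n.
    replace (s n * t n - l * m) with
      ((s n - l) * (t n - m) + (l * (t n - m) + m * (s n - l))) by ring.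
    rewrite <- !Cmod_mult.
    eapply Rle_trans; [apply Cmod_triangle|].
    apply Rplus_le_compat_l, Cmod_triangle.
  - apply is_lim_seq_plus0.
    + replace (Finite 0) with (Finite (0 * 0)) by (f_equal; ring).
      apply is_lim_seq_mult'; auto.
    + apply is_lim_seq_plus0; apply is_lim_seq_scal0; auto.
Qed.

Lemma Ccv_scal (c : C) (s : nat -> C) (l : C) :
  Ccv s l -> Ccv (fun n => c * s n) (c * l).
Proof. apply Ccv_mult, Ccv_const. Qed.

Lemma Ccv_opp (s : nat -> C) (l : C) : Ccv s l -> Ccv (fun n => - s n) (- l).
Proof.
  apply is_lim_seq_ext; intros n.
  rewrite <- (Cmod_opp (s n - l)); f_equal; ring.
Qed.

Lemma Ccv_incr (s : nat -> C) (l : C) (p : nat) :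
  Ccv s l -> Ccv (fun n => s (n + p)%nat) l.
Proof. intros H; apply (is_lim_seq_incr_n (fun n => Cmod (s n - l)) p); auto. Qed.

Lemma Ccv_unique (s : nat -> C) (l m : C) : Ccv s l -> Ccv s m -> l = m.
Proof.
  intros Hs Ht.
  assert (H := is_lim_seq_plus0 _ _ Hs Ht).
  assert (H1 : Rbar_le (Cmod (l - m)) 0).
  { refine (is_lim_seq_le _ _ _ _ _ (is_lim_seq_const _) H).
    intros n; rewrite (Cmod_sub_sym (s n) l).
    replace (l - m) with ((l - s n) + (s n - m)) by ring; apply Cmod_triangle. }
  simpl in H1.
  assert (H2 : Cmod (l - m) = 0%R) by (generalize (Cmod_ge_0 (l - m)); lra).
  apply Cmod_eq_0 in H2.
  replace l with ((l - m) + m) by ring; rewrite H2; ring.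
Qed.

Lemma Im_le_Cmod (z : C) : (Rabs (Im z) <= Cmod z)%R.
Proof.
  eapply Rle_trans; [|apply Rmax_Cmod]; apply Rmax_r.
Qed.

(** [Clim] returns a value for every sequence, so genuine convergence has to be supplied; this is
    the passage from [Ccv] to the values used in the definitions of theta, eta, mu and nu. *)
Lemma Ccv_Clim (s : nat -> C) (l : C) : Ccv s l -> Clim s = l.
Proof.
  intros H; unfold Clim; destruct l as [a b].
  assert (Hg : forall (p : C -> R) (x : R),
    (forall n, (Rabs (p (s n) - x) <= Cmod (s n - (a, b)))%R) ->
    Lim_seq (fun n => p (s n)) = x).
  { intros p x Hp; apply is_lim_seq_unique.
    apply is_lim_seq_ext with (fun n => x + (p (s n) - x))%R; [intros; ring|].
    replace (Finite x) with (Finite (x + 0)) by (f_equal; ring).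
    apply is_lim_seq_plus'; [apply is_lim_seq_const|].
    apply is_lim_seq_abs_0.
    apply is_lim_seq_le_le with (fun _ => 0%R) (fun n => Cmod (s n - (a, b))); auto.
    - intros n; split; [apply Rabs_pos | apply Hp].
    - apply is_lim_seq_const. }
  rewrite (Hg Re a), (Hg Im b); auto; intros n.
  - exact (Im_le_Cmod (s n - (a, b))).
  - exact (re_le_Cmod (s n - (a, b))).
Qed.

Lemma Csum_cv {A} (l : list A) (f : nat -> A -> C) (g : A -> C) :
  (forall a, In a l -> Ccv (fun n => f n a) (g a)) ->
  Ccv (fun n => Csum l (f n)) (Csum l g).
Proof.
  induction l as [|a l IH]; simpl; intros H; [apply Ccv_const|].
  apply Ccv_plus; auto.
Qed.

Lemma Ccv_bound (s : nat -> C) (l : C) (B : R) :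
  (forall n, (Cmod (s n) <= B)%R) -> Ccv s l -> (Cmod l <= B)%R.
Proof.
  intros Hs H.
  assert (H0 : is_lim_seq (fun n => B + Cmod (s n - l))%R (B + 0)%R).
  { apply is_lim_seq_plus'; [apply is_lim_seq_const | exact H]. }
  assert (H1 : Rbar_le (Cmod l) (B + 0)%R).
  { refine (is_lim_seq_le _ _ _ _ _ (is_lim_seq_const _) H0).
    intros n; replace l with (s n + (l - s n)) at 1 by ring.
    eapply Rle_trans; [apply Cmod_triangle|].
    rewrite (Cmod_sub_sym l); specialize (Hs n); lra. }
  simpl in H1; lra.
Qed.

(** * Sums over the integers *)

Definition zs (f : Z -> C) : C := Clim (fun M => Csum (zrange M) f).

Lemma zrange_S_perm (M : nat) :
  Permutation (zrange (S M))
    (Z.of_nat (S M) :: (- Z.of_nat (S M))%Z :: zrange M).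
Proof.
  unfold zrange.
  replace (2 * S M + 1)%nat with (S (S (2 * M + 1))) by lia.
  remember (2 * M + 1)%nat as p eqn:Hp.
  rewrite <- cons_seq, seq_S, map_cons, map_app, <- seq_shift, map_map.
  rewrite (map_ext (fun x => (Z.of_nat (S x) - Z.of_nat (S M))%Z)
     (fun i => (Z.of_nat i - Z.of_nat M)%Z)) by (intros; lia).
  unfold map at 2.
  replace (Z.of_nat (1 + p) - Z.of_nat (S M))%Z with (Z.of_nat (S M)) by lia.
  replace (Z.of_nat 0 - Z.of_nat (S M))%Z with (- Z.of_nat (S M))%Z by lia.
  apply Permutation_sym, (Permutation_cons_append
    ((- Z.of_nat (S M))%Z :: map _ _)).
Qed.

Lemma Csum_zrange_S (M : nat) (f : Z -> C) :
  Csum (zrange (S M)) f =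
  f (Z.of_nat (S M)) + (f (- Z.of_nat (S M))%Z + Csum (zrange M) f).
Proof. rewrite (Csum_perm _ _ _ (zrange_S_perm M)); reflexivity. Qed.

Lemma Csum_zrange_0 (f : Z -> C) : Csum (zrange 0) f = f 0%Z.
Proof. simpl; ring. Qed.

(** One geometric majorant in |k| serves as convergence certificate, as bound for the sum and as
    dominating function; the constants stay explicit so that a whole family can share them. *)
Definition dom (c s : R) (f : Z -> C) : Prop :=
  forall k, (Cmod (f k) <= c * s ^ Z.abs_nat k)%R.

(** The term k = 0 contributes at most c and the pairs k, -k together at most 2 c / (1 - s); 3 / (1
    - s) bounds 1 + 2 / (1 - s). *)
Definition geo (s : R) : R := (3 / (1 - s))%R.

Lemma dom_nonneg (c s : R) (f : Z -> C) : dom c s f -> (0 <= c)%R.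
Proof.
  intros H; generalize (H 0%Z) (Cmod_ge_0 (f 0%Z)); simpl; lra.
Qed.

Lemma abs_nat_pos (n : nat) : Z.abs_nat (Z.of_nat n) = n.
Proof. lia. Qed.

Lemma abs_nat_neg (n : nat) : Z.abs_nat (- Z.of_nat n) = n.
Proof. lia. Qed.

Lemma dom_step (c s : R) (f : Z -> C) (n : nat) : dom c s f ->
  (Cmod (f (Z.of_nat n) + f (- Z.of_nat n)%Z) <= 2 * c * s ^ n)%R.
Proof.
  intros H; eapply Rle_trans; [apply Cmod_triangle|].
  generalize (H (Z.of_nat n)) (H (- Z.of_nat n)%Z).
  rewrite abs_nat_pos, abs_nat_neg; lra.
Qed.

(** The telescoping form s^M - s^(M+p) is what the induction on p reproduces: its increase pays 2 c
    s^(M+p), more than the cost of the new pair. *)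
Lemma dom_diff (c s : R) (f : Z -> C) (M p : nat) : (0 < s < 1)%R -> dom c s f ->
  (Cmod (Csum (zrange (M + p)) f - Csum (zrange M) f)
     <= c * (2 / (1 - s)) * (s ^ M - s ^ (M + p)))%R.
Proof.
  intros Hs Hf; assert (Hc := dom_nonneg _ _ _ Hf).
  induction p as [|p IH].
  - rewrite Nat.add_0_r.
    replace (Csum (zrange M) f - Csum (zrange M) f) with (RtoC 0) by ring.
    rewrite Cmod_0; lra.
  - rewrite Nat.add_succ_r, Csum_zrange_S.
    set (x := Csum (zrange (M + p)) f) in *; set (y := Csum (zrange M) f) in *.
    assert (Hd := dom_step c s f (S (M + p)) Hf).
    set (a := f _) in *; set (b := f (- _)%Z) in *.
    replace (a + (b + x) - y) with ((a + b) + (x - y)) by ring.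
    eapply Rle_trans; [apply Cmod_triangle|].
    assert (0 < s ^ (M + p))%R by (apply pow_lt; lra).
    replace (c * (2 / (1 - s)) * (s ^ M - s ^ S (M + p)))%R with
      (2 * c * s ^ (M + p) + c * (2 / (1 - s)) * (s ^ M - s ^ (M + p)))%R
      by (simpl pow; field; lra).
    apply Rplus_le_compat; auto.
    eapply Rle_trans; [exact Hd|].
    apply Rmult_le_compat_l; [lra|].
    simpl; nra.
Qed.

Lemma geo_split (s : R) : (0 < s < 1)%R -> (0 < 2 / (1 - s) /\ 1 + 2 / (1 - s) <= geo s)%R.
Proof.
  intros Hs; unfold geo.
  assert (1 <= / (1 - s))%R.
  { rewrite <- Rinv_1 at 1; apply Rinv_le_contravar; lra. }
  unfold Rdiv; lra.
Qed.

Lemma dom_partial (c s : R) (f : Z -> C) (M : nat) : (0 < s < 1)%R -> dom c s f ->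
  (Cmod (Csum (zrange M) f) <= c * geo s)%R.
Proof.
  intros Hs Hf; assert (Hc := dom_nonneg _ _ _ Hf).
  assert (H := dom_diff c s f 0 M Hs Hf); rewrite Csum_zrange_0 in H; simpl in H.
  assert (0 < s ^ M)%R by (apply pow_lt; lra).
  assert (Hf0 := Hf 0%Z); simpl in Hf0.
  destruct (geo_split s Hs) as [G1 G2].
  replace (Csum (zrange M) f) with ((Csum (zrange M) f - f 0%Z) + f 0%Z) by ring.
  eapply Rle_trans; [apply Cmod_triangle|].
  apply Rle_trans with (c * (2 / (1 - s)) * 1 + c * 1)%R; [|nra].
  apply Rplus_le_compat; [|lra].
  eapply Rle_trans; [exact H|].
  apply Rmult_le_compat_l; nra.
Qed.

Lemma dom_cv (c s : R) (f : Z -> C) : (0 < s < 1)%R -> dom c s f ->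
  Ccv (fun M => Csum (zrange M) f) (zs f).
Proof.
  intros Hs Hf.
  (* Real and imaginary parts are treated at once: [p] is any additive functional bounded by the
     modulus. *)
  assert (Hp : forall p : C -> R, (forall a b, p (a - b) = (p a - p b)%R) ->
    (forall a, (Rabs (p a) <= Cmod a)%R) ->
    exists x : R, is_lim_seq (fun M => p (Csum (zrange M) f)) x).
  { intros p Hm Hb.
    assert (Hx : ex_finite_lim_seq (fun M => p (Csum (zrange M) f))).
    { apply ex_lim_seq_cauchy_corr; intros eps.
      assert (Hg : is_lim_seq (fun M => c * (2 / (1 - s)) * s ^ M)%R 0).
      { apply is_lim_seq_scal0, is_lim_seq_geom; rewrite Rabs_pos_eq; lra. }
      apply is_lim_seq_spec in Hg; destruct (Hg eps) as [n0 Hn0].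
      assert (Hc := dom_nonneg _ _ _ Hf).
      destruct (geo_split s Hs) as [G1 G2].
      assert (Hle : forall n m, (n0 <= n)%nat -> (n <= m)%nat ->
        (Rabs (p (Csum (zrange m) f) - p (Csum (zrange n) f)) < eps)%R).
      { intros n m Hn Hm'; rewrite <- Hm.
        replace m with (n + (m - n))%nat by lia.
        eapply Rle_lt_trans; [apply Hb|].
        eapply Rle_lt_trans; [apply dom_diff; eauto|].
        specialize (Hn0 n Hn); rewrite Rminus_0_r in Hn0.
        apply Rle_lt_trans with (2 := Hn0).
        eapply Rle_trans; [|apply Rle_abs].
        assert (0 < s ^ (n + (m - n)))%R by (apply pow_lt; lra).
        apply Rmult_le_compat_l; nra. }
      exists n0; intros n m Hn Hm'.
      destruct (Nat.le_ge_cases n m); [|apply Hle; auto].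
      rewrite <- Rabs_Ropp, Ropp_minus_distr; apply Hle; auto. }
    destruct Hx as [x Hx]; exists x; auto. }
  destruct (Hp Re) as [x Hx];
    [intros [] []; simpl; ring | intros; apply re_le_Cmod |].
  destruct (Hp Im) as [y Hy];
    [intros [] []; simpl; ring | intros; apply Im_le_Cmod |].
  assert (Hz : zs f = (x, y)).
  { unfold zs, Clim.
    rewrite (is_lim_seq_unique _ _ Hx), (is_lim_seq_unique _ _ Hy); reflexivity. }
  rewrite Hz.
  assert (H0 : forall (g : nat -> R) (l : R), is_lim_seq g l ->
    is_lim_seq (fun n => Rabs (g n - l)) 0).
  { intros g l Hg; apply (proj1 (is_lim_seq_abs_0 _)).
    replace (Finite 0) with (Finite (l - l)) by (f_equal; ring).
    apply is_lim_seq_minus'; auto; apply is_lim_seq_const. }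
  apply Ccv_squeeze with (fun M => Rabs (Re (Csum (zrange M) f) - x)
    + Rabs (Im (Csum (zrange M) f) - y))%R; [|apply is_lim_seq_plus0; auto].
  intros n; destruct (Csum (zrange n) f) as [a b]; simpl.
  replace ((a, b) - (x, y)) with (RtoC (a - x) + Ci * RtoC (b - y))
    by (unfold RtoC, Ci, Cplus, Cmult, Cminus, Copp; simpl; apply injective_projections; simpl; ring).
  eapply Rle_trans; [apply Cmod_triangle|].
  rewrite Cmod_mult, Cmod_Ci, !Cmod_R; lra.
Qed.

Lemma zs_bound (c s : R) (f : Z -> C) : (0 < s < 1)%R -> dom c s f ->
  (Cmod (zs f) <= c * geo s)%R.
Proof.
  intros Hs Hf; eapply Ccv_bound; [|apply (dom_cv c s); auto].
  intros n; apply dom_partial; auto.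
Qed.

Lemma zs_tail (c s : R) (f : Z -> C) (M : nat) : (0 < s < 1)%R -> dom c s f ->
  (Cmod (zs f - Csum (zrange M) f) <= c * geo s * s ^ M)%R.
Proof.
  intros Hs Hf; assert (Hc := dom_nonneg _ _ _ Hf).
  apply (Ccv_bound (fun p => Csum (zrange (p + M)) f + - Csum (zrange M) f)).
  - intros p; rewrite Nat.add_comm.
    eapply Rle_trans; [apply dom_diff; eauto|].
    destruct (geo_split s Hs) as [G1 G2].
    assert (0 < s ^ (M + p))%R by (apply pow_lt; lra).
    assert (0 < s ^ M)%R by (apply pow_lt; lra).
    apply Rle_trans with (c * (2 / (1 - s)) * s ^ M)%R.
    + apply Rmult_le_compat_l; nra.
    + apply Rmult_le_compat_r; nra.
  - apply Ccv_plus; [|apply Ccv_const].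
    apply (Ccv_incr (fun n => Csum (zrange n) f)), (dom_cv c s); auto.
Qed.

Lemma zs_ext (f g : Z -> C) : (forall k, f k = g k) -> zs f = zs g.
Proof.
  intros H; unfold zs; f_equal; apply functional_extensionality; intros M.
  apply Csum_ext; auto.
Qed.

Lemma zs_unique (c s : R) (f : Z -> C) (l : C) : (0 < s < 1)%R -> dom c s f ->
  Ccv (fun M => Csum (zrange M) f) l -> zs f = l.
Proof. intros Hs Hf H; eapply Ccv_unique; [apply (dom_cv c s) | ]; eauto. Qed.

(** Tannery's theorem: the common majorant makes both tails beyond a fixed M small uniformly in n,
    and the finitely many remaining terms converge. *)
Lemma dom_tannery (c s : R) (f : nat -> Z -> C) (g : Z -> C) : (0 < s < 1)%R ->
  (forall n, dom c s (f n)) -> (forall k, Ccv (fun n => f n k) (g k)) ->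
  dom c s g /\ Ccv (fun n => zs (f n)) (zs g).
Proof.
  intros Hs Hf Hg.
  assert (Hd : dom c s g).
  { intros k; apply (Ccv_bound (fun n => f n k)); auto.
    intros n; apply Hf. }
  split; auto.
  assert (Hc := dom_nonneg _ _ _ Hd).
  assert (Hp : is_lim_seq (fun M => 2 * (c * geo s) * s ^ M)%R 0).
  { apply is_lim_seq_scal0, is_lim_seq_geom; rewrite Rabs_pos_eq; lra. }
  unfold Ccv; apply is_lim_seq_spec; intros eps.
  apply is_lim_seq_spec in Hp.
  destruct (Hp (pos_div_2 eps)) as [M HM].
  specialize (HM M (le_n M)); rewrite Rminus_0_r in HM.
  assert (HM' := Rle_lt_trans _ _ _ (Rle_abs _) HM).
  assert (Hfin := Csum_cv (zrange M) f g (fun k _ => Hg k)).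
  apply is_lim_seq_spec in Hfin.
  destruct (Hfin (pos_div_2 eps)) as [n0 Hn0].
  exists n0; intros n Hn; specialize (Hn0 n Hn).
  rewrite Rminus_0_r, Rabs_pos_eq in * by apply Cmod_ge_0.
  assert (T1 := zs_tail c s (f n) M Hs (Hf n)).
  assert (T2 := zs_tail c s g M Hs Hd).
  rewrite Cmod_sub_sym in T2.
  replace (zs (f n) - zs g) with
    ((zs (f n) - Csum (zrange M) (f n)) +
     ((Csum (zrange M) g - zs g) + (Csum (zrange M) (f n) - Csum (zrange M) g))) by ring.
  eapply Rle_lt_trans; [apply Cmod_triangle|].
  eapply Rle_lt_trans; [apply Rplus_le_compat_l, Cmod_triangle|].
  simpl in *; lra.
Qed.

Lemma dom_weaken (c c' s s' : R) (f : Z -> C) :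
  (0 <= s <= s')%R -> (c <= c')%R -> dom c s f -> dom c' s' f.
Proof.
  intros Hs Hc Hf k; assert (H0 := dom_nonneg _ _ _ Hf).
  eapply Rle_trans; [apply Hf|].
  apply Rmult_le_compat; auto; [apply pow_le; lra | apply pow_incr; lra].
Qed.

Lemma dom_plus (c d s : R) (f g : Z -> C) :
  dom c s f -> dom d s g -> dom (c + d) s (fun k => f k + g k).
Proof.
  intros Hf Hg k; eapply Rle_trans; [apply Cmod_triangle|].
  generalize (Hf k) (Hg k); lra.
Qed.

Lemma dom_scal (c s : R) (a : C) (f : Z -> C) :
  dom c s f -> dom (Cmod a * c) s (fun k => a * f k).
Proof.
  intros Hf k; rewrite Cmod_mult, Rmult_assoc.
  apply Rmult_le_compat_l; [apply Cmod_ge_0 | apply Hf].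
Qed.

Lemma zs_plus (c d s : R) (f g : Z -> C) : (0 < s < 1)%R -> dom c s f -> dom d s g ->
  zs (fun k => f k + g k) = zs f + zs g.
Proof.
  intros Hs Hf Hg.
  apply (zs_unique (c + d) s); auto; [apply dom_plus; auto|].
  eapply Ccv_ext; [intros n; symmetry; apply Csum_plus|].
  apply Ccv_plus; eapply dom_cv; eauto.
Qed.

Lemma zs_scal (c s : R) (a : C) (f : Z -> C) : (0 < s < 1)%R -> dom c s f ->
  zs (fun k => a * f k) = a * zs f.
Proof.
  intros Hs Hf.
  apply (zs_unique (Cmod a * c) s); auto; [apply dom_scal; auto|].
  eapply Ccv_ext; [intros n; symmetry; apply Csum_scal|].
  apply Ccv_scal; eapply dom_cv; eauto.
Qed.

Lemma zs_refl (f : Z -> C) : zs (fun k => f (- k)%Z) = zs f.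
Proof.
  unfold zs; f_equal; apply functional_extensionality; intros M.
  induction M as [|M IH]; [rewrite !Csum_zrange_0; reflexivity|].
  rewrite !Csum_zrange_S, IH, Z.opp_involutive; ring.
Qed.

Lemma dom_shift1 (c s : R) (f : Z -> C) : (0 < s < 1)%R -> dom c s f ->
  dom (c / s) s (fun k => f (k + 1)%Z).
Proof.
  intros Hs Hf k; assert (H0 := dom_nonneg _ _ _ Hf).
  eapply Rle_trans; [apply Hf|].
  replace (c / s * s ^ Z.abs_nat k)%R with (c * (/ s * s ^ Z.abs_nat k))%R
    by (unfold Rdiv; ring).
  apply Rmult_le_compat_l; auto.
  apply Rmult_le_reg_l with s; [lra|].
  replace (s * (/ s * s ^ Z.abs_nat k))%R with (s ^ Z.abs_nat k)%R by (field; lra).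
  rewrite tech_pow_Rmult.
  assert (Hk : exists d, (S (Z.abs_nat (k + 1)) = Z.abs_nat k + d)%nat)
    by (exists (S (Z.abs_nat (k + 1)) - Z.abs_nat k)%nat; lia).
  destruct Hk as [d ->]; rewrite pow_add.
  assert (s ^ d <= 1)%R by (rewrite <- (pow1 d); apply pow_incr; lra).
  assert (0 < s ^ Z.abs_nat k)%R by (apply pow_lt; lra).
  nra.
Qed.

Lemma zs_shift1 (c s : R) (f : Z -> C) : (0 < s < 1)%R -> dom c s f ->
  zs (fun k => f (k + 1)%Z) = zs f.
Proof.
  intros Hs Hf; apply (zs_unique (c / s) s); auto; [apply dom_shift1; auto|].
  (* Shifting the window brings in the term at M + 1 and drops the one at -M; both are geometrically
     small. *)
  assert (E : forall M, Csum (zrange M) (fun k => f (k + 1)%Z)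
     = Csum (zrange M) f + (f (Z.of_nat M + 1)%Z - f (- Z.of_nat M)%Z)).
  { induction M as [|M IH]; [rewrite !Csum_zrange_0; simpl; ring|].
    rewrite !Csum_zrange_S, IH.
    replace (- Z.of_nat (S M) + 1)%Z with (- Z.of_nat M)%Z by lia.
    replace (Z.of_nat M + 1)%Z with (Z.of_nat (S M)) by lia; ring. }
  eapply Ccv_ext; [intros M; symmetry; apply E|].
  replace (zs f) with (zs f + 0) at 1 by ring.
  apply Ccv_plus; [eapply dom_cv; eauto|].
  assert (H0 := dom_nonneg _ _ _ Hf).
  apply Ccv_squeeze with (fun M => (2 * c) * s ^ M)%R.
  - intros M.
    replace (f (Z.of_nat M + 1)%Z - f (- Z.of_nat M)%Z - 0) with
      (f (Z.of_nat M + 1)%Z + - f (- Z.of_nat M)%Z) by ring.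
    eapply Rle_trans; [apply Cmod_triangle|]; rewrite Cmod_opp.
    assert (A := Hf (Z.of_nat M + 1)%Z); assert (B := Hf (- Z.of_nat M)%Z).
    rewrite abs_nat_neg in B.
    replace (Z.abs_nat (Z.of_nat M + 1)) with (S M) in A by lia; simpl in A.
    assert (0 < s ^ M)%R by (apply pow_lt; lra).
    assert (0 <= c * s ^ M)%R by nra.
    nra.
  - apply is_lim_seq_scal0, is_lim_seq_geom; rewrite Rabs_pos_eq; lra.
Qed.

Lemma zs_shift_nat (s : R) (f : Z -> C) (p : nat) (c : R) : (0 < s < 1)%R -> dom c s f ->
  zs (fun k => f (k + Z.of_nat p)%Z) = zs f.
Proof.
  intros Hs; revert c f; induction p as [|p IH]; intros c f Hf.
  - apply zs_ext; intros k; f_equal; lia.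
  - rewrite <- (zs_shift1 c s f Hs Hf).
    rewrite <- (IH (c / s)%R (fun k => f (k + 1)%Z)); [|apply dom_shift1; auto].
    apply zs_ext; intros k; f_equal; lia.
Qed.

Lemma dom_shift (c s : R) (f : Z -> C) (p : Z) : (0 < s < 1)%R -> dom c s f ->
  dom (c / s ^ Z.abs_nat p) s (fun k => f (k + p)%Z).
Proof.
  intros Hs Hf k; assert (H0 := dom_nonneg _ _ _ Hf).
  eapply Rle_trans; [apply Hf|].
  assert (0 < s ^ Z.abs_nat p)%R by (apply pow_lt; lra).
  apply Rmult_le_reg_r with (s ^ Z.abs_nat p)%R; auto.
  replace (c / s ^ Z.abs_nat p * s ^ Z.abs_nat k * s ^ Z.abs_nat p)%R
    with (c * s ^ Z.abs_nat k)%R by (field; lra).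
  rewrite Rmult_assoc, <- pow_add; apply Rmult_le_compat_l; auto.
  assert (Hk : exists d, (Z.abs_nat (k + p) + Z.abs_nat p = Z.abs_nat k + d)%nat)
    by (exists (Z.abs_nat (k + p) + Z.abs_nat p - Z.abs_nat k)%nat; lia).
  destruct Hk as [d ->]; rewrite pow_add.
  assert (s ^ d <= 1)%R by (rewrite <- (pow1 d); apply pow_incr; lra).
  assert (0 < s ^ Z.abs_nat k)%R by (apply pow_lt; lra).
  nra.
Qed.

Lemma zs_shift (c s : R) (f : Z -> C) (p : Z) : (0 < s < 1)%R -> dom c s f ->
  zs (fun k => f (k + p)%Z) = zs f.
Proof.
  intros Hs Hf; destruct (Z.le_ge_cases 0 p) as [Hp|Hp].
  - rewrite <- (Z2Nat.id p Hp); eapply zs_shift_nat; eauto.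
  - rewrite <- (zs_shift_nat s (fun k => f (k + p)%Z) (Z.to_nat (- p)) _ Hs
      (dom_shift c s f p Hs Hf)).
    apply zs_ext; intros k; f_equal; lia.
Qed.

Lemma dom2_fix (c s : R) (F : Z -> Z -> C) : (0 < s < 1)%R ->
  (forall n m, Cmod (F n m) <= c * s ^ Z.abs_nat n * s ^ Z.abs_nat m)%R ->
  (forall n, dom (c * s ^ Z.abs_nat n) s (F n)) /\ dom (c * geo s) s (fun n => zs (F n)).
Proof.
  intros Hs HF; split; [intros n m; apply HF|].
  intros n; eapply Rle_trans; [apply (zs_bound (c * s ^ Z.abs_nat n) s); auto|].
  - intros m; apply HF.
  - lra.
Qed.

Lemma zs_Csum {A} (l : list A) (s : R) (f : A -> Z -> C) : (0 < s < 1)%R ->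
  (forall a, exists c, dom c s (f a)) ->
  (exists c, dom c s (fun k => Csum l (fun a => f a k))) /\
  zs (fun k => Csum l (fun a => f a k)) = Csum l (fun a => zs (f a)).
Proof.
  intros Hs Hf; induction l as [|a l [[c Hc] IH]]; simpl.
  - assert (D : dom 0 s (fun _ => 0)) by (intros k; rewrite Cmod_0; lra).
    split; [exists 0%R; auto|].
    apply (zs_unique 0 s); auto.
    apply Ccv_ext with (fun _ => 0); [|apply Ccv_const].
    intros M; induction (zrange M) as [|z r IHr]; simpl; auto.
    rewrite <- IHr; ring.
  - destruct (Hf a) as [d Hd]; split.
    + exists (d + c)%R; apply dom_plus; auto.
    + rewrite (zs_plus d c s); auto; congruence.
Qed.

(** The exchange is exact for partial sums in n by linearity; [dom_tannery] in m carries it to the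
    limit. *)
Lemma zs_fubini (c s : R) (F : Z -> Z -> C) : (0 < s < 1)%R ->
  (forall n m, Cmod (F n m) <= c * s ^ Z.abs_nat n * s ^ Z.abs_nat m)%R ->
  zs (fun n => zs (fun m => F n m)) = zs (fun m => zs (fun n => F n m)).
Proof.
  intros Hs HF; destruct (dom2_fix c s F Hs HF) as [D1 D2].
  assert (D3 : forall m, dom (c * s ^ Z.abs_nat m) s (fun n => F n m)).
  { intros m n; generalize (HF n m); lra. }
  eapply Ccv_unique; [apply (dom_cv (c * geo s) s); auto|].
  apply Ccv_ext with (fun M => zs (fun m => Csum (zrange M) (fun n => F n m))).
  - intros M; apply (zs_Csum (zrange M) s F Hs).
    intros n; eexists; apply D1.
  - apply (dom_tannery (c * geo s) s); auto.
    + intros M m; eapply Rle_trans; [apply (dom_partial (c * s ^ Z.abs_nat m) s); auto|].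
      lra.
    + intros m; apply (dom_cv (c * s ^ Z.abs_nat m) s); auto.
Qed.

(** Forgets the constants, so that linearity and shifts act as rewriting rules without carrying
    majorants along. *)
Definition summ (f : Z -> C) : Prop := exists c s, (0 < s < 1)%R /\ dom c s f.

Lemma summ2 (f g : Z -> C) : summ f -> summ g ->
  exists c d s, (0 < s < 1)%R /\ dom c s f /\ dom d s g.
Proof.
  intros (c & s & Hs & Hf) (d & t & Ht & Hg).
  assert (M1 := Rmax_l s t); assert (M2 := Rmax_r s t).
  exists c, d, (Rmax s t); split; [split; [lra | apply Rmax_lub_lt; lra]|].
  split; [apply dom_weaken with c s | apply dom_weaken with d t]; auto; lra.
Qed.

Lemma summ_cv (f : Z -> C) : summ f -> Ccv (fun M => Csum (zrange M) f) (zs f).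
Proof. intros (c & s & Hs & Hf); eapply dom_cv; eauto. Qed.

Lemma summ_plus (f g : Z -> C) : summ f -> summ g ->
  summ (fun k => f k + g k) /\ zs (fun k => f k + g k) = zs f + zs g.
Proof.
  intros Hf Hg; destruct (summ2 f g Hf Hg) as (c & d & s & Hs & Df & Dg).
  split; [exists (c + d)%R, s; split; auto; apply dom_plus; auto|].
  eapply zs_plus; eauto.
Qed.

Lemma summ_scal (a : C) (f : Z -> C) : summ f ->
  summ (fun k => a * f k) /\ zs (fun k => a * f k) = a * zs f.
Proof.
  intros (c & s & Hs & Hf).
  split; [exists (Cmod a * c)%R, s; split; auto; apply dom_scal; auto|].
  eapply zs_scal; eauto.
Qed.

Lemma summ_shift (f : Z -> C) (p : Z) : summ f ->
  summ (fun k => f (k + p)%Z) /\ zs (fun k => f (k + p)%Z) = zs f.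
Proof.
  intros (c & s & Hs & Hf); split; [|eapply zs_shift; eauto].
  eexists; exists s; split; auto; apply dom_shift; eauto.
Qed.

(** * Rapidly decreasing sequences and their Laurent series *)

(** Decay faster than every geometric sequence is the condition for convergence of the Laurent
    series at every v, since |e(kv)| may grow geometrically in |k| at any rate. *)
Definition RD (a : Z -> C) : Prop :=
  forall s, (0 < s < 1)%R -> exists c, dom c s a.

Lemma RD_summ (a : Z -> C) : RD a -> summ a.
Proof.
  intros H; destruct (H (/ 2)%R) as [c Hc]; [lra|].
  exists c, (/ 2)%R; split; auto; lra.
Qed.

Lemma RD_ext (a b : Z -> C) : (forall k, a k = b k) -> RD a -> RD b.
Proof.
  intros E H s Hs; destruct (H s Hs) as [c Hc]; exists c; intros k.
  rewrite <- E; auto.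
Qed.

Lemma RD_plus (a b : Z -> C) : RD a -> RD b -> RD (fun k => a k + b k).
Proof.
  intros Ha Hb s Hs; destruct (Ha s Hs) as [c Hc]; destruct (Hb s Hs) as [d Hd].
  exists (c + d)%R; apply dom_plus; auto.
Qed.

(** Growth A^|k| is absorbed by asking for the decay rate s / A in place of s. *)
Lemma RD_mult_exp (a g : Z -> C) (A B : R) : (1 <= A)%R ->
  (forall k, (Cmod (g k) <= B * A ^ Z.abs_nat k)%R) -> RD a -> RD (fun k => a k * g k).
Proof.
  intros HA Hg Ha s Hs.
  destruct (Ha (s / A)%R) as [c Hc].
  { split; [apply Rdiv_lt_0_compat; lra|].
    apply Rmult_lt_reg_r with A; [lra|].
    unfold Rdiv; rewrite Rmult_assoc, Rinv_l; nra. }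
  exists (c * B)%R; intros k; rewrite Cmod_mult.
  replace (c * B * s ^ Z.abs_nat k)%R with
    ((c * (s / A) ^ Z.abs_nat k) * (B * A ^ Z.abs_nat k))%R.
  - apply Rmult_le_compat; auto using Cmod_ge_0.
  - replace s with ((s / A) * A)%R at 2 by (field; lra).
    rewrite Rpow_mult_distr; ring.
Qed.

Definition Zbounded (g : Z -> C) : Prop := exists B, forall k, (Cmod (g k) <= B)%R.

Lemma RD_mult_bd (a g : Z -> C) : Zbounded g -> RD a -> RD (fun k => a k * g k).
Proof.
  intros [B HB]; apply (RD_mult_exp a g 1 B); [lra|].
  intros k; rewrite pow1, Rmult_1_r; auto.
Qed.

Lemma bounded_const (l : C) : Zbounded (fun _ => l).
Proof. exists (Cmod l); intros; lra. Qed.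

Lemma RD_scal (l : C) (a : Z -> C) : RD a -> RD (fun k => l * a k).
Proof.
  intros H; apply RD_ext with (fun k => a k * l); [intros; ring|].
  apply RD_mult_bd; auto; apply bounded_const.
Qed.

Lemma bounded_eventually (g : Z -> C) (M : nat) (B : R) :
  (forall k, (M <= Z.abs_nat k)%nat -> (Cmod (g k) <= B)%R) -> Zbounded g.
Proof.
  revert B; induction M as [|M IH]; intros B H.
  - exists B; intros k; apply H; lia.
  - apply (IH (Rmax B (Rmax (Cmod (g (Z.of_nat M))) (Cmod (g (- Z.of_nat M)%Z))))).
    intros k Hk; destruct (Nat.eq_dec (Z.abs_nat k) M) as [E|E].
    + eapply Rle_trans; [|apply Rmax_r].
      assert (E' : k = Z.of_nat M \/ k = (- Z.of_nat M)%Z) by lia.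
      destruct E' as [->| ->]; [apply Rmax_l | apply Rmax_r].
    + eapply Rle_trans; [apply H; lia | apply Rmax_l].
Qed.

Definition conv (a b : Z -> C) (m : Z) : C := zs (fun n => a n * b (m - n)%Z).

(** The rate s * s of the first factor is split: one s^|n| joins s^|m - n| to give s^|m| by the
    triangle inequality, the other remains for the sum over n. *)
Lemma conv_dom (c d s : R) (a b : Z -> C) : (0 < s < 1)%R ->
  dom c (s * s) a -> dom d s b ->
  forall n m, (Cmod (a n * b (m - n)%Z) <= c * d * s ^ Z.abs_nat n * s ^ Z.abs_nat m)%R.
Proof.
  intros Hs Ha Hb n m; rewrite Cmod_mult.
  assert (H1 := dom_nonneg _ _ _ Ha); assert (H2 := dom_nonneg _ _ _ Hb).
  apply Rle_trans with ((c * (s * s) ^ Z.abs_nat n) * (d * s ^ Z.abs_nat (m - n)))%R.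
  - apply Rmult_le_compat; auto using Cmod_ge_0.
  - rewrite Rpow_mult_distr.
    assert (0 < s ^ Z.abs_nat n)%R by (apply pow_lt; lra).
    assert (0 < s ^ Z.abs_nat m)%R by (apply pow_lt; lra).
    assert (s ^ Z.abs_nat n * s ^ Z.abs_nat (m - n) <= s ^ Z.abs_nat m)%R.
    { rewrite <- pow_add.
      assert (Hk : exists e, (Z.abs_nat n + Z.abs_nat (m - n) = Z.abs_nat m + e)%nat)
        by (exists (Z.abs_nat n + Z.abs_nat (m - n) - Z.abs_nat m)%nat; lia).
      destruct Hk as [e ->]; rewrite pow_add.
      assert (s ^ e <= 1)%R by (rewrite <- (pow1 e); apply pow_incr; lra).
      nra. }
    assert (0 <= c * d * s ^ Z.abs_nat n)%R by (apply Rmult_le_pos; nra).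
    nra.
Qed.

Lemma RD_conv (a b : Z -> C) : RD a -> RD b -> RD (conv a b).
Proof.
  intros Ha Hb s Hs.
  destruct (Ha (s * s)%R) as [c Hc]; [nra|].
  destruct (Hb s Hs) as [d Hd].
  exists (c * d * geo s)%R; intros m; unfold conv.
  eapply Rle_trans; [apply (zs_bound (c * d * s ^ Z.abs_nat m) s); auto|].
  - intros n; generalize (conv_dom c d s a b Hs Hc Hd n m); lra.
  - lra.
Qed.

(** Fubini with m = n + k. With g = 1 it multiplies Laurent series; with g a kernel such as 1 / (1 -
    e(u) q^m) it groups a multiple sum by its total index. *)
Lemma conv_sum (a b g : Z -> C) : RD a -> RD b -> Zbounded g ->
  zs (fun m => conv a b m * g m) = zs (fun n => a n * zs (fun k => b k * g (n + k)%Z)).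
Proof.
  intros Ha Hb Hg.
  assert (Hs : (0 < / 2 < 1)%R) by lra.
  destruct (Ha (/ 2 * / 2)%R) as [c Hc]; [lra|].
  destruct (Hb (/ 2)%R Hs) as [d Hd].
  assert (HF := conv_dom c d _ a b Hs Hc Hd).
  destruct Hg as [B HB].
  rewrite (zs_ext _ (fun m => zs (fun n => a n * b (m - n)%Z * g m))).
  2:{ intros m; unfold conv; rewrite Cmult_comm.
      rewrite (zs_ext (fun n => a n * b (m - n)%Z * g m)
        (fun n => g m * (a n * b (m - n)%Z))) by (intros; ring).
      symmetry; apply summ_scal.
      exists (c * d * (/ 2) ^ Z.abs_nat m)%R, (/ 2)%R; split; auto.
      intros n; generalize (HF n m); lra. }
  rewrite (zs_fubini (c * d * B) (/ 2) (fun m n => a n * b (m - n)%Z * g m)); auto.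
  - apply zs_ext; intros n.
    rewrite (zs_ext _ (fun m => a n * (fun k => b k * g (n + k)%Z) (m + - n)%Z)).
    2:{ intros m; replace (m + - n)%Z with (m - n)%Z by lia.
        replace (n + (m - n))%Z with m by lia; ring. }
    assert (Hsum : summ (fun k => b k * g (n + k)%Z)).
    { apply RD_summ, RD_mult_bd; auto; exists B; auto. }
    destruct (summ_shift _ (- n) Hsum) as [S1 S2].
    rewrite <- S2; apply summ_scal; auto.
  - intros m n; rewrite Cmod_mult.
    assert (H := HF n m); assert (H' := HB m).
    assert (0 <= Cmod (a n * b (m - n)%Z))%R by apply Cmod_ge_0.
    assert (0 <= Cmod (g m))%R by apply Cmod_ge_0.
    apply Rle_trans with ((c * d * (/ 2) ^ Z.abs_nat n * (/ 2) ^ Z.abs_nat m) * B)%R;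
      [apply Rmult_le_compat; auto | lra].
Qed.

(** * The exponential e(z) and its period *)

Lemma Cexp_add (z w : C) : Cexp (z + w) = Cexp z * Cexp w.
Proof.
  destruct z as [a b]; destruct w as [c d].
  unfold Cexp, Cplus, Cmult; simpl.
  rewrite exp_plus, cos_plus, sin_plus.
  apply injective_projections; simpl; ring.
Qed.

Lemma Cexp_0 : Cexp 0 = 1.
Proof.
  unfold Cexp; simpl; rewrite exp_0, cos_0, sin_0.
  apply injective_projections; simpl; ring.
Qed.

Lemma Cmod_Cexp (z : C) : Cmod (Cexp z) = exp (Re z).
Proof.
  unfold Cexp, Cmod; simpl.
  replace (exp (Re z) * cos (Im z) * (exp (Re z) * cos (Im z) * 1)
    + exp (Re z) * sin (Im z) * (exp (Re z) * sin (Im z) * 1))%R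
    with (exp (Re z) * exp (Re z))%R.
  - apply sqrt_square; left; apply exp_pos.
  - generalize (sin2_cos2 (Im z)); unfold Rsqr; intros H.
    transitivity (exp (Re z) * exp (Re z) * (sin (Im z) * sin (Im z)
      + cos (Im z) * cos (Im z)))%R; [rewrite H|]; ring.
Qed.

Definition ee (z : C) : C := Cexp (twopii * z).

Definition zc (n : Z) : C := RtoC (IZR n).

Lemma zc_add (n m : Z) : zc (n + m) = zc n + zc m.
Proof. unfold zc; rewrite plus_IZR, RtoC_plus; auto. Qed.

Lemma zc_opp (n : Z) : zc (- n) = - zc n.
Proof. unfold zc; rewrite opp_IZR, RtoC_opp; auto. Qed.

Lemma zc_sub (n m : Z) : zc (n - m) = zc n - zc m.
Proof. unfold zc; rewrite minus_IZR, RtoC_minus; auto. Qed.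

Lemma zc_mul (n m : Z) : zc (n * m) = zc n * zc m.
Proof. unfold zc; rewrite mult_IZR, RtoC_mult; auto. Qed.

Lemma ee_add (z w : C) : ee (z + w) = ee z * ee w.
Proof. unfold ee; rewrite <- Cexp_add; f_equal; ring. Qed.

Lemma ee_0 : ee 0 = 1.
Proof. unfold ee; rewrite Cmult_0_r; apply Cexp_0. Qed.

Lemma ee_opp_l (z : C) : ee (- z) * ee z = 1.
Proof. rewrite <- ee_add, <- ee_0; f_equal; ring. Qed.

Lemma Cmod_ee (z : C) : Cmod (ee z) = exp (- (2 * PI * Im z)).
Proof.
  unfold ee; rewrite Cmod_Cexp; f_equal.
  destruct z as [a b]; unfold twopii; simpl; ring.
Qed.

Lemma ee_neq0 (z : C) : ee z <> 0.
Proof.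
  intros H; generalize (Cmod_ee z); rewrite H, Cmod_0.
  generalize (exp_pos (- (2 * PI * Im z))); lra.
Qed.

Lemma ee_opp (z : C) : ee (- z) = / ee z.
Proof.
  rewrite <- (Cmult_1_l (/ ee z)), <- (ee_opp_l z); field; apply ee_neq0.
Qed.

Lemma ee_sub (z w : C) : ee (z - w) = ee z / ee w.
Proof. unfold Cminus; rewrite ee_add, ee_opp; reflexivity. Qed.

Lemma ee_RtoC (x : R) : ee (RtoC x) = (cos (2 * PI * x), sin (2 * PI * x)).
Proof.
  unfold ee, Cexp, twopii; simpl.
  replace ((2 * PI - 0 * 0) * 0 - (2 * 0 + 0 * PI) * 1)%R with 0%R by ring.
  replace (_ * x - _ * 0)%R with 0%R by ring; rewrite exp_0.
  apply injective_projections; simpl; rewrite Rmult_1_l; f_equal; ring.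
Qed.

Lemma ee_1 : ee 1 = 1.
Proof.
  rewrite ee_RtoC, Rmult_1_r, cos_2PI, sin_2PI; reflexivity.
Qed.

Lemma two_neq0 : RtoC 2 <> 0.
Proof. intros H; apply RtoC_inj in H; lra. Qed.

Lemma ee_half : ee (/ 2) = - (1).
Proof.
  rewrite <- RtoC_inv by lra; rewrite ee_RtoC.
  replace (2 * PI * / 2)%R with PI by field; rewrite cos_PI, sin_PI.
  apply injective_projections; simpl; ring.
Qed.

Lemma ee_Z (n : Z) : ee (zc n) = 1.
Proof.
  assert (H : forall p : nat, ee (zc (Z.of_nat p)) = 1).
  { induction p as [|p IH]; [apply ee_0|].
    rewrite Nat2Z.inj_succ, <- Z.add_1_r, zc_add, ee_add, IH.
    unfold zc; rewrite ee_1; ring. }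
  destruct (Z.le_ge_cases 0 n) as [Hn|Hn].
  - rewrite <- (Z2Nat.id n Hn); auto.
  - replace n with (- Z.of_nat (Z.to_nat (- n)))%Z by lia.
    rewrite zc_opp, ee_opp, H; field; apply C1_nz.
Qed.

Lemma ee_addZ (z : C) (n : Z) : ee (z + zc n) = ee z.
Proof. rewrite ee_add, ee_Z; ring. Qed.

Lemma ee_eq1 (z : C) : ee z = 1 -> exists n, z = zc n.
Proof.
  intros H.
  assert (H1 : Im z = 0%R).
  { assert (Hm := Cmod_ee z); rewrite H, Cmod_1, <- exp_0 in Hm.
    apply exp_inv in Hm; generalize PI_RGT_0; intros; nra. }
  assert (E : z = RtoC (Re z)) by (apply injective_projections; auto).
  rewrite E in *; set (x := Re z) in *; rewrite ee_RtoC in H.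
  assert (H2 : cos (2 * (PI * x)) = 1%R).
  { apply (f_equal fst) in H; simpl in H; rewrite <- H; f_equal; ring. }
  rewrite cos_2a_sin in H2.
  assert (H3 : sin (PI * x) = 0%R) by nra.
  apply sin_eq_0_0 in H3; destruct H3 as [k Hk].
  exists k; unfold zc; f_equal.
  generalize PI_RGT_0; intros; nra.
Qed.

(** * Laurent series in e(v) and uniqueness of their coefficients *)

Definition Lau (a : Z -> C) (v : C) : C := zs (fun k => a k * ee (zc k * v)).

Lemma pow_exp (x : R) (n : nat) : (exp x ^ n)%R = exp (INR n * x).
Proof.
  induction n as [|n IH]; [simpl; rewrite Rmult_0_l, exp_0; auto|].
  simpl pow; rewrite IH, <- exp_plus, S_INR; f_equal; ring.
Qed.

Lemma INR_abs_nat (k : Z) : INR (Z.abs_nat k) = Rabs (IZR k).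
Proof.
  rewrite INR_IZR_INZ, Zabs2Nat.id_abs, abs_IZR; reflexivity.
Qed.

Lemma RD_ee (a : Z -> C) (v : C) : RD a -> RD (fun k => a k * ee (zc k * v)).
Proof.
  apply (RD_mult_exp _ _ (exp (Rabs (2 * PI * Im v))) 1).
  - rewrite <- exp_0; destruct (Rabs_pos (2 * PI * Im v)) as [H|<-]; [|lra].
    left; apply exp_increasing; auto.
  - intros k; rewrite Cmod_ee, Rmult_1_l, pow_exp, INR_abs_nat, <- Rabs_mult.
    replace (- (2 * PI * Im (zc k * v)))%R with (- (IZR k * (2 * PI * Im v)))%R
      by (unfold zc; rewrite im_scal_l; ring).
    set (x := (IZR k * _)%R).
    destruct (Rle_lt_or_eq_dec (- x) (Rabs x)) as [H| ->]; [|left; apply exp_increasing; auto|lra].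
    rewrite <- Rabs_Ropp; apply Rle_abs.
Qed.

Lemma Lau_summ (a : Z -> C) (v : C) : RD a -> summ (fun k => a k * ee (zc k * v)).
Proof. intros H; apply RD_summ, RD_ee; auto. Qed.

Definition laurent (F : C -> C) : Prop := exists a, RD a /\ forall v, F v = Lau a v.

Lemma laurent_plus (F G : C -> C) : laurent F -> laurent G ->
  laurent (fun v => F v + G v).
Proof.
  intros (a & Ha & Fa) (b & Hb & Gb).
  exists (fun k => a k + b k); split; [apply RD_plus; auto|]; intros v.
  rewrite Fa, Gb; unfold Lau.
  rewrite <- (proj2 (summ_plus _ _ (Lau_summ a v Ha) (Lau_summ b v Hb))).
  apply zs_ext; intros; ring.
Qed.

Lemma laurent_scal (l : C) (F : C -> C) : laurent F -> laurent (fun v => l * F v).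
Proof.
  intros (a & Ha & Fa).
  exists (fun k => l * a k); split; [apply RD_scal; auto|]; intros v.
  rewrite Fa; unfold Lau.
  rewrite <- (proj2 (summ_scal l _ (Lau_summ a v Ha))).
  apply zs_ext; intros; ring.
Qed.

Lemma laurent_sub (F G : C -> C) : laurent F -> laurent G ->
  laurent (fun v => F v - G v).
Proof.
  intros HF HG.
  destruct (laurent_plus F (fun v => - (1) * G v) HF (laurent_scal _ _ HG)) as (a & Ha & E).
  exists a; split; auto; intros v; rewrite <- E; ring.
Qed.

Lemma Lau_trans (a : Z -> C) (b v : C) :
  Lau a (v + b) = Lau (fun k => a k * ee (zc k * b)) v.
Proof.
  apply zs_ext; intros k.
  replace (zc k * (v + b)) with (zc k * b + zc k * v) by ring; rewrite ee_add; ring.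
Qed.

Lemma laurent_trans (F : C -> C) (b : C) : laurent F -> laurent (fun v => F (v + b)).
Proof.
  intros (a & Ha & Fa); exists (fun k => a k * ee (zc k * b)).
  split; [apply RD_ee; auto|]; intros v; rewrite Fa; apply Lau_trans.
Qed.

Lemma Lau_conv (a b : Z -> C) (v : C) : RD a -> RD b ->
  Lau (conv a b) v = Lau a v * Lau b v.
Proof.
  intros Ha Hb.
  assert (Ha' := RD_ee a v Ha); assert (Hb' := RD_ee b v Hb).
  transitivity (zs (fun m => conv (fun k => a k * ee (zc k * v))
    (fun k => b k * ee (zc k * v)) m * 1)).
  - apply zs_ext; intros m; unfold conv.
    rewrite Cmult_1_r, Cmult_comm.
    assert (Hs : summ (fun n => a n * b (m - n)%Z)).
    { destruct (Hb (/ 2)%R) as [d Hd]; [lra|].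
      apply RD_summ, (RD_mult_bd _ (fun n => b (m - n)%Z)); auto.
      exists d; intros k; eapply Rle_trans; [apply Hd|].
      assert (H0 := dom_nonneg _ _ _ Hd).
      assert ((/ 2) ^ Z.abs_nat (m - k) <= 1)%R
        by (rewrite <- (pow1 (Z.abs_nat (m - k))); apply pow_incr; lra).
      nra. }
    rewrite <- (proj2 (summ_scal (ee (zc m * v)) _ Hs)).
    apply zs_ext; intros n.
    replace (zc m * v) with (zc n * v + zc (m - n) * v) by (rewrite zc_sub; ring).
    rewrite ee_add; ring.
  - rewrite (conv_sum _ _ (fun _ => 1)); auto; [|apply bounded_const].
    transitivity (Lau b v * Lau a v); [|ring]; unfold Lau at 2.
    rewrite <- (proj2 (summ_scal (Lau b v) _ (Lau_summ a v Ha))).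
    apply zs_ext; intros n; rewrite Cmult_comm; f_equal.
    apply zs_ext; intros k; ring.
Qed.

Lemma laurent_mult (F G : C -> C) : laurent F -> laurent G ->
  laurent (fun v => F v * G v).
Proof.
  intros (a & Ha & Fa) (b & Hb & Gb); exists (conv a b).
  split; [apply RD_conv; auto|]; intros v; rewrite Lau_conv, Fa, Gb; auto.
Qed.

(** Mean of the n-th character over the K-th roots of unity: a finite replacement for the integral
    over a period. *)
Definition avg (K : nat) (n : Z) : C :=
  / RtoC (INR K) * Csum (seq 0 K) (fun j => ee (zc n * (RtoC (INR j) / RtoC (INR K)))).

Lemma INR_C_neq0 (K : nat) : (0 < K)%nat -> RtoC (INR K) <> 0.
Proof.
  intros HK H; apply RtoC_inj in H; apply (not_0_INR K); auto; lia.
Qed.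

Lemma Csum_seq_S (K : nat) (f : nat -> C) :
  Csum (seq 0 (S K)) f = Csum (seq 0 K) f + f K.
Proof. rewrite seq_S, Csum_app; simpl; ring. Qed.

(** Multiplied by e(n/K) - 1 the geometric sum becomes e(n) - 1 = 0, and the multiplier is nonzero
    because 0 < |n| < K. *)
Lemma avg_small (K : nat) (n : Z) : n <> 0%Z -> (Z.abs_nat n < K)%nat -> avg K n = 0.
Proof.
  intros Hn HK; unfold avg.
  assert (HK0 := INR_C_neq0 K ltac:(lia)).
  set (w := zc n / RtoC (INR K)).
  assert (Hw : ee w <> 1).
  { intros H; apply ee_eq1 in H; destruct H as [m Hm].
    assert (E : zc n = zc (m * Z.of_nat K)).
    { rewrite zc_mul, <- Hm; unfold w.
      replace (zc (Z.of_nat K)) with (RtoC (INR K))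
        by (unfold zc; rewrite <- INR_IZR_INZ; auto).
      field; auto. }
    apply RtoC_inj, eq_IZR in E.
    assert (Z.abs n < Z.of_nat K)%Z by lia.
    assert (Z.abs n = Z.abs m * Z.of_nat K)%Z by (rewrite E, Z.abs_mul; lia).
    assert (m <> 0)%Z by (intros ->; lia).
    nia. }
  assert (T : forall p, (ee w - 1) * Csum (seq 0 p)
     (fun j => ee (zc n * (RtoC (INR j) / RtoC (INR K)))) = ee (RtoC (INR p) * w) - 1).
  { induction p as [|p IH].
    - simpl; replace (RtoC 0 * w) with (RtoC 0) by ring; rewrite ee_0; ring.
    - rewrite Csum_seq_S, Cmult_plus_distr_l, IH, S_INR, RtoC_plus.
      replace ((RtoC (INR p) + 1) * w) with (RtoC (INR p) * w + w) by ring.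
      replace (zc n * (RtoC (INR p) / RtoC (INR K))) with (RtoC (INR p) * w)
        by (unfold w; field; auto).
      rewrite ee_add; ring. }
  specialize (T K).
  replace (RtoC (INR K) * w) with (zc n) in T by (unfold w; field; auto).
  rewrite ee_Z in T; replace (1 - 1) with (RtoC 0) in T by ring.
  destruct (Ceq_dec (Csum (seq 0 K)
    (fun j => ee (zc n * (RtoC (INR j) / RtoC (INR K))))) 0) as [E|E].
  - rewrite E; ring.
  - exfalso; apply (Cmult_neq_0 (ee w - 1) _) in E; [contradiction|].
    apply Cminus_eq_contra; auto.
Qed.

Lemma avg_0 (K : nat) : (0 < K)%nat -> avg K 0 = 1.
Proof.
  intros HK; unfold avg; assert (HK0 := INR_C_neq0 K HK).
  assert (E : forall p, Csum (seq 0 p)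
    (fun j => ee (zc 0 * (RtoC (INR j) / RtoC (INR K)))) = RtoC (INR p)).
  { induction p as [|p IH]; [reflexivity|].
    rewrite Csum_seq_S, IH, S_INR, RtoC_plus.
    replace (zc 0 * _) with (RtoC 0) by (unfold zc; ring); rewrite ee_0; ring. }
  rewrite E; field; auto.
Qed.

Lemma avg_bound (K : nat) (n : Z) : (0 < K)%nat -> (Cmod (avg K n) <= 1)%R.
Proof.
  intros HK; unfold avg; assert (HK0 := INR_C_neq0 K HK).
  assert (HKr : (0 < INR K)%R) by (apply lt_0_INR; auto).
  assert (HKn : INR K <> 0%R) by (apply Rgt_not_eq; auto).
  rewrite Cmod_mult, Cmod_inv, Cmod_R, Rabs_pos_eq by (auto; lra).
  assert (E : forall p, (Cmod (Csum (seq 0 p)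
    (fun j => ee (zc n * (RtoC (INR j) / RtoC (INR K))))) <= INR p)%R).
  { induction p as [|p IH]; [simpl; rewrite Cmod_0; lra|].
    rewrite Csum_seq_S, S_INR; eapply Rle_trans; [apply Cmod_triangle|].
    apply Rplus_le_compat; auto.
    rewrite Cmod_ee; unfold zc.
    rewrite <- RtoC_div, <- RtoC_mult by auto; simpl Im.
    rewrite Rmult_0_r, Ropp_0, exp_0; lra. }
  apply Rmult_le_reg_l with (INR K); auto.
  rewrite <- Rmult_assoc, Rinv_r, Rmult_1_l, Rmult_1_r by auto; apply E.
Qed.

(* Averaging over the points j/K extracts the constant coefficient in the limit. *)
Lemma Lau_zero_coeff0 (a : Z -> C) : RD a -> (forall v, Lau a v = 0) -> a 0%Z = 0.
Proof.
  intros Ha H.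
  destruct (Ha (/ 2)%R) as [c Hc]; [lra|].
  assert (Hs : (0 < / 2 < 1)%R) by lra.
  assert (E : forall K, zs (fun n => a n * avg (S K) n) = 0).
  { intros K; unfold avg; set (k := RtoC (INR (S K))).
    rewrite (zs_ext _ (fun n => Csum (seq 0 (S K))
      (fun j => / k * (a n * ee (zc n * (RtoC (INR j) / k)))))).
    2:{ intros n; rewrite !Csum_scal; ring. }
    assert (D : forall j : nat, exists d,
      dom d (/ 2) (fun n => / k * (a n * ee (zc n * (RtoC (INR j) / k))))).
    { intros j; exact (RD_scal (/ k) _ (RD_ee a (RtoC (INR j) / k) Ha) (/ 2)%R Hs). }
    rewrite (proj2 (zs_Csum (seq 0 (S K)) (/ 2) _ Hs D)).
    rewrite (Csum_ext _ _ (fun _ => 0 * 0)); [rewrite Csum_scal; ring|].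
    intros j _; rewrite (proj2 (summ_scal _ _ (Lau_summ a _ Ha))).
    fold (Lau a (RtoC (INR j) / k)); rewrite H; ring. }
  (* For fixed n the mean is eventually the indicator of n = 0, and its bound by 1 lets the majorant
     of [a] serve for all K. *)
  assert (T : Ccv (fun K => zs (fun n => a n * avg (S K) n))
     (zs (fun n => if Z.eqb n 0 then a 0%Z else 0))).
  { apply (dom_tannery c (/ 2)); auto.
    - intros K n; eapply Rle_trans; [|apply Hc].
      rewrite Cmod_mult; rewrite <- (Rmult_1_r (Cmod (a n))) at 2.
      apply Rmult_le_compat_l; [apply Cmod_ge_0 | apply avg_bound; lia].
    - intros n; destruct (Z.eqb_spec n 0) as [->|Hn].
      + apply Ccv_ext with (fun _ => a 0%Z); [|apply Ccv_const].
        intros K; rewrite avg_0 by lia; ring.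
      + apply Ccv_ext_loc with (fun _ => 0) (Z.abs_nat n); [|apply Ccv_const].
        intros K HK; rewrite avg_small by lia; ring. }
  assert (Z0 : zs (fun n => if Z.eqb n 0 then a 0%Z else 0) = 0).
  { eapply Ccv_unique; [exact T|].
    apply Ccv_ext with (fun _ => 0); [intros; symmetry; apply E | apply Ccv_const]. }
  rewrite <- Z0; symmetry.
  apply (zs_unique (Cmod (a 0%Z)) (/ 2)); auto.
  - intros n; destruct (Z.eqb_spec n 0) as [->|_]; [simpl; lra|].
    rewrite Cmod_0; apply Rmult_le_pos; [apply Cmod_ge_0|].
    apply pow_le; lra.
  - apply Ccv_ext with (fun _ => a 0%Z); [|apply Ccv_const].
    induction n as [|M IH]; [rewrite Csum_zrange_0; auto|].
    rewrite Csum_zrange_S, <- IH.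
    destruct (Z.eqb_spec (Z.of_nat (S M)) 0) as [?|_]; [lia|].
    destruct (Z.eqb_spec (- Z.of_nat (S M)) 0) as [?|_]; [lia|]; ring.
Qed.

Lemma RD_shift (a : Z -> C) (p : Z) : RD a -> RD (fun k => a (k + p)%Z).
Proof.
  intros Ha s Hs; destruct (Ha s Hs) as [c Hc]; eexists.
  apply dom_shift; eauto.
Qed.

Lemma Lau_shift (a : Z -> C) (p : Z) (v : C) : RD a ->
  Lau (fun k => a (k + p)%Z) v = ee (- zc p * v) * Lau a v.
Proof.
  intros Ha; unfold Lau.
  rewrite <- (proj2 (summ_shift _ p (Lau_summ a v Ha))).
  rewrite <- (proj2 (summ_scal _ _ (proj1 (summ_shift _ p (Lau_summ a v Ha))))).
  apply zs_ext; intros k.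
  replace (zc k * v) with (- zc p * v + zc (k + p) * v) by (rewrite zc_add; ring).
  rewrite ee_add; ring.
Qed.

(** Shifting the difference by p turns its p-th coefficient into the constant one, to which
    [Lau_zero_coeff0] applies. *)
Lemma Lau_inj (a b : Z -> C) : RD a -> RD b -> (forall v, Lau a v = Lau b v) ->
  forall k, a k = b k.
Proof.
  intros Ha Hb H p.
  assert (Hd : RD (fun k => a k + - (1) * b k)) by (apply RD_plus, RD_scal; auto).
  assert (E := Lau_zero_coeff0 _ (RD_shift _ p Hd)); simpl in E.
  rewrite <- (Cplus_0_r (b p)), <- E; [ring|].
  intros v; rewrite (Lau_shift (fun k => a k + - (1) * b k)) by auto.
  replace (Lau (fun k => a k + - (1) * b k) v) with (Lau a v + - (1) * Lau b v).
  - rewrite H; ring.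
  - unfold Lau.
    rewrite <- (proj2 (summ_scal (- (1)) _ (Lau_summ b v Hb))).
    rewrite <- (proj2 (summ_plus _ _ (Lau_summ a v Ha)
      (proj1 (summ_scal (- (1)) _ (Lau_summ b v Hb))))).
    apply zs_ext; intros; ring.
Qed.

(** * The theta series and the Appell sums *)

Section Tau.

Context (tau : C) (Htau : (0 < Im tau)%R).

(** The sign (-1)^n is written as e(n/2), so that products of such factors collapse to a single
    exponential and identities reduce to comparing exponents modulo integers. *)
Definition tq (n : Z) : C := ee (zc n / 2 + zc n * (zc n + 1) / 2 * tau).

Lemma exp_le (x y : R) : (x <= y)%R -> (exp x <= exp y)%R.
Proof.
  intros [H| ->]; [left; apply exp_increasing; auto | lra].
Qed.

Lemma RD_tq : RD tq.
Proof.
  intros s Hs.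
  set (y := (PI * Im tau)%R); set (b := (- ln s)%R).
  assert (Hy : (0 < y)%R) by (apply Rmult_lt_0_compat; auto; apply PI_RGT_0).
  (* Completing the square: with x = |n|, -y x^2 + (y + b) x is at most (y + b)^2 / (4 y), where y =
     pi Im tau and e^(-b) = s. *)
  exists (exp ((y + b) * (y + b) / (4 * y))); intros n.
  replace s with (exp (- b)) by (unfold b; rewrite Ropp_involutive; apply exp_ln; lra).
  unfold tq; rewrite Cmod_ee, pow_exp, <- exp_plus, INR_abs_nat.
  apply exp_le.
  assert (E : Im (zc n / 2 + zc n * (zc n + 1) / 2 * tau)
              = (IZR n * (IZR n + 1) / 2 * Im tau)%R).
  { unfold zc; rewrite <- !RtoC_plus, <- RtoC_mult, <- !RtoC_div by lra.
    destruct tau as [p q]; simpl; ring. }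
  rewrite E.
  replace (- (2 * PI * (IZR n * (IZR n + 1) / 2 * Im tau)))%R
    with (- (y * (IZR n * IZR n)) - y * IZR n)%R by (unfold y; field).
  assert (A : (IZR n * IZR n = Rabs (IZR n) * Rabs (IZR n))%R)
    by (unfold Rabs; destruct Rcase_abs; ring).
  assert (B : (- (y * IZR n) <= y * Rabs (IZR n))%R).
  { generalize (Rle_abs (- IZR n)); rewrite Rabs_Ropp; nra. }
  rewrite A; set (x := Rabs (IZR n)) in *.
  apply Rle_trans with (- (y * (x * x)) + (y + b) * x + - b * x)%R; [lra|].
  replace (x * - b)%R with (- b * x)%R by ring.
  apply Rplus_le_compat_r.
  apply Rmult_le_reg_r with (4 * y)%R; [lra|].
  replace ((y + b) * (y + b) / (4 * y) * (4 * y))%R with ((y + b) * (y + b))%R by (field; lra).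
  assert (0 <= (2 * y * x - (y + b)) * (2 * y * x - (y + b)))%R by apply Rle_0_sqr.
  lra.
Qed.

Definition T (v : C) : C := Lau tq v.

Lemma T_summ (v : C) : summ (fun k => tq k * ee (zc k * v)).
Proof. apply Lau_summ, RD_tq. Qed.

(** Reindexing n to n + k. The shift is written v - k tau because the parameters enter as v -
    u_j. *)
Lemma T_shift (k : Z) (v : C) :
  T (v - zc k * tau) = ee (zc k / 2 + zc k * v + (zc k - zc k * zc k) / 2 * tau) * T v.
Proof.
  unfold T, Lau.
  rewrite <- (proj2 (summ_shift _ k (T_summ (v - zc k * tau)))).
  rewrite <- (proj2 (summ_scal _ _ (T_summ v))).
  apply zs_ext; intros n; unfold tq; rewrite <- !ee_add, zc_add; f_equal.
  field; apply two_neq0.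
Qed.

Lemma T_addtau (v : C) : T (v + tau) = - ee (- v - tau) * T v.
Proof.
  replace (v + tau) with (v - zc (-1) * tau) by (unfold zc; ring).
  rewrite T_shift; f_equal.
  replace (zc (-1)) with (- (1)) by (unfold zc; rewrite <- RtoC_opp; reflexivity).
  replace (- (1) / 2 + - (1) * v + (- (1) - - (1) * - (1)) / 2 * tau)
    with (/ 2 + (- v - tau) - 1) by (field; apply two_neq0).
  rewrite ee_sub, ee_add, ee_half, ee_1; field; apply C1_nz.
Qed.

(** Replacing n by -n produces T(v - tau); this is the oddness of theta, and T(0) = 0 follows from
    it. *)
Lemma T_neg (v : C) : T (- v) = - ee v * T v.
Proof.
  transitivity (T (v - zc 1 * tau)).
  - unfold T, Lau; rewrite <- zs_refl; apply zs_ext; intros n.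
    unfold tq; rewrite <- !ee_add, zc_opp.
    rewrite <- (ee_addZ (- zc n / 2 + _ + _) n); f_equal; unfold zc; field; apply two_neq0.
  - rewrite T_shift; f_equal.
    replace (zc 1 / 2 + zc 1 * v + (zc 1 - zc 1 * zc 1) / 2 * tau) with (/ 2 + v)
      by (unfold zc; field; apply two_neq0).
    rewrite ee_add, ee_half; ring.
Qed.

Lemma T_0 : T 0 = 0.
Proof.
  assert (H := T_neg 0); rewrite ee_0 in H.
  replace (- 0) with (RtoC 0) in H by ring.
  assert (H2 : 2 * T 0 = 0) by (transitivity (T 0 + T 0); [ring | rewrite H at 1; ring]).
  destruct (Ceq_dec (T 0) 0) as [E|E]; auto.
  exfalso; apply (Cmult_neq_0 _ _ two_neq0 E); auto.
Qed.

Lemma T_laurent (b : C) : laurent (fun v => T (v + b)).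
Proof.
  apply (laurent_trans T); exists tq; split; [apply RD_tq | reflexivity].
Qed.

Lemma ee_quarter : ee (/ 4) = Ci.
Proof.
  assert (H4 : RtoC 4 <> 0) by (intros H; apply RtoC_inj in H; lra).
  rewrite <- RtoC_inv by lra; rewrite ee_RtoC.
  replace (2 * PI * / 4)%R with (PI / 2)%R by field.
  rewrite cos_PI2, sin_PI2; reflexivity.
Qed.

Lemma qpow_ee (c : R) : qpow tau c = ee (RtoC c * tau).
Proof. unfold qpow, ee; f_equal; ring. Qed.

Lemma Csum_zbox_S (N M : nat) (f : list Z -> C) :
  Csum (zbox (S N) M) f = Csum (zrange M) (fun z => Csum (zbox N M) (fun l => f (z :: l))).
Proof.
  simpl; rewrite Csum_flat_map; apply Csum_ext; intros z _; apply Csum_map.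
Qed.

(** For nu = n + 1/2, nu^2 / 2 = n(n+1)/2 + 1/8 and e(nu / 2) = e(1/4) e(n/2), whence the factors
    e(tau/8) and i. *)
Lemma theta_T (v : C) : theta v tau = Ci * ee (v / 2) * ee (tau / 8) * T v.
Proof.
  unfold theta, zsum; apply Ccv_Clim.
  eapply Ccv_ext; [|apply Ccv_scal, summ_cv, T_summ].
  intros M; cbv beta; rewrite <- Csum_scal, Csum_zbox_S; apply Csum_ext; intros n _.
  simpl; rewrite qpow_ee.
  fold (zc n); unfold tq.
  replace (Cexp (twopii * RtoC (IZR n + / 2) * (v + RtoC (/ 2))))
    with (ee (RtoC (IZR n + / 2) * (v + RtoC (/ 2)))) by (unfold ee; f_equal; ring).
  assert (H4 : RtoC 4 <> 0) by (intros H; apply RtoC_inj in H; lra).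
  assert (H8 : RtoC 8 <> 0) by (intros H; apply RtoC_inj in H; lra).
  rewrite <- ee_quarter, <- !ee_add, Cplus_0_r; f_equal.
  rewrite !RtoC_div, !RtoC_mult, !RtoC_plus, !RtoC_inv by lra.
  fold (zc n); field; split; auto using two_neq0.
Qed.

Lemma theta_Tneg (v : C) : T (- v) = Ci * ee (v / 2) / ee (tau / 8) * theta v tau.
Proof.
  rewrite theta_T, T_neg.
  replace v with (v / 2 + v / 2) at 1 by (field; apply two_neq0).
  rewrite ee_add.
  replace (- (ee (v / 2) * ee (v / 2)) * T v) with
    ((Ci * Ci) * (ee (v / 2) * ee (v / 2)) * T v).
  - field; apply ee_neq0.
  - replace (Ci * Ci) with (- (1)) by (apply injective_projections; simpl; ring); ring.
Qed.

Definition phi (u : C) (m : Z) : C := / (1 - ee (u + zc m * tau)).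

Lemma phi_den (u : C) (m : Z) : ~ in_lattice tau u -> 1 - ee (u + zc m * tau) <> 0.
Proof.
  intros Hu H; apply Hu.
  assert (H1 : ee (u + zc m * tau) = 1) by (rewrite <- (Cplus_0_r (ee _)), <- H; ring).
  apply ee_eq1 in H1; destruct H1 as [n Hn].
  exists n, (- m)%Z; fold (zc n) (zc (- m)); rewrite <- Hn, zc_opp; ring.
Qed.

Lemma Cmod_1_sub (z : C) : (1 - Cmod z <= Cmod (1 - z))%R /\ (Cmod z - 1 <= Cmod (1 - z))%R.
Proof.
  split.
  - assert (H := Cmod_triangle (1 - z) z).
    replace (1 - z + z) with (RtoC 1) in H by ring; rewrite Cmod_1 in H; lra.
  - assert (H := Cmod_triangle 1 (- (1 - z))).
    replace (1 + - (1 - z)) with z in H by ring; rewrite Cmod_opp, Cmod_1 in H; lra.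
Qed.

(** For |m| large, |e(u + m tau)| is at least e or at most 1/e, so the denominator has modulus at
    least 1/2; only finitely many m are left. *)
Lemma phi_bounded (u : C) : ~ in_lattice tau u -> Zbounded (phi u).
Proof.
  intros Hu.
  assert (HP := PI_RGT_0); set (y := (2 * PI * Im tau)%R); set (x := (2 * PI * Im u)%R).
  assert (Hy : (0 < y)%R) by (apply Rmult_lt_0_compat; auto; lra).
  (* For |k| > M the contribution of k tau to the exponent outweighs that of u by at least 1. *)
  destruct (nfloor_ex ((Rabs x + 1) / y)) as [M [_ HM]].
  { apply Rmult_le_pos; [generalize (Rabs_pos x); lra | left; apply Rinv_0_lt_compat; auto]. }
  apply (bounded_eventually _ (S M) 2); intros k Hk.
  assert (Hk' : (Rabs x + 1 <= Rabs (IZR k) * y)%R).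
  { assert (Hk2 : (INR M + 1 <= Rabs (IZR k))%R)
      by (rewrite <- INR_abs_nat, <- S_INR; apply le_INR; auto).
    apply Rle_trans with ((INR M + 1) * y)%R; [|nra].
    apply Rmult_le_reg_r with (/ y)%R; [apply Rinv_0_lt_compat; auto|].
    rewrite Rmult_assoc, Rinv_r by lra; unfold Rdiv in HM; lra. }
  unfold phi; rewrite Cmod_inv by (apply phi_den; auto).
  assert (Hd := phi_den u k Hu); apply Cmod_gt_0 in Hd.
  replace 2%R with (/ / 2)%R by field.
  apply Rinv_le_contravar; [lra|].
  destruct (Cmod_1_sub (ee (u + zc k * tau))) as [A B].
  assert (E : Cmod (ee (u + zc k * tau)) = exp (- (x + IZR k * y))).
  { rewrite Cmod_ee; f_equal; unfold x, y, zc; destruct tau, u; simpl; ring. }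
  rewrite E in A, B.
  assert (e2 : (2 <= exp 1)%R) by (generalize (exp_ineq1_le 1); lra).
  assert (e3 : (exp (- (1)) <= / 2)%R).
  { rewrite exp_Ropp; apply Rinv_le_contravar; lra. }
  assert (X1 := Rle_abs x); assert (X2 := Rle_abs (- x)); rewrite Rabs_Ropp in X2.
  unfold Rabs in Hk' at 2; destruct (Rcase_abs (IZR k)) as [Hn|Hn].
  - assert (exp 1 <= exp (- (x + IZR k * y)))%R by (apply exp_le; lra); lra.
  - assert (exp (- (x + IZR k * y)) <= exp (- (1)))%R by (apply exp_le; lra); lra.
Qed.

(* [Sol u c] solves f(v) - e(u) f(v + tau) = Lau c v; see [Sol_eq]. *)
Definition Sol (u : C) (c : Z -> C) (v : C) : C := Lau (fun m => c m * phi u m) v.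

Lemma RD_Sol (u : C) (c : Z -> C) : ~ in_lattice tau u -> RD c -> RD (fun m => c m * phi u m).
Proof. intros Hu; apply RD_mult_bd, phi_bounded; auto. Qed.

Lemma Sol_laurent (u : C) (c : Z -> C) : ~ in_lattice tau u -> RD c -> laurent (Sol u c).
Proof.
  intros Hu Hc; exists (fun m => c m * phi u m); split; [apply RD_Sol; auto | reflexivity].
Qed.

(** Termwise, e(u) q^m / (1 - e(u) q^m) = 1 / (1 - e(u) q^m) - 1. *)
Lemma Sol_eq (u : C) (c : Z -> C) (v : C) : ~ in_lattice tau u -> RD c ->
  ee u * Sol u c (v + tau) = Sol u c v - Lau c v.
Proof.
  intros Hu Hc; unfold Sol; assert (H := RD_Sol u c Hu Hc).
  assert (H2 := Lau_summ _ (v + tau) H); assert (H1 := Lau_summ c v Hc).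
  rewrite <- (Cplus_0_r (_ - _)).
  replace (Lau (fun m => c m * phi u m) v - Lau c v + 0) with
    (Lau (fun m => c m * phi u m) v + - (1) * Lau c v) by ring.
  unfold Lau.
  rewrite <- (proj2 (summ_scal _ _ H2)), <- (proj2 (summ_scal (- (1)) _ H1)).
  rewrite <- (proj2 (summ_plus _ _ (Lau_summ _ v H) (proj1 (summ_scal _ _ H1)))).
  apply zs_ext; intros k; unfold phi; assert (Hd := phi_den u k Hu).
  replace (zc k * (v + tau)) with (zc k * v + zc k * tau) by ring.
  rewrite ee_add in *; rewrite ee_add; field; auto.
Qed.

Lemma tq_succ (n : Z) : tq (Z.succ n) = - ee ((zc n + 1) * tau) * tq n.
Proof.
  unfold tq, Z.succ; rewrite zc_add.
  replace ((zc n + zc 1) / 2 + (zc n + zc 1) * (zc n + zc 1 + 1) / 2 * tau) with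
    (/ 2 + ((zc n + 1) * tau + (zc n / 2 + zc n * (zc n + 1) / 2 * tau)))
    by (unfold zc; field; apply two_neq0).
  rewrite ee_add, ee_half, ee_add; ring.
Qed.

Lemma tq_0 : tq 0 = 1.
Proof. unfold tq, zc; rewrite <- ee_0; f_equal; field; apply two_neq0. Qed.

(* The functional equation is a first-order recursion on Laurent coefficients. *)
Lemma quasi_unique (G : C -> C) (b : C) : laurent G ->
  (forall v, G (v + tau) = - ee (- v - tau - b) * G v) ->
  exists l, forall v, G v = l * T (v + b).
Proof.
  intros (a & Ha & Ga) H.
  assert (Hrec : forall n, a (n + 1)%Z = - ee ((zc n + 1) * tau + b) * a n).
  { intros n.
    (* Coefficient of e(nv) in the functional equation: translation by tau multiplies a_n by q^n,
       and the factor e(-v) brings in a_{n+1}. *)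
    assert (E : a n * ee (zc n * tau) = - ee (- tau - b) * a (n + 1)%Z).
    { apply (Lau_inj (fun n => a n * ee (zc n * tau)) (fun n => - ee (- tau - b) * a (n + 1)%Z)).
      - apply RD_ee; auto.
      - apply RD_scal, RD_shift; auto.
      - intros v; rewrite <- Lau_trans, <- Ga, H.
        transitivity (- ee (- tau - b) * Lau (fun n => a (n + 1)%Z) v).
        + rewrite Lau_shift, Ga by auto.
          replace (- v - tau - b) with ((- tau - b) + - zc 1 * v) by (unfold zc; ring).
          rewrite ee_add; ring.
        + unfold Lau; rewrite <- (proj2 (summ_scal _ _ (Lau_summ _ v (RD_shift a 1 Ha)))).
          apply zs_ext; intros; ring. }
    replace ((zc n + 1) * tau + b) with (zc n * tau - (- tau - b)) by ring.
    rewrite ee_sub.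
    replace (- (ee (zc n * tau) / ee (- tau - b)) * a n) with
      (- / ee (- tau - b) * (a n * ee (zc n * tau))) by (field; apply ee_neq0).
    rewrite E; field; apply ee_neq0. }
  (* The recursion runs from n = 0 in both directions, its factor being an exponential and hence
     never zero. *)
  assert (Hsol : forall n, a n = a 0%Z * (tq n * ee (zc n * b))).
  { apply Z.peano_ind.
    - rewrite tq_0; replace (zc 0 * b) with (RtoC 0) by (unfold zc; ring); rewrite ee_0; ring.
    - intros n IH; unfold Z.succ at 1; rewrite Hrec, IH, tq_succ.
      unfold Z.succ; rewrite zc_add.
      replace ((zc n + zc 1) * b) with (zc n * b + b) by (unfold zc; ring).
      rewrite !ee_add; ring.
    - intros n IH.
      assert (E := Hrec (Z.pred n)); assert (E' := tq_succ (Z.pred n)).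
      rewrite Z.succ_pred in E'.
      replace (Z.pred n + 1)%Z with n in E by lia.
      rewrite IH, E' in E.
      replace (zc n * b) with (zc (Z.pred n) * b + b) in E
        by (unfold Z.pred; rewrite zc_add; unfold zc; ring).
      rewrite !ee_add in E; clear E'.
      assert (N1 := ee_neq0 ((zc (Z.pred n) + 1) * tau)); assert (N2 := ee_neq0 b).
      replace (a (Z.pred n)) with
        (- / ee ((zc (Z.pred n) + 1) * tau) * / ee b *
         (- (ee ((zc (Z.pred n) + 1) * tau) * ee b) * a (Z.pred n))) by (field; auto).
      rewrite <- E; field; auto. }
  exists (a 0%Z); intros v; rewrite Ga; unfold T; rewrite Lau_trans; unfold Lau.
  rewrite <- (proj2 (summ_scal _ _ (Lau_summ _ v (RD_ee tq b RD_tq)))).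
  apply zs_ext; intros n; rewrite Hsol; ring.
Qed.

(* The difference of the two sides, with T(v - u) in place of T(-u), is a multiple of T(v). *)
Lemma Sol_sym (u u' k k' : C) (c c' : Z -> C) :
  ~ in_lattice tau u -> ~ in_lattice tau u' -> RD c -> RD c' ->
  (forall v, k * (T (v - u) * Lau c v) = k' * (T (v - u') * Lau c' v)) ->
  k * (T (- u) * Sol u c 0) = k' * (T (- u') * Sol u' c' 0).
Proof.
  intros Hu Hu' Hc Hc' H.
  set (G := fun v => k * (T (v + - u) * Sol u c v) - k' * (T (v + - u') * Sol u' c' v)).
  destruct (quasi_unique G 0) as [l Hl].
  - apply laurent_sub; apply laurent_scal, laurent_mult;
      auto using Sol_laurent, T_laurent.
  - intros v; unfold G.
    assert (E : forall w, T (v + tau + - w) = - ee (- v - tau) * ee w * T (v - w)).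
    { intros w; replace (v + tau + - w) with (v - w + tau) by ring; rewrite T_addtau.
      replace (- (v - w) - tau) with (- v - tau + w) by ring; rewrite ee_add; ring. }
    rewrite !E.
    replace (k * (- ee (- v - tau) * ee u * T (v - u) * Sol u c (v + tau))) with
      (- ee (- v - tau) * (k * T (v - u) * (ee u * Sol u c (v + tau)))) by ring.
    replace (k' * (- ee (- v - tau) * ee u' * T (v - u') * Sol u' c' (v + tau))) with
      (- ee (- v - tau) * (k' * T (v - u') * (ee u' * Sol u' c' (v + tau)))) by ring.
    rewrite !Sol_eq by auto.
    (* Each solution contributes its inhomogeneous term; these are the two sides of [H] and
       cancel. *)
    transitivity (- ee (- v - tau) *
      (k * (T (v - u) * Sol u c v) - k' * (T (v - u') * Sol u' c' v)
       - (k * (T (v - u) * Lau c v) - k' * (T (v - u') * Lau c' v)))); [ring|].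
    rewrite H; unfold Cminus; rewrite Copp_0, Cplus_0_r; ring.
  - assert (E := Hl 0); unfold G in E; rewrite (Cplus_0_l 0), T_0, !Cplus_0_l in E.
    transitivity (l * 0 + k' * (T (- u') * Sol u' c' 0)); [rewrite <- E; ring | ring].
Qed.
End Tau.

(** * The Jacobi triple product *)

Lemma zs_finite (f : Z -> C) (M : nat) :
  (forall k, (M < Z.abs_nat k)%nat -> f k = 0) -> zs f = Csum (zrange M) f.
Proof.
  intros H; apply Ccv_Clim.
  apply Ccv_ext_loc with (fun _ => Csum (zrange M) f) M; [|apply Ccv_const].
  intros n Hn; replace n with (M + (n - M))%nat by lia.
  generalize (n - M)%nat; intros p; induction p as [|p IH].
  - rewrite Nat.add_0_r; auto.
  - rewrite Nat.add_succ_r, Csum_zrange_S, IH, !H by lia; ring.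
Qed.

Lemma Cprod_seq_S (c : nat -> C) (n : nat) :
  Cprod (seq 1 (S n)) c = c (S n) * Cprod (seq 1 n) c.
Proof.
  rewrite seq_S, (Cprod_perm _ _ _ (Permutation_sym (Permutation_cons_append _ _))).
  reflexivity.
Qed.

(** * Infinite products with geometrically small deviations from 1 *)

Section Product.

Context (c : nat -> C) (K r : R) (Hr : (0 < r < 1)%R).
Context (Hc : forall j, (1 <= j)%nat -> (Cmod (c j) <= K * r ^ j)%R).

Let P (n : nat) : C := Cprod (seq 1 n) (fun j => 1 - c j).

Let HK : (0 <= K)%R.
Proof.
  assert (H := Hc 1 (le_n 1)); generalize (Cmod_ge_0 (c 1)); simpl in H; nra.
Qed.

Let P_S (n : nat) : P (S n) = (1 - c (S n)) * P n.
Proof. apply Cprod_seq_S. Qed.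

Let P_upper (n : nat) : (Cmod (P n) <= exp (K * / (1 - r)))%R.
Proof.
  assert (Hr' : (0 < / (1 - r))%R) by (apply Rinv_0_lt_compat; lra).
  (* The exponent is the partial geometric sum K (1 + r + ... + r^(n-1)), which the induction can
     carry; 1 + x <= e^x supplies each step. *)
  assert (H : (Cmod (P n) <= exp (K * / (1 - r) * (1 - r ^ n)))%R).
  { induction n as [|n IH].
    - unfold P; simpl; rewrite Cmod_1, Rminus_diag, Rmult_0_r, exp_0; lra.
    - rewrite P_S, Cmod_mult.
      replace (K * / (1 - r) * (1 - r ^ S n))%R with
        (K * r ^ n + K * / (1 - r) * (1 - r ^ n))%R by (simpl; field; lra).
      rewrite exp_plus; apply Rmult_le_compat; auto using Cmod_ge_0.
      apply Rle_trans with (1 + Cmod (c (S n)))%R.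
      + eapply Rle_trans; [apply Cmod_triangle|]; rewrite Cmod_1, Cmod_opp; lra.
      + eapply Rle_trans; [|apply exp_ineq1_le].
        apply Rplus_le_compat_l; eapply Rle_trans; [apply Hc; lia|].
        assert (0 < r ^ n)%R by (apply pow_lt; lra).
        assert (0 <= K * r ^ n)%R by nra.
        simpl; nra. }
  eapply Rle_trans; [exact H|]; apply exp_le.
  assert (0 < r ^ n)%R by (apply pow_lt; lra).
  assert (0 <= K * / (1 - r))%R by nra.
  nra.
Qed.

Lemma prod_bounded : exists B, forall n, (Cmod (Cprod (seq 1 n) (fun j => (1 - c j)%C)) <= B)%R.
Proof. eexists; apply P_upper. Qed.

(** The partial products are partial sums over Z of their increments -c_k P_{k-1}, extended by 0 to
    negative k, so [dom_cv] provides the limit. *)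
Lemma prod_cv : exists l, Ccv (fun n => Cprod (seq 1 n) (fun j => 1 - c j)) l.
Proof.
  fold P.
  set (f := fun k : Z => if (k <? 0)%Z then RtoC 0 else
              if (k =? 0)%Z then RtoC 1 else - c (Z.abs_nat k) * P (Z.abs_nat k - 1)).
  assert (E : forall n, Csum (zrange n) f = P n).
  { induction n as [|n IH]; [rewrite Csum_zrange_0; reflexivity|].
    rewrite Csum_zrange_S, IH, P_S; unfold f.
    destruct (Z.ltb_spec (Z.of_nat (S n)) 0); [lia|].
    destruct (Z.eqb_spec (Z.of_nat (S n)) 0); [lia|].
    destruct (Z.ltb_spec (- Z.of_nat (S n)) 0); [|lia].
    rewrite abs_nat_pos; replace (S n - 1)%nat with n by lia; ring. }
  exists (zs f); apply Ccv_ext with (fun n => Csum (zrange n) f); auto.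
  set (U := exp (K * / (1 - r))) in *.
  assert (HU : (1 <= U)%R).
  { assert (H := P_upper 0); fold U in H; unfold P in H; simpl in H.
    rewrite Cmod_1 in H; auto. }
  apply (dom_cv (1 + K * U) r); auto; intros k; unfold f.
  assert (H0 : (0 < r ^ Z.abs_nat k)%R) by (apply pow_lt; lra).
  destruct (Z.ltb_spec k 0).
  - rewrite Cmod_0; apply Rmult_le_pos; nra.
  - destruct (Z.eqb_spec k 0) as [->|Hk].
    + rewrite Cmod_1; simpl; nra.
    + rewrite Cmod_mult, Cmod_opp.
      assert (H1 := Hc (Z.abs_nat k) ltac:(lia)).
      assert (H2 := P_upper (Z.abs_nat k - 1)); fold U in H2.
      apply Rle_trans with (K * r ^ Z.abs_nat k * U)%R;
        [apply Rmult_le_compat; auto using Cmod_ge_0 | nra].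
Qed.

(** Beyond a J with K r^J / (1 - r) < 1/2 the later factors at most halve the modulus, because (1 -
    e)(1 - d) >= 1 - e - d; the earlier products are finitely many. *)
Lemma prod_inv_bounded : (forall j, (1 <= j)%nat -> 1 - c j <> 0) ->
  exists B, forall n, (Cmod (/ Cprod (seq 1 n) (fun j => (1 - c j)%C))%C <= B)%R.
Proof.
  intros Hne; fold P.
  assert (HP0 : forall n, P n <> 0).
  { intros n; apply Cprod_neq0; intros j Hj; apply in_seq in Hj; apply Hne; lia. }
  assert (Hg : is_lim_seq (fun M => K * / (1 - r) * r ^ M)%R 0).
  { apply is_lim_seq_scal0, is_lim_seq_geom; rewrite Rabs_pos_eq; lra. }
  apply is_lim_seq_spec in Hg; destruct (Hg (mkposreal (/ 2) ltac:(lra))) as [J HJ].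
  specialize (HJ J (le_n J)); simpl in HJ; rewrite Rminus_0_r in HJ.
  assert (HJ' := Rle_lt_trans _ _ _ (Rle_abs _) HJ); clear HJ Hg.
  assert (HJ0 := proj1 (Cmod_gt_0 _) (HP0 J)).
  assert (Hr' : (0 < / (1 - r))%R) by (apply Rinv_0_lt_compat; lra).
  assert (L : forall p, (Cmod (P J) * (1 - K * / (1 - r) * (r ^ J - r ^ (J + p)))
                          <= Cmod (P (J + p)))%R).
  { induction p as [|p IH].
    - rewrite Nat.add_0_r; lra.
    - rewrite Nat.add_succ_r, P_S, Cmod_mult.
      assert (H1 := proj1 (Cmod_1_sub (c (S (J + p))))).
      assert (H2 := Hc (S (J + p)) ltac:(lia)).
      assert (H3 : (0 < r ^ (J + p))%R) by (apply pow_lt; lra).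
      assert (H4 : (r ^ (J + p) <= r ^ J)%R).
      { rewrite pow_add; assert (r ^ p <= 1)%R
          by (rewrite <- (pow1 p); apply pow_incr; lra).
        assert (0 < r ^ J)%R by (apply pow_lt; lra); nra. }
      assert (H5 : (0 <= K * / (1 - r))%R) by nra.
      replace (K * / (1 - r) * (r ^ J - r ^ S (J + p)))%R with
        (K * r ^ (J + p) + K * / (1 - r) * (r ^ J - r ^ (J + p)))%R
        by (simpl; field; lra).
      set (d := (K * / (1 - r) * (r ^ J - r ^ (J + p)))%R) in *.
      assert (Hd : (0 <= d)%R) by (apply Rmult_le_pos; lra).
      assert (Hd2 : (d <= / 2)%R).
      { apply Rle_trans with (K * / (1 - r) * r ^ J)%R; [|lra].
        apply Rmult_le_compat_l; lra. }
      assert (He : (0 <= K * r ^ (J + p) <= / 2)%R).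
      { split; [nra|].
        apply Rle_trans with (K * / (1 - r) * r ^ J)%R; [|lra].
        rewrite Rmult_assoc; apply Rmult_le_compat_l; auto.
        assert (1 <= / (1 - r))%R by (rewrite <- Rinv_1 at 1; apply Rinv_le_contravar; lra).
        nra. }
      set (e := (K * r ^ (J + p))%R) in *.
      assert (H6 : (1 - e <= Cmod (1 - c (S (J + p)))%C)%R).
      { eapply Rle_trans; [|exact H1]; simpl in H2.
        assert (r * r ^ (J + p) <= r ^ (J + p))%R by nra.
        unfold e; nra. }
      assert (Hed : (0 <= Cmod (P J) * (e * d))%R)
        by (apply Rmult_le_pos; [lra | apply Rmult_le_pos; lra]).
      apply Rle_trans with ((1 - e) * (Cmod (P J) * (1 - d)))%R; [lra|].
      apply Rmult_le_compat; auto; try lra; apply Rmult_le_pos; lra. }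
  destruct (bounded_eventually (fun k => / P (Z.abs_nat k)) J (2 * / Cmod (P J))) as [B HB].
  - intros k Hk; rewrite Cmod_inv by auto.
    replace (2 * / Cmod (P J))%R with (/ (Cmod (P J) * / 2))%R by (field; lra).
    apply Rinv_le_contravar; [lra|].
    eapply Rle_trans; [|replace (Z.abs_nat k) with (J + (Z.abs_nat k - J))%nat by lia; apply L].
    apply Rmult_le_compat_l; [lra|].
    assert (0 < r ^ (J + (Z.abs_nat k - J)))%R by (apply pow_lt; lra).
    assert (0 <= K * / (1 - r))%R by nra.
    assert (K * / (1 - r) * (r ^ J - r ^ (J + (Z.abs_nat k - J))) <= K * / (1 - r) * r ^ J)%R
      by (apply Rmult_le_compat_l; lra).
    lra.
  - exists B; intros n; rewrite <- (abs_nat_pos n); apply HB.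
Qed.

End Product.

(** Otherwise 1 = s_n / s_n would tend to 0. *)
Lemma Ccv_0_inv_bounded (s : nat -> C) (B : R) :
  (forall n, s n <> 0) -> (forall n, (Cmod (/ s n) <= B)%R) -> ~ Ccv s 0.
Proof.
  intros H0 HB H.
  assert (E : Ccv (fun _ => 1) 0).
  { apply Ccv_squeeze with (fun n => B * Cmod (s n - 0))%R; [|apply is_lim_seq_scal0; auto].
    intros n; replace (1 - 0) with (/ s n * (s n - 0)) by (field; auto).
    rewrite Cmod_mult; apply Rmult_le_compat_r; auto using Cmod_ge_0. }
  apply C1_nz; apply (Ccv_unique (fun _ => 1)); auto using Ccv_const.
Qed.

Lemma Ccv_inv (s : nat -> C) (l : C) (B : R) :
  (forall n, s n <> 0) -> (forall n, (Cmod (/ s n) <= B)%R) -> Ccv s l ->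
  l <> 0 /\ Ccv (fun n => / s n) (/ l).
Proof.
  intros H0 HB H.
  assert (Hl : l <> 0) by (intros ->; apply (Ccv_0_inv_bounded s B); auto).
  split; auto.
  apply Ccv_squeeze with (fun n => (B * Cmod (/ l)) * Cmod (s n - l))%R;
    [|apply is_lim_seq_scal0; auto].
  intros n; replace (/ s n - / l) with (/ s n * / l * - (s n - l)) by (field; auto).
  rewrite !Cmod_mult, Cmod_opp.
  apply Rmult_le_compat_r; [apply Cmod_ge_0|].
  apply Rmult_le_compat_r; auto using Cmod_ge_0.
Qed.

Lemma RD_zc (a : Z -> C) : RD a -> RD (fun k => a k * zc k).
Proof.
  apply (RD_mult_exp _ _ 2 1); [lra|].
  intros k; unfold zc; rewrite Cmod_R, <- INR_abs_nat, Rmult_1_l.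
  generalize (Z.abs_nat k); intros p; induction p as [|p IHp]; [simpl; lra|].
  rewrite S_INR; simpl.
  assert (1 <= 2 ^ p)%R by (apply pow_R1_Rle; lra); lra.
Qed.

(** * The finite triple product and its limit *)

Section Tau.

Context (tau : C) (Htau : (0 < Im tau)%R).

Let rho : R := exp (- (2 * PI * Im tau)).

Let Hrho : (0 < rho < 1)%R.
Proof.
  unfold rho; split; [apply exp_pos|].
  rewrite <- exp_0; apply exp_increasing.
  assert (H := PI_RGT_0); nra.
Qed.

Definition Q (n : Z) : C := ee (zc n * tau).

Lemma Q_add (n m : Z) : Q (n + m) = Q n * Q m.
Proof. unfold Q; rewrite zc_add, Cmult_plus_distr_r, ee_add; auto. Qed.

Lemma Q_opp (n : Z) : Q (- n) = / Q n.
Proof.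
  unfold Q; rewrite zc_opp.
  replace (- zc n * tau) with (- (zc n * tau)) by ring; apply ee_opp.
Qed.

Lemma Q_neq0 (n : Z) : Q n <> 0.
Proof. apply ee_neq0. Qed.

Let Cmod_Q (n : nat) : Cmod (Q (Z.of_nat n)) = (rho ^ n)%R.
Proof.
  unfold Q, rho; rewrite Cmod_ee, pow_exp; f_equal.
  unfold zc; rewrite im_scal_l, <- INR_IZR_INZ; ring.
Qed.

Lemma qpow_Q (n : nat) : qpow tau (INR n) = Q (Z.of_nat n).
Proof. rewrite qpow_ee; unfold Q, zc; rewrite <- INR_IZR_INZ; auto. Qed.

Lemma lattice_ee (x : C) (n : Z) : ee (x + zc n * tau) = 1 -> in_lattice tau x.
Proof.
  intros H; apply ee_eq1 in H; destruct H as [k Hk].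
  exists k, (- n)%Z; fold (zc k) (zc (- n)); rewrite <- Hk, zc_opp; ring.
Qed.

Lemma lattice_opp (x : C) : in_lattice tau x -> in_lattice tau (- x).
Proof.
  intros (a & b & ->); exists (- a)%Z, (- b)%Z.
  fold (zc a) (zc b) (zc (- a)) (zc (- b)); rewrite !zc_opp; ring.
Qed.

Lemma factor_neq0 (x : C) (n : nat) : ~ in_lattice tau x ->
  1 - Q (Z.of_nat n) * ee x <> 0.
Proof.
  intros Hx H; apply Hx, (lattice_ee x (Z.of_nat n)).
  rewrite Cplus_comm, ee_add; fold (Q (Z.of_nat n)).
  rewrite <- (Cplus_0_r (_ * _)), <- H; ring.
Qed.

Definition qf (n : nat) : C := Cprod (seq 1 n) (fun j => 1 - qpow tau (INR j)).

Lemma one_sub_Q (n : nat) : (0 < n)%nat -> 1 - Q (Z.of_nat n) <> 0.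
Proof.
  intros Hn H; assert (E : Q (Z.of_nat n) = 1) by (rewrite <- (Cplus_0_r (Q _)), <- H; ring).
  assert (H1 := Cmod_Q n); rewrite E, Cmod_1 in H1.
  assert (rho ^ n < 1)%R by (apply pow_lt_1_compat; [lra | lia]); lra.
Qed.

Lemma qf_neq0 (n : nat) : qf n <> 0.
Proof.
  apply Cprod_neq0; intros j Hj; apply in_seq in Hj; rewrite qpow_Q; apply one_sub_Q; lia.
Qed.

Lemma qf_S (n : nat) : qf (S n) = (1 - Q (Z.of_nat (S n))) * qf n.
Proof. unfold qf; rewrite Cprod_seq_S, qpow_Q; auto. Qed.

Definition qinf : C := Clim qf.

Lemma qf_inv_bounded : exists B, forall n, (Cmod (/ qf n) <= B)%R.
Proof.
  apply (prod_inv_bounded (fun j => qpow tau (INR j)) 1 rho Hrho).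
  - intros j _; rewrite qpow_Q, Cmod_Q; lra.
  - intros j Hj; rewrite qpow_Q; apply one_sub_Q; lia.
Qed.

Lemma qf_bounded : exists B, forall n, (Cmod (qf n) <= B)%R.
Proof.
  apply (prod_bounded (fun j => qpow tau (INR j)) 1 rho Hrho).
  intros j _; rewrite qpow_Q, Cmod_Q; lra.
Qed.

Lemma qf_cv : Ccv qf qinf.
Proof.
  destruct (prod_cv (fun j => qpow tau (INR j)) 1 rho Hrho) as [l Hl].
  - intros j _; rewrite qpow_Q, Cmod_Q; lra.
  - replace qinf with l by (symmetry; exact (Ccv_Clim _ _ Hl)); exact Hl.
Qed.

Lemma qinf_neq0 : qinf <> 0.
Proof.
  destruct qf_inv_bounded as [B HB].
  apply (Ccv_inv qf qinf B); auto using qf_neq0, qf_cv.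
Qed.

(** 1/(q;q)_m, with the value 0 for negative m: the convention under which the recursion [iota_pred]
    holds for every m, including m = 0, and q-binomials vanish outside their range. *)
Definition iota (m : Z) : C := if (m <? 0)%Z then RtoC 0 else / qf (Z.to_nat m).

Lemma iota_pred (m : Z) : iota (m - 1) = (1 - Q m) * iota m.
Proof.
  unfold iota; destruct (Z.ltb_spec m 0); destruct (Z.ltb_spec (m - 1) 0); try lia.
  - ring.
  - replace m with 0%Z by lia; unfold Q.
    replace (zc 0 * tau) with (RtoC 0) by (unfold zc; ring); rewrite ee_0; ring.
  - replace (Z.to_nat m) with (S (Z.to_nat (m - 1))) by lia.
    rewrite qf_S; replace (Z.of_nat (S (Z.to_nat (m - 1)))) with m by lia.
    assert (H1 := one_sub_Q (Z.to_nat m) ltac:(lia)); rewrite Z2Nat.id in H1 by lia.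
    field; split; [apply qf_neq0 | auto].
Qed.

Lemma iota_bounded : exists B, forall m, (Cmod (iota m) <= B)%R.
Proof.
  destruct qf_inv_bounded as [B HB]; exists B; intros m; unfold iota.
  destruct (m <? 0)%Z; auto; rewrite Cmod_0.
  apply Rle_trans with (2 := HB O); apply Cmod_ge_0.
Qed.

Lemma iota_cv (k : Z) : Ccv (fun n => iota (Z.of_nat n + k)) (/ qinf).
Proof.
  destruct qf_inv_bounded as [B HB].
  destruct (Ccv_inv qf qinf B qf_neq0 HB qf_cv) as [_ H].
  assert (H1 : Ccv (fun n => iota (Z.of_nat n)) (/ qinf)).
  { apply Ccv_ext with (2 := H); intros n; unfold iota.
    destruct (Z.ltb_spec (Z.of_nat n) 0); [lia|]; rewrite Nat2Z.id; auto. }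
  destruct (Z.le_ge_cases 0 k).
  - apply Ccv_ext with (2 := Ccv_incr _ _ (Z.to_nat k) H1).
    intros n; f_equal; lia.
  - unfold Ccv; apply (is_lim_seq_incr_n _ (Z.to_nat (- k))).
    apply is_lim_seq_ext with (2 := H1).
    intros n; do 3 f_equal; lia.
Qed.

(* q-binomial coefficients [2n+1, n-k], so that the finite Jacobi product is
   (1 - 1/x) prod_{j<=n} (1 - x q^j)(1 - q^j/x) = sum_k jt n k x^k. *)
Definition jt (n : nat) (k : Z) : C :=
  tq tau k * (qf (2 * n + 1) * iota (Z.of_nat n + - k) * iota (Z.of_nat n + (1 + k))).

(** With X = q^(n+1), passing to n + 1 multiplies the product by (1 - X x)(1 - X / x) = 1 + X^2 - X
    (x + 1/x); this is the coefficient of x^k. *)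
Lemma jt_S (n : nat) (k : Z) :
  jt (S n) k = (1 + Q (Z.of_nat (S n)) * Q (Z.of_nat (S n))) * jt n k
    - Q (Z.of_nat (S n)) * (jt n (k + -1) + jt n (k + 1)).
Proof.
  unfold jt.
  set (m := Z.of_nat (S n)); assert (Hm : Z.of_nat n = (m - 1)%Z) by (unfold m; lia).
  rewrite !Hm.
  replace (2 * S n + 1)%nat with (S (S (2 * n + 1))) by lia.
  rewrite !qf_S.
  replace (Z.of_nat (S (S (2 * n + 1)))) with (m + m + 1)%Z by (unfold m; lia).
  replace (Z.of_nat (S (2 * n + 1))) with (m + m)%Z by (unfold m; lia).
  (* All values of [iota] are reduced to those at m - k and m + 1 + k, and all values of [tq] to the
     one at k - 1; a rational identity in powers of q remains. *)
  assert (I1 : iota (m - 1 + - k) = (1 - Q (m + - k)) * iota (m + - k))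
    by (rewrite <- iota_pred; f_equal; lia).
  assert (I2 : iota (m + k) = (1 - Q (m + (1 + k))) * iota (m + (1 + k)))
    by (rewrite <- iota_pred; f_equal; lia).
  assert (I3 : iota (m + k - 1) = (1 - Q (m + k)) * iota (m + k))
    by (rewrite <- iota_pred; f_equal; lia).
  assert (I4 : iota (m + - k - 2) = (1 - Q (m - 1 + - k)) * iota (m - 1 + - k))
    by (rewrite <- iota_pred; f_equal; lia).
  replace (m - 1 + (1 + k))%Z with (m + k)%Z by lia.
  replace (m - 1 + - (k + -1))%Z with (m + - k)%Z by lia.
  replace (m - 1 + (1 + (k + -1)))%Z with (m + k - 1)%Z by lia.
  replace (m - 1 + - (k + 1))%Z with (m + - k - 2)%Z by lia.
  replace (m - 1 + (1 + (k + 1)))%Z with (m + (1 + k))%Z by lia.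
  rewrite I3, I4, I1, I2.
  assert (T1 : tq tau (k + 1) = - (Q k * Q 1) * tq tau k).
  { change (k + 1)%Z with (Z.succ k); rewrite tq_succ; unfold Q; rewrite <- ee_add.
    do 3 f_equal; unfold zc; ring. }
  assert (T2 : tq tau k = - Q k * tq tau (k + -1)).
  { replace k with (Z.succ (k + -1)) at 1 by lia; rewrite tq_succ; unfold Q.
    do 3 f_equal; rewrite zc_add; unfold zc.
    replace (RtoC (IZR (-1))) with (- (1)) by (rewrite <- RtoC_opp; reflexivity); ring. }
  rewrite T1, T2.
  replace (m - 1 + - k)%Z with (m + - k + - (1))%Z by lia.
  rewrite !Q_add, !Q_opp.
  field; split; apply Q_neq0.
Qed.

Lemma jt_factor_bounded (n : nat) : Zbounded (fun k =>
  qf (2 * n + 1) * iota (Z.of_nat n + - k) * iota (Z.of_nat n + (1 + k))).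
Proof.
  destruct iota_bounded as [B HB]; exists (Cmod (qf (2 * n + 1)) * B * B)%R; intros k.
  rewrite !Cmod_mult.
  repeat apply Rmult_le_compat; auto using Cmod_ge_0; try lra.
  apply Rmult_le_pos; apply Cmod_ge_0.
Qed.

Lemma RD_jt (n : nat) : RD (jt n).
Proof. apply RD_mult_bd; [apply jt_factor_bounded | apply RD_tq; auto]. Qed.

(** For n = 0 the product is 1 - 1/x, so only the exponents 0 and -1 survive. *)
Lemma jt_0 (k : Z) : k <> 0%Z -> k <> (-1)%Z -> jt 0 k = 0.
Proof.
  intros H0 H1; unfold jt, iota.
  destruct (Z.ltb_spec (Z.of_nat 0 + - k) 0); [ring|].
  destruct (Z.ltb_spec (Z.of_nat 0 + (1 + k)) 0); [ring|lia].
Qed.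

Lemma jt_00 : jt 0 0 = 1.
Proof.
  unfold jt; rewrite tq_0; unfold iota; simpl.
  change (Pos.to_nat 1) with 1%nat; simpl.
  replace (qf 0) with (RtoC 1) by reflexivity.
  field; auto using qf_neq0, C1_nz.
Qed.

Lemma jt_0m1 : jt 0 (-1) = - (1).
Proof.
  unfold jt; rewrite <- (Cmult_1_r (- (1))); f_equal.
  - unfold tq, zc; rewrite <- ee_half.
    rewrite <- (ee_addZ (_ + _) 1); f_equal; unfold zc.
    replace (RtoC (IZR (-1))) with (- (1)) by (rewrite <- RtoC_opp; reflexivity).
    field; apply two_neq0.
  - unfold iota; simpl.
    change (Pos.to_nat 1) with 1%nat; simpl.
    replace (qf 0) with (RtoC 1) by reflexivity.
    field; auto using qf_neq0, C1_nz.
Qed.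

Lemma jt_product (n : nat) (x : C) :
  Lau (jt n) x = (1 - ee (- x)) *
    (Cprod (seq 1 n) (fun j => 1 - Q (Z.of_nat j) * ee x) *
     Cprod (seq 1 n) (fun j => 1 - Q (Z.of_nat j) * ee (- x))).
Proof.
  induction n as [|n IH].
  - unfold Lau; rewrite (zs_finite _ 1).
    + rewrite Csum_zrange_S, Csum_zrange_0; simpl.
      rewrite (jt_0 1), jt_0m1, jt_00 by lia.
      replace (zc 0 * x) with (RtoC 0) by (unfold zc; ring); rewrite ee_0.
      replace (zc (-1) * x) with (- x)
        by (change (-1)%Z with (- (1))%Z; rewrite zc_opp; unfold zc; ring).
      ring.
    + intros k Hk; rewrite jt_0 by lia; ring.
  - set (X := Q (Z.of_nat (S n))).
    transitivity ((1 + X * X) * Lau (jt n) x - X * (ee x * Lau (jt n) x + ee (- x) * Lau (jt n) x)).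
    + assert (S0 := Lau_summ _ x (RD_jt n)).
      assert (S1 := Lau_summ _ x (RD_shift _ (-1) (RD_jt n))).
      assert (S2 := Lau_summ _ x (RD_shift _ 1 (RD_jt n))).
      replace (ee x * Lau (jt n) x) with (Lau (fun k => jt n (k + -1)%Z) x).
      2:{ rewrite Lau_shift by apply RD_jt; do 2 f_equal.
          change (-1)%Z with (- (1))%Z; rewrite zc_opp; unfold zc; ring. }
      replace (ee (- x) * Lau (jt n) x) with (Lau (fun k => jt n (k + 1)%Z) x).
      2:{ rewrite Lau_shift by apply RD_jt; do 2 f_equal; unfold zc; ring. }
      transitivity ((1 + X * X) * Lau (jt n) x + (- X) * (Lau (fun k => jt n (k + -1)%Z) x
         + Lau (fun k => jt n (k + 1)%Z) x)); [|ring].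
      unfold Lau.
      rewrite <- (proj2 (summ_plus _ _ S1 S2)).
      rewrite <- (proj2 (summ_scal (1 + X * X) _ S0)).
      rewrite <- (proj2 (summ_scal (- X) _ (proj1 (summ_plus _ _ S1 S2)))).
      rewrite <- (proj2 (summ_plus _ _ (proj1 (summ_scal (1 + X * X) _ S0))
        (proj1 (summ_scal (- X) _ (proj1 (summ_plus _ _ S1 S2)))))).
      apply zs_ext; intros k; rewrite jt_S; fold X; ring.
    + rewrite IH, !Cprod_seq_S; fold X.
      replace (X * X) with (X * X * (ee (- x) * ee x)) by (rewrite ee_opp_l; ring).
      ring.
Qed.

(* The derivative of [jt_product] at x = 0, through the recursion [jt_S]. *)
Lemma jt_deriv (n : nat) : zs (fun k => zc k * jt n k) = qf n * qf n.
Proof.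
  assert (Hzc : forall m, summ (fun k => zc k * jt m k)).
  { intros m; apply RD_summ, RD_ext with (fun k => jt m k * zc k); [intros; ring|].
    apply RD_zc, RD_jt. }
  induction n as [|n IH].
  - rewrite (zs_finite _ 1).
    + rewrite Csum_zrange_S, Csum_zrange_0; simpl.
      rewrite (jt_0 1), jt_0m1, jt_00 by lia.
      change (qf 0) with (RtoC 1).
      change (-1)%Z with (- (1))%Z; rewrite zc_opp; unfold zc; ring.
    + intros k Hk; rewrite jt_0 by lia; ring.
  (* The factor 1 - e(-x) vanishes at 0, so the coefficients sum to 0. Hence shifting k by 1 leaves
     the first moment unchanged, and the recursion multiplies it by 1 + X^2 - 2 X = (1 - X)^2. *)
  - assert (Sn : zs (jt n) = 0).
    { transitivity (Lau (jt n) 0).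
      - apply zs_ext; intros k; rewrite Cmult_0_r, ee_0; ring.
      - rewrite jt_product; replace (- 0) with (RtoC 0) by ring; rewrite ee_0; ring. }
    assert (SJ := RD_summ _ (RD_jt n)).
    assert (Hp := summ_plus _ _ (Hzc n) SJ).
    assert (Hm := summ_plus _ _ (Hzc n) (proj1 (summ_scal (- (1)) _ SJ))).
    rewrite (proj2 (summ_scal (- (1)) _ SJ)), Sn in Hm; rewrite Sn in Hp.
    assert (H1 := summ_shift _ (-1) (proj1 Hp)); rewrite (proj2 Hp) in H1.
    assert (H2 := summ_shift _ 1 (proj1 Hm)); rewrite (proj2 Hm) in H2.
    cbv beta in H1, H2.
    set (X := Q (Z.of_nat (S n))).
    assert (H3 := summ_plus _ _ (proj1 H1) (proj1 H2)).
    assert (H4 := summ_scal (- X) _ (proj1 H3)).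
    assert (H5 := summ_scal (1 + X * X) _ (Hzc n)).
    assert (H6 := proj2 (summ_plus _ _ (proj1 H5) (proj1 H4))).
    destruct H5 as [H5 H5'], H4 as [H4 H4'].
    cbv beta in *.
    rewrite H5', H4', (proj2 H3), (proj2 H1), (proj2 H2), IH in H6.
    rewrite qf_S; fold X.
    transitivity ((1 + X * X) * (qf n * qf n) +
      - X * (qf n * qf n + 0 + (qf n * qf n + - (1) * 0))); [|ring].
    rewrite <- H6; apply zs_ext; intros k; rewrite jt_S, !zc_add; fold X.
    replace (zc (-1)) with (- zc 1) by (rewrite <- zc_opp; reflexivity).
    unfold zc; ring.
Qed.

(** For each k the q-binomial factor tends to [qinf] / [qinf]^2, and it is bounded uniformly in n
    and k, so [dom_tannery] applies. *)
Lemma jt_limit (g : Z -> C) : RD (fun k => tq tau k * g k) ->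
  Ccv (fun n => zs (fun k => jt n k * g k)) (/ qinf * zs (fun k => tq tau k * g k)).
Proof.
  intros Ha.
  destruct iota_bounded as [B HB]; destruct qf_bounded as [U HU].
  assert (HB0 : (0 <= B)%R) by (eapply Rle_trans; [apply Cmod_ge_0 | apply (HB 0%Z)]).
  assert (HU0 : (0 <= U)%R) by (eapply Rle_trans; [apply Cmod_ge_0 | apply (HU O)]).
  destruct (Ha (/ 2)%R) as [c Hc]; [lra|].
  rewrite <- (proj2 (summ_scal (/ qinf) _ (RD_summ _ Ha))).
  apply (dom_tannery (c * (U * B * B)) (/ 2)); [lra| |].
  - intros n k; unfold jt; specialize (Hc k); cbv beta in Hc.
    set (x := tq tau k * g k) in Hc.
    match goal with |- (Cmod ?z <= _)%R => replace z with
      (x * (qf (2 * n + 1) * iota (Z.of_nat n + - k) * iota (Z.of_nat n + (1 + k))))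
      by (unfold x; ring) end.
    rewrite Cmod_mult.
    apply Rle_trans with (c * (/ 2) ^ Z.abs_nat k * (U * B * B))%R; [|lra].
    apply Rmult_le_compat; auto using Cmod_ge_0.
    rewrite !Cmod_mult.
    repeat apply Rmult_le_compat; auto using Cmod_ge_0.
    apply Rmult_le_pos; apply Cmod_ge_0.
  - intros k.
    replace (/ qinf * (tq tau k * g k)) with
      (tq tau k * g k * (qinf * / qinf * / qinf)) by (field; apply qinf_neq0).
    apply Ccv_ext with (fun n => tq tau k * g k *
      (qf (2 * n + 1) * iota (Z.of_nat n + - k) * iota (Z.of_nat n + (1 + k))));
      [intros n; unfold jt; ring|].
    apply Ccv_scal, Ccv_mult; [apply Ccv_mult|]; [|apply iota_cv|apply iota_cv].
    refine (is_lim_seq_subseq (fun n => Cmod (qf n - qinf)) 0 (fun n => 2 * n + 1)%nat _ qf_cv).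
    apply eventually_subseq; intros n; lia.
Qed.

(** T(x) / [qinf] is a limit of finite products whose inverses stay bounded off the lattice, so it
    cannot be 0. *)
Lemma T_neq0 (x : C) : ~ in_lattice tau x -> T tau x <> 0.
Proof.
  intros Hx HT.
  assert (Hx' : ~ in_lattice tau (- x)).
  { intros H; apply Hx; replace x with (- - x) by ring; apply lattice_opp; auto. }
  assert (L : Ccv (fun n => Lau (jt n) x) (/ qinf * 0)).
  { rewrite <- HT; apply (jt_limit (fun k => ee (zc k * x))).
    apply RD_ee, RD_tq; auto. }
  assert (Hf : forall y n, ~ in_lattice tau y -> 1 - Q (Z.of_nat n) * ee y <> 0)
    by (intros; apply factor_neq0; auto).
  assert (HP : forall y, ~ in_lattice tau y -> exists B, forall n,
    (Cmod (/ Cprod (seq 1 n) (fun j => (1 - Q (Z.of_nat j) * ee y)%C))%C <= B)%R).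
  { intros y Hy; apply (prod_inv_bounded _ (Cmod (ee y)) rho Hrho); auto.
    intros j _; rewrite Cmod_mult, Cmod_Q; lra. }
  destruct (HP x Hx) as [B1 H1]; destruct (HP _ Hx') as [B2 H2].
  assert (H0 : 1 - ee (- x) <> 0).
  { generalize (Hf (- x) 0%nat Hx'); unfold Q.
    replace (zc (Z.of_nat 0) * tau) with (RtoC 0) by (unfold zc; simpl; ring).
    rewrite ee_0, Cmult_1_l; auto. }
  assert (HC : forall y n, ~ in_lattice tau y ->
    Cprod (seq 1 n) (fun j => 1 - Q (Z.of_nat j) * ee y) <> 0)
    by (intros; apply Cprod_neq0; auto).
  rewrite Cmult_0_r in L; revert L.
  apply Ccv_0_inv_bounded with (Cmod (/ (1 - ee (- x))) * (B1 * B2))%R;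
    intros n; rewrite jt_product.
  - repeat apply Cmult_neq_0; auto.
  - match goal with |- (Cmod (/ (?a * (?b * ?c))) <= _)%R =>
      replace (/ (a * (b * c))) with (/ a * (/ b * / c)) by (field; auto) end.
    rewrite !Cmod_mult.
    apply Rmult_le_compat_l; [apply Cmod_ge_0|].
    apply Rmult_le_compat; auto using Cmod_ge_0.
Qed.

(** The limit of the first moments of [jt n] is computed twice: from the coefficients it is the
    series divided by [qinf], from [jt_deriv] it is the square of [qinf]. *)
Lemma jacobi_cube : zs (fun k => tq tau k * zc k) = qinf * (qinf * qinf).
Proof.
  assert (L1 := jt_limit zc (RD_zc _ (RD_tq tau Htau))).
  assert (L2 : Ccv (fun n => zs (fun k => jt n k * zc k)) (qinf * qinf)).
  { apply Ccv_ext with (fun n => qf n * qf n); [|apply Ccv_mult; apply qf_cv].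
    intros n; rewrite <- jt_deriv; apply zs_ext; intros; ring. }
  assert (E := Ccv_unique _ _ _ L1 L2).
  rewrite <- E; field; apply qinf_neq0.
Qed.

End Tau.

(** * The one-variable Appell sum *)

(** Difference quotient of e(kt) relative to e(t) - 1, a geometric sum that tends to k as t tends to
    0; through it the derivative of T at 0 is reached without differentiating a series. *)
Definition hq (t : C) (k : Z) : C := (ee (zc k * t) - 1) / (ee t - 1).

Lemma hq_0 (t : C) : hq t 0 = 0.
Proof.
  unfold hq; replace (zc 0 * t) with (RtoC 0) by (unfold zc; ring); rewrite ee_0.
  unfold Cdiv; ring.
Qed.

Lemma hq_succ (t : C) (k : Z) : ee t - 1 <> 0 -> hq t (Z.succ k) = hq t k + ee (zc k * t).
Proof.
  intros H; unfold hq, Z.succ; rewrite zc_add.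
  replace ((zc k + zc 1) * t) with (zc k * t + t) by (unfold zc; ring).
  rewrite ee_add; field; auto.
Qed.

Lemma Cmod_ee_R (x : R) : Cmod (ee (RtoC x)) = 1%R.
Proof. rewrite Cmod_ee; simpl; rewrite Rmult_0_r, Ropp_0, exp_0; auto. Qed.

Lemma zc_mult_R (k : Z) (t : R) : zc k * RtoC t = RtoC (IZR k * t).
Proof. unfold zc; rewrite RtoC_mult; auto. Qed.

(** A geometric sum of |k| terms of modulus 1; for negative k, extracting -e(kt) leads back to
    -k. *)
Lemma hq_bound (t : R) (k : Z) : ee (RtoC t) - 1 <> 0 ->
  (Cmod (hq (RtoC t) k) <= Rabs (IZR k))%R.
Proof.
  intros H.
  assert (Hn : forall n : nat, (Cmod (hq (RtoC t) (Z.of_nat n)) <= INR n)%R).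
  { induction n as [|n IH]; [change (Z.of_nat 0) with 0%Z; rewrite hq_0, Cmod_0; simpl; lra|].
    rewrite Nat2Z.inj_succ, hq_succ, S_INR by auto.
    eapply Rle_trans; [apply Cmod_triangle|].
    rewrite zc_mult_R, Cmod_ee_R; lra. }
  rewrite <- INR_abs_nat.
  destruct (Z.le_ge_cases 0 k) as [Hk|Hk].
  - replace k with (Z.of_nat (Z.abs_nat k)) at 1 by lia; apply Hn.
  - replace (hq (RtoC t) k) with
      (- ee (zc k * RtoC t) * hq (RtoC t) (Z.of_nat (Z.abs_nat k))).
    + rewrite Cmod_mult, Cmod_opp, zc_mult_R, Cmod_ee_R, Rmult_1_l; auto.
    + replace (Z.of_nat (Z.abs_nat k)) with (- k)%Z by lia.
      unfold hq; rewrite zc_opp.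
      replace (- zc k * RtoC t) with (- (zc k * RtoC t)) by ring.
      rewrite ee_opp; field; auto using ee_neq0.
Qed.

Lemma ee_cv (s : nat -> R) : is_lim_seq s 0 -> Ccv (fun n => ee (RtoC (s n))) 1.
Proof.
  intros Hs.
  assert (H1 : is_lim_seq (fun n => cos (2 * PI * s n) - 1)%R 0).
  { replace (Finite 0) with (Finite (cos (2 * PI * 0) - 1)%R)
      by (f_equal; rewrite Rmult_0_r, cos_0; ring).
    apply (is_lim_seq_continuous (fun y => cos (2 * PI * y) - 1)%R); auto; reg. }
  assert (H2 : is_lim_seq (fun n => sin (2 * PI * s n)) 0).
  { replace (Finite 0) with (Finite (sin (2 * PI * 0))%R)
      by (f_equal; rewrite Rmult_0_r, sin_0; ring).
    apply (is_lim_seq_continuous (fun y => sin (2 * PI * y))%R); auto; reg. }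
  apply (proj1 (is_lim_seq_abs_0 _)) in H1; apply (proj1 (is_lim_seq_abs_0 _)) in H2.
  apply Ccv_squeeze with (2 := is_lim_seq_plus0 _ _ H1 H2).
  intros n; rewrite ee_RtoC.
  set (a := cos _); set (b := sin _).
  replace ((a, b) - 1) with (RtoC (a - 1) + Ci * RtoC b)
    by (apply injective_projections; simpl; ring).
  eapply Rle_trans; [apply Cmod_triangle|].
  rewrite Cmod_mult, Cmod_Ci, !Cmod_R; lra.
Qed.

Section Tau.

Context (tau : C) (Htau : (0 < Im tau)%R).

(** [R] stands for the product of the T(v - u_j) with j >= 2. Under v to v + tau both terms acquire
    the factor -e(-v - tau + u_1 + z - u_0), and both inhomogeneous parts equal T(v - u_1) T(v - u_1
    - z) R(v), so they cancel. *)
Lemma Sol_shift_diff (u0 u1 z : C) (c c' : Z -> C) (R : C -> C) :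
  ~ in_lattice tau u0 -> ~ in_lattice tau (u0 - z) -> RD c -> RD c' ->
  (forall v, Lau c v = T tau (v - u1) * R v) ->
  (forall v, Lau c' v = T tau (v - (u1 + z)) * R v) ->
  exists l, forall v, Sol tau (u0 - z) c' v * T tau (v - u1)
     - Sol tau u0 c v * T tau (v - (u1 + z)) = l * T tau (v + (u0 - u1 - z)).
Proof.
  intros Hu Huz Hc Hc' HL HL'.
  apply (quasi_unique tau Htau (fun v => Sol tau (u0 - z) c' v * T tau (v + - u1)
     - Sol tau u0 c v * T tau (v + - (u1 + z)))).
  - apply laurent_sub; apply laurent_mult; auto using Sol_laurent, T_laurent.
  - intros v.
    assert (E : forall w, T tau (v + tau + - w) = - ee (- v - tau) * ee w * T tau (v - w)).
    { intros w; replace (v + tau + - w) with (v - w + tau) by ring; rewrite T_addtau by auto.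
      replace (- (v - w) - tau) with (- v - tau + w) by ring; rewrite ee_add; ring. }
    rewrite !E.
    assert (E1 := Sol_eq tau Htau u0 c v Hu Hc).
    assert (E2 := Sol_eq tau Htau (u0 - z) c' v Huz Hc').
    rewrite HL in E1; rewrite HL' in E2.
    replace (- v - tau - (u0 - u1 - z)) with (- v - tau + (u1 + z) - u0) by ring.
    rewrite (ee_sub _ u0), (ee_add _ (u1 + z)), (ee_add u1 z).
    rewrite ee_sub in E2.
    change (v + - u1) with (v - u1); change (v + - (u1 + z)) with (v - (u1 + z)).
    set (S1 := Sol tau u0 c (v + tau)) in *; set (S2 := Sol tau (u0 - z) c' (v + tau)) in *.
    set (S3 := Sol tau u0 c v) in *; set (S4 := Sol tau (u0 - z) c' v) in *.
    replace S3 with (ee u0 * S1 + T tau (v - u1) * R v) by (rewrite E1; ring).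
    replace S4 with (ee u0 / ee z * S2 + T tau (v - (u1 + z)) * R v) by (rewrite E2; ring).
    field; split; apply ee_neq0.
Qed.

Let Zf (u : C) : C := ee u * Sol tau u (tq tau) 0 * T tau u.

Lemma lattice_R (t : R) : in_lattice tau (RtoC t) -> exists a, t = IZR a.
Proof.
  intros (a & b & H); exists a.
  assert (H1 := f_equal Im H); assert (H2 := f_equal Re H).
  destruct tau as [p q]; simpl in *.
  assert (IZR b = 0)%R by nra.
  nra.
Qed.

(** The case u_1 = 0, R = 1: v = 0 and v = z each remove one of the two terms by T(0) = 0, and l is
    eliminated between the two equations. The factor T(z) is kept because z may lie in the
    lattice. *)
Lemma Zf_const (u z : C) : ~ in_lattice tau u -> ~ in_lattice tau (u - z) ->
  T tau z * Zf (u - z) = T tau z * Zf u.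
Proof.
  intros Hu Huz.
  assert (Hq := RD_tq tau Htau).
  destruct (Sol_shift_diff u 0 z (tq tau) (fun k => tq tau k * ee (zc k * - z)) (fun _ => 1))
    as [l Hl]; auto.
  - apply RD_ee; auto.
  - intros v; replace (v - 0) with v by ring; unfold T; ring.
  - intros v; rewrite <- Lau_trans.
    replace (v - (0 + z)) with (v + - z) by ring; unfold T; ring.
  - assert (A := Hl 0); assert (B := Hl z).
    replace (z - (0 + z)) with (RtoC 0) in B by ring.
    replace (0 - 0) with (RtoC 0) in A by ring.
    replace (0 - (0 + z)) with (- z) in A by ring.
    replace (z - 0) with z in B by ring.
    replace (z + (u - 0 - z)) with u in B by ring.
    replace (0 + (u - 0 - z)) with (u - z) in A by ring.
    rewrite T_0 in A by auto; rewrite T_0 in B by auto; rewrite T_neg in A by auto.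
    assert (S : Sol tau (u - z) (fun k => tq tau k * ee (zc k * - z)) z
                = Sol tau (u - z) (tq tau) 0).
    { apply zs_ext; intros k.
      replace (zc k * 0) with (zc k * - z + zc k * z) by ring; rewrite ee_add; ring. }
    rewrite S in B; clear S Hl.
    unfold Zf; rewrite ee_sub.
    set (S1 := Sol tau (u - z) (tq tau) 0) in *; set (S2 := Sol tau u (tq tau) 0) in *.
    set (S3 := Sol _ _ _ 0) in A.
    assert (A' : S2 * ee z * T tau z = l * T tau (u - z)) by (rewrite <- A; ring).
    assert (B' : S1 * T tau z = l * T tau u) by (rewrite <- B; ring).
    transitivity (ee u / ee z * (S1 * T tau z) * T tau (u - z)); [unfold Cdiv; ring|].
    rewrite B'.
    transitivity (ee u / ee z * T tau u * (l * T tau (u - z))); [ring|].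
    rewrite <- A'; field; apply ee_neq0.
Qed.

(** Points approaching 0 inside (0, 1): the lattice meets the real line only in Z, so the quotients
    at these points have nonzero denominators, and |e(t)| = 1 for real t. *)
Let s (n : nat) : R := (/ (INR n + 2))%R.

Let s_pos (n : nat) : (0 < s n < 1)%R.
Proof.
  assert (H := pos_INR n); unfold s; split; [apply Rinv_0_lt_compat; lra|].
  rewrite <- Rinv_1; apply Rinv_lt_contravar; lra.
Qed.

Let s_cv : is_lim_seq s 0.
Proof.
  assert (H : is_lim_seq (fun n => INR n + 2)%R p_infty).
  { eapply is_lim_seq_plus; [apply is_lim_seq_INR | apply is_lim_seq_const | reflexivity]. }
  change (Finite 0) with (Rbar_inv p_infty).
  apply is_lim_seq_inv; auto; discriminate.
Qed.

Let s_lattice (n : nat) : ~ in_lattice tau (RtoC (s n)).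
Proof.
  intros H; apply lattice_R in H; destruct H as [a Ha].
  assert (H := s_pos n); rewrite Ha in H; destruct H as [H1 H2].
  apply lt_IZR in H1; apply lt_IZR in H2; lia.
Qed.

Let s_ne (n : nat) : ee (RtoC (s n)) - 1 <> 0.
Proof.
  intros H; apply (s_lattice n), (lattice_ee tau (RtoC (s n)) 0).
  replace (RtoC (s n) + zc 0 * tau) with (RtoC (s n)) by (unfold zc; ring).
  transitivity (ee (RtoC (s n)) - 1 + 1); [ring | rewrite H; ring].
Qed.

Let ks_cv (k : Z) : Ccv (fun n => ee (zc k * RtoC (s n))) 1.
Proof.
  apply Ccv_ext with (fun n => ee (RtoC (IZR k * s n))).
  - intros n; rewrite zc_mult_R; auto.
  - apply ee_cv, is_lim_seq_scal0, s_cv.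
Qed.

Let T_cv (u : C) : Ccv (fun n => T tau (u - RtoC (s n))) (T tau u).
Proof.
  assert (Hr := RD_ee (tq tau) u (RD_tq tau Htau)).
  destruct (Hr (/ 2)%R) as [c Hc]; [lra|].
  apply (dom_tannery c (/ 2)); [lra| |].
  - intros n k.
    replace (zc k * (u - RtoC (s n))) with (zc k * u + RtoC (IZR (- k) * s n))
      by (rewrite <- zc_mult_R, zc_opp; ring).
    rewrite ee_add, Cmult_assoc, Cmod_mult, Cmod_ee_R, Rmult_1_r; apply Hc.
  - intros k.
    apply Ccv_ext with (fun n => tq tau k * ee (zc k * u) * ee (zc (- k) * RtoC (s n))).
    + intros n; rewrite <- Cmult_assoc, <- ee_add; do 2 f_equal; rewrite zc_opp; ring.
    + assert (H := Ccv_scal (tq tau k * ee (zc k * u)) _ _ (ks_cv (- k))).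
      rewrite Cmult_1_r in H; exact H.
Qed.

Let T_quot_cv : Ccv (fun n => T tau (RtoC (s n)) / (ee (RtoC (s n)) - 1))
  (zs (fun k => tq tau k * zc k)).
Proof.
  assert (Hq := RD_tq tau Htau).
  destruct (RD_zc _ Hq (/ 2)%R) as [c Hc]; [lra|].
  apply Ccv_ext with (fun n => zs (fun k => tq tau k * hq (RtoC (s n)) k)).
  - intros n; set (t := RtoC (s n)).
    assert (T0 := T_0 tau Htau); unfold T in T0.
    assert (S0 := Lau_summ _ 0 Hq); assert (S1 := Lau_summ _ t Hq).
    transitivity (/ (ee t - 1) * (Lau (tq tau) t + - (1) * Lau (tq tau) 0)).
    + unfold Lau; rewrite <- (proj2 (summ_scal (- (1)) _ S0)).
      rewrite <- (proj2 (summ_plus _ _ S1 (proj1 (summ_scal (- (1)) _ S0)))).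
      rewrite <- (proj2 (summ_scal (/ (ee t - 1)) _
        (proj1 (summ_plus _ _ S1 (proj1 (summ_scal (- (1)) _ S0)))))).
      apply zs_ext; intros k; rewrite Cmult_0_r, ee_0; unfold hq, Cdiv; ring.
    + rewrite T0; unfold T, Cdiv; ring.
  - apply (dom_tannery c (/ 2)); [lra| |].
    + intros n k; eapply Rle_trans; [|apply Hc]; rewrite !Cmod_mult.
      apply Rmult_le_compat_l; [apply Cmod_ge_0|].
      unfold zc; rewrite Cmod_R; apply hq_bound, s_ne.
    (* Induction on k in both directions: each step adds or removes one term e(jt), which tends to
       1. *)
    + intros k; apply Ccv_scal; revert k; apply Z.peano_ind.
      * apply Ccv_ext with (fun _ => 0); [intros; rewrite hq_0; auto | apply Ccv_const].
      * intros k IH; unfold Z.succ at 2; rewrite zc_add.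
        apply Ccv_ext with (fun n => hq (RtoC (s n)) k + ee (zc k * RtoC (s n))).
        -- intros n; rewrite hq_succ; auto; apply s_ne.
        -- apply Ccv_plus; auto; apply ks_cv.
      * intros k IH; unfold Z.pred at 2; rewrite zc_add.
        apply Ccv_ext with (fun n => hq (RtoC (s n)) k + - ee (zc (Z.pred k) * RtoC (s n))).
        -- intros n; rewrite <- (Z.succ_pred k) at 1; rewrite hq_succ by apply s_ne; ring.
        -- replace (zc (-1)) with (- (1)) by (unfold zc; rewrite <- RtoC_opp; reflexivity).
           apply Ccv_plus; auto; apply Ccv_opp, ks_cv.
Qed.

(** With y = 2 pi Im tau, a real argument does not affect the modulus e^(-ky), which for k nonzero
    keeps the distance 1 - e^(-y) from 1; for k < 0 this is e^y + e^(-y) >= 2. *)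
Let phi_near (n : nat) (k : Z) : k <> 0%Z ->
  (Cmod (phi tau (RtoC (s n)) k) <= / (1 - exp (- (2 * PI * Im tau))))%R.
Proof.
  intros Hk; set (y := (2 * PI * Im tau)%R).
  assert (HP := PI_RGT_0).
  assert (Hy : (0 < y)%R) by (apply Rmult_lt_0_compat; auto; lra).
  assert (H1 : (exp (- y) < 1)%R) by (rewrite <- exp_0; apply exp_increasing; lra).
  unfold phi; rewrite Cmod_inv by (apply phi_den, s_lattice).
  apply Rinv_le_contravar; [lra|].
  destruct (Cmod_1_sub (ee (RtoC (s n) + zc k * tau))) as [A B].
  assert (E : Cmod (ee (RtoC (s n) + zc k * tau)) = exp (- (IZR k * y))).
  { rewrite Cmod_ee; f_equal; unfold y, zc; destruct tau; simpl; ring. }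
  rewrite E in A, B.
  destruct (Z.lt_total k 0) as [H|[H|H]]; [|lia|].
  - assert (Hk' : (IZR k <= -1)%R) by (apply IZR_le; lia).
    assert (exp y <= exp (- (IZR k * y)))%R by (apply exp_le; nra).
    assert (1 + y <= exp y)%R by apply exp_ineq1_le.
    assert (exp (- y) * exp y = 1)%R by (rewrite <- exp_plus, Rplus_opp_l, exp_0; auto).
    assert (0 < exp (- y))%R by apply exp_pos.
    assert (2 - exp (- y) <= exp y)%R by nra.
    lra.
  - assert (Hk' : (1 <= IZR k)%R) by (apply IZR_le; lia).
    assert (exp (- (IZR k * y)) <= exp (- y))%R by (apply exp_le; nra).
    lra.
Qed.

(** Only the term m = 0 has a pole at u = 0; multiplied by 1 - e(u) it equals 1, while the other
    terms tend to 0. *)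
Let Sol_quot_cv : Ccv (fun n => (1 - ee (RtoC (s n))) * Sol tau (RtoC (s n)) (tq tau) 0) 1.
Proof.
  assert (Hq := RD_tq tau Htau).
  destruct (Hq (/ 2)%R) as [c Hc]; [lra|].
  set (U := (/ (1 - exp (- (2 * PI * Im tau))))%R) in *.
  apply Ccv_ext with (fun n => zs (fun k => tq tau k *
    ((1 - ee (RtoC (s n))) * phi tau (RtoC (s n)) k))).
  - intros n; unfold Sol, Lau.
    assert (H := Lau_summ _ 0 (RD_Sol tau Htau _ _ (s_lattice n) Hq)).
    rewrite <- (proj2 (summ_scal (1 - ee (RtoC (s n))) _ H)).
    apply zs_ext; intros k; rewrite Cmult_0_r, ee_0; ring.
  - assert (E : zs (fun k => tq tau k * (if Z.eqb k 0 then RtoC 1 else RtoC 0)) = 1).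
    { rewrite (zs_finite _ 0), Csum_zrange_0, tq_0; [simpl; ring|].
      intros k Hk; destruct (Z.eqb_spec k 0); [lia | ring]. }
    match goal with |- Ccv ?f _ => enough (H : Ccv f
      (zs (fun k => tq tau k * (if Z.eqb k 0 then RtoC 1 else RtoC 0))))
      by (rewrite E in H; exact H) end.
    assert (Ph0 : forall n, (1 - ee (RtoC (s n))) * phi tau (RtoC (s n)) 0 = 1).
    { intros n; unfold phi.
      replace (RtoC (s n) + zc 0 * tau) with (RtoC (s n)) by (unfold zc; ring).
      field; intros H; apply (s_ne n); rewrite <- Copp_0, <- H; ring. }
    (* The 1 covers k = 0; 2 |U| covers the rest, as |1 - e(s_n)| <= 2. *)
    apply (dom_tannery (c * (1 + 2 * Rabs U)) (/ 2)); [lra| |].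
    + intros n k.
      rewrite Cmod_mult, Rmult_assoc, (Rmult_comm (1 + _)), <- Rmult_assoc.
      apply Rmult_le_compat; auto using Cmod_ge_0.
      destruct (Z.eq_dec k 0) as [->|Hk].
      * rewrite Ph0, Cmod_1; generalize (Rabs_pos U); lra.
      * rewrite Cmod_mult.
        assert (H1 := phi_near n k Hk); fold U in H1.
        assert (H2 := Rle_abs U).
        assert (H3 : (Cmod (1 - ee (RtoC (s n))) <= 2)%R).
        { eapply Rle_trans; [apply Cmod_triangle|].
          rewrite Cmod_opp, Cmod_1, Cmod_ee_R; lra. }
        apply Rle_trans with (2 * Rabs U)%R; [|lra].
        apply Rmult_le_compat; auto using Cmod_ge_0; lra.
    + intros k; apply Ccv_scal.
      destruct (Z.eqb_spec k 0) as [->|Hk].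
      * apply Ccv_ext with (fun _ => 1); [intros; rewrite Ph0; auto | apply Ccv_const].
      * apply Ccv_squeeze with (fun n => U * Cmod (ee (RtoC (s n)) - 1))%R;
          [|apply is_lim_seq_scal0, (ee_cv s s_cv)].
        intros n; rewrite (Cmod_sub_sym (ee _) 1).
        replace ((1 - ee (RtoC (s n))) * phi tau (RtoC (s n)) k - 0) with
          (phi tau (RtoC (s n)) k * (1 - ee (RtoC (s n)))) by ring.
        rewrite Cmod_mult; apply Rmult_le_compat_r; [apply Cmod_ge_0|].
        apply phi_near; auto.
Qed.

(* [Zf] does not depend on its argument, and near 0 it is the product of the residue of
   [Sol] and the derivative of [T]. *)
Lemma appell_const (u : C) : ~ in_lattice tau u ->
  ee u * Sol tau u (tq tau) 0 * T tau u = - (qinf tau * (qinf tau * qinf tau)).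
Proof.
  intros Hu; fold (Zf u); rewrite <- (jacobi_cube tau Htau).
  set (J := zs (fun k => tq tau k * zc k)).
  assert (HT := T_neq0 tau Htau u Hu).
  assert (L : Ccv (fun n => Zf (RtoC (s n))) (- J)).
  (* Inserting 1 - e(s_n) separates the pole of [Sol] from the zero of T. *)
  { apply Ccv_ext with (fun n => ee (RtoC (s n)) *
      (((1 - ee (RtoC (s n))) * Sol tau (RtoC (s n)) (tq tau) 0) *
       (- (1) * (T tau (RtoC (s n)) / (ee (RtoC (s n)) - 1))))).
    - intros n; unfold Zf; field; apply s_ne.
    - replace (- J) with (1 * (1 * (- (1) * J))) by ring.
      apply Ccv_mult; [apply ee_cv, s_cv|].
      apply Ccv_mult; [apply Sol_quot_cv|].
      apply Ccv_scal, T_quot_cv. }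
  (* [Zf_const] with z = u - s_n controls only T(z) [Zf]; the limit T(u) is nonzero, so the division
     is made after passing to the limit. *)
  assert (L1 := Ccv_mult _ _ _ _ (T_cv u) L).
  assert (L2 := Ccv_mult _ _ _ _ (T_cv u) (Ccv_const (Zf u))).
  assert (E : T tau u * - J = T tau u * Zf u).
  { apply (Ccv_unique _ _ _ L1).
    apply Ccv_ext with (2 := L2); intros n.
    rewrite <- Zf_const; auto.
    - do 2 f_equal; ring.
    - replace (u - (u - RtoC (s n))) with (RtoC (s n)) by ring; auto. }
  replace (Zf u) with (/ T tau u * (T tau u * Zf u)) by (field; auto).
  rewrite <- E; field; auto.
Qed.

End Tau.

(** * The functions mu and their invariance *)

Lemma Cprod_seq_cons (N : nat) (f : nat -> C) :
  Cprod (seq 1 (S N)) f = f 1%nat * Cprod (seq 1 N) (fun j => f (S j)).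
Proof. simpl seq; simpl; rewrite <- seq_shift, Cprod_map; auto. Qed.

Lemma Csum_seq_cons (N : nat) (f : nat -> C) :
  Csum (seq 1 (S N)) f = f 1%nat + Csum (seq 1 N) (fun j => f (S j)).
Proof. simpl seq; simpl; rewrite <- seq_shift, Csum_map; auto. Qed.

Lemma Cprod_const (N : nat) (a : C) : Cprod (seq 1 N) (fun _ => a) = Cpown a N.
Proof. induction N as [|N IH]; auto; rewrite Cprod_seq_cons, IH; auto. Qed.

Lemma Cprod_ee {A} (l : list A) (f : A -> C) : Cprod l (fun j => ee (f j)) = ee (Csum l f).
Proof. induction l as [|a l IH]; simpl; [rewrite ee_0 | rewrite IH, ee_add]; auto. Qed.

(** Induction on N: splitting off the first index z replaces g by g(z + .), hence the quantification
    over all bounded g; the bound linear in sup |g| and uniform in M is what [dom_tannery] needs for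
    the sum over z. *)
Lemma box_limit (N : nat) (a : nat -> Z -> C) : (forall j, RD (a j)) ->
  exists c, RD c /\ (forall v, Lau c v = Cprod (seq 1 N) (fun j => Lau (a j) v)) /\
  (exists K, (0 <= K)%R /\ forall (g : Z -> C) (B : R), (forall k, (Cmod (g k) <= B)%R) ->
     forall M, (Cmod (Csum (zbox N M) (fun l => (g (zabs l) *
       Cprod (seq 1 N) (fun j => a j (nth (j - 1) l 0%Z)))%C)) <= K * B)%R) /\
  forall g, Zbounded g -> Ccv (fun M => Csum (zbox N M) (fun l => g (zabs l) *
       Cprod (seq 1 N) (fun j => a j (nth (j - 1) l 0%Z)))) (zs (fun m => c m * g m)).
Proof.
  revert a; induction N as [|N IH]; intros a Ha.
  - exists (fun m => if Z.eqb m 0 then RtoC 1 else RtoC 0).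
    assert (E : forall h, zs (fun m => (if Z.eqb m 0 then RtoC 1 else RtoC 0) * h m) = h 0%Z).
    { intros h; rewrite (zs_finite _ 0), Csum_zrange_0; [simpl; ring|].
      intros k Hk; destruct (Z.eqb_spec k 0); [lia | ring]. }
    split; [|split; [|split]].
    + intros s Hs; exists 1%R; intros k.
      destruct (Z.eqb_spec k 0) as [->|_]; [rewrite Cmod_1; simpl; lra|].
      rewrite Cmod_0, Rmult_1_l; apply pow_le; lra.
    + intros v; unfold Lau; rewrite E; simpl.
      replace (zc 0 * v) with (RtoC 0) by (unfold zc; ring); apply ee_0.
    + exists 1%R; split; [lra|]; intros g B HB M; simpl.
      rewrite Cplus_0_r, Cmult_1_r, Rmult_1_l; auto.
    + intros g _; rewrite E; simpl.
      apply Ccv_ext with (fun _ => g 0%Z); [intros; ring | apply Ccv_const].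
  - destruct (IH (fun j => a (S j)) (fun j => Ha (S j))) as (c & Hc & HL & (K & HK & Hbd) & Hcv).
    set (box := fun g M => Csum (zbox N M) (fun l => g (zabs l) *
       Cprod (seq 1 N) (fun j => a (S j) (nth (j - 1) l 0%Z)))).
    assert (Hbox : forall g M, Csum (zbox (S N) M) (fun l => g (zabs l) *
       Cprod (seq 1 (S N)) (fun j => a j (nth (j - 1) l 0%Z)))
       = Csum (zrange M) (fun z => a 1%nat z * box (fun k => g (z + k)%Z) M)).
    { intros g M; rewrite Csum_zbox_S; apply Csum_ext; intros z _.
      unfold box; rewrite <- Csum_scal; apply Csum_ext; intros l _.
      rewrite Cprod_seq_cons; simpl.
      rewrite (Cprod_ext _ _ (fun j => a (S j) (nth (j - 1) l 0%Z))); [ring|].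
      intros j Hj; apply in_seq in Hj; destruct j as [|j]; [lia|].
      rewrite Nat.sub_0_r; simpl; rewrite Nat.sub_0_r; auto. }
    destruct (Ha 1%nat (/ 2)%R) as [d Hd]; [lra|].
    assert (Hd0 := dom_nonneg _ _ _ Hd).
    assert (Hdom : forall g B, (forall k, (Cmod (g k) <= B)%R) -> forall M,
       dom (d * (K * B)) (/ 2) (fun z => a 1%nat z * box (fun k => g (z + k)%Z) M)).
    { intros g B HB M z; rewrite Cmod_mult.
      replace (d * (K * B) * (/ 2) ^ Z.abs_nat z)%R with
        (d * (/ 2) ^ Z.abs_nat z * (K * B))%R by ring.
      apply Rmult_le_compat; auto using Cmod_ge_0.
      apply Hbd; auto. }
    exists (conv (a 1%nat) c); split; [apply RD_conv; auto|split; [|split]].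
    + intros v; rewrite Lau_conv, Cprod_seq_cons, HL by auto; auto.
    + exists (d * K * geo (/ 2))%R; split.
      * destruct (geo_split (/ 2) ltac:(lra)) as [G1 G2].
        apply Rmult_le_pos; [apply Rmult_le_pos; auto | lra].
      * intros g B HB M; rewrite Hbox.
        eapply Rle_trans; [apply (dom_partial (d * (K * B)) (/ 2)); [lra | auto]|]; lra.
    + intros g Hg; rewrite conv_sum by auto.
      destruct Hg as [B HB].
      assert (T : Ccv (fun M => zs (fun z => a 1%nat z * box (fun k => g (z + k)%Z) M))
        (zs (fun n => a 1%nat n * zs (fun k => c k * g (n + k)%Z)))).
      { apply (dom_tannery (d * (K * B)) (/ 2)); [lra | auto |].
        intros z; apply Ccv_scal, Hcv; exists B; auto. }
      (* Inner box and outer range grow with the same M; the outer range is completed to Z at the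
         price of a tail that tends to 0, the majorant being independent of M. *)
      apply Ccv_ext with (fun M => zs (fun z => a 1%nat z * box (fun k => g (z + k)%Z) M) +
        (Csum (zrange M) (fun z => a 1%nat z * box (fun k => g (z + k)%Z) M)
         - zs (fun z => a 1%nat z * box (fun k => g (z + k)%Z) M)));
        [intros M; rewrite Hbox; ring|].
      rewrite <- (Cplus_0_r (zs _)); apply Ccv_plus; auto.
      apply Ccv_squeeze with (fun M => d * (K * B) * geo (/ 2) * (/ 2) ^ M)%R.
      * intros M.
        match goal with |- Rle (Cmod (Cminus (Cminus ?x ?y) _)) _ =>
          replace (x - y - 0) with (- (y - x)) by ring end.
        rewrite Cmod_opp; apply zs_tail; auto; lra.
      * apply is_lim_seq_scal0, is_lim_seq_geom; rewrite Rabs_pos_eq; lra.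
Qed.

Lemma powerRZ_m1 (n : Z) : RtoC (powerRZ (-1) n) = ee (zc n / 2).
Proof.
  assert (H1 : (-1 <> 0)%R) by lra.
  assert (E1 : ee (zc 1 / 2) = - (1)) by (unfold zc; rewrite <- ee_half; f_equal; field; apply two_neq0).
  assert (E2 : ee (zc (-1) / 2) = - (1)).
  { rewrite <- E1, <- (ee_addZ (zc (-1) / 2) 1); f_equal.
    replace (zc (-1)) with (- zc 1) by (rewrite <- zc_opp; auto).
    unfold zc; field; apply two_neq0. }
  revert n; apply Z.peano_ind.
  - replace (zc 0 / 2) with (RtoC 0) by (unfold zc; field; apply two_neq0).
    rewrite ee_0; auto.
  - intros n IH; unfold Z.succ; rewrite powerRZ_add, RtoC_mult, IH, zc_add by auto.
    replace ((zc n + zc 1) / 2) with (zc n / 2 + zc 1 / 2) by (field; apply two_neq0).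
    rewrite ee_add, E1; f_equal; simpl.
    rewrite <- RtoC_opp; f_equal; ring.
  - intros n IH; unfold Z.pred; rewrite powerRZ_add, RtoC_mult, IH, zc_add by auto.
    replace ((zc n + zc (-1)) / 2) with (zc n / 2 + zc (-1) / 2) by (field; apply two_neq0).
    rewrite ee_add, E2; f_equal; simpl.
    rewrite <- RtoC_opp; f_equal; field.
Qed.

Section Tau.

Context (tau : C) (Htau : (0 < Im tau)%R).

Lemma theta_neq0 (v : C) : ~ in_lattice tau v -> theta v tau <> 0.
Proof.
  intros H; rewrite theta_T by auto.
  repeat apply Cmult_neq_0; auto using Ci_nz, ee_neq0, T_neq0.
Qed.

Lemma lattice_add (x : C) (n : Z) : ~ in_lattice tau x -> ~ in_lattice tau (x + zc n * tau).
Proof.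
  intros H (a & b & E); apply H; exists a, (b - n)%Z.
  fold (zc a) (zc b) in E; fold (zc a) (zc (b - n)); rewrite zc_sub.
  transitivity (x + zc n * tau - zc n * tau); [ring | rewrite E; ring].
Qed.

Lemma prodT_coeffs (N : nat) (u : nat -> C) :
  exists c, RD c /\ (forall v, Lau c v = Cprod (seq 1 N) (fun j => T tau (v - u j))) /\
  forall g, Zbounded g -> Ccv (fun M => Csum (zbox N M) (fun l => g (zabs l) *
       Cprod (seq 1 N) (fun j => tq tau (nth (j - 1) l 0%Z) * ee (zc (nth (j - 1) l 0%Z) * - u j))))
    (zs (fun m => c m * g m)).
Proof.
  destruct (box_limit N (fun j n => tq tau n * ee (zc n * - u j))) as (c & Hc & HL & _ & Hcv).
  - intros j; apply RD_ee, RD_tq; auto.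
  - exists c; split; [auto|split; [|auto]].
    intros v; rewrite HL; apply Cprod_ext; intros j _.
    rewrite <- Lau_trans; reflexivity.
Qed.

(** Any [c] with the right Laurent series will do, as [Lau_inj] makes it unique; a change of u_0
    alone can therefore keep the same [c]. *)
Lemma mu_Sol (N : nat) (u : nat -> C) (c : Z -> C) : ~ in_lattice tau (u 0%nat) -> RD c ->
  (forall v, Lau c v = Cprod (seq 1 N) (fun j => T tau (v - u j))) ->
  mu N u tau = ee (u 0%nat / 2) * Cprod (seq 1 N) (fun j => / theta (u j) tau)
    * Sol tau (u 0%nat) c 0.
Proof.
  intros Hu Hc HL.
  destruct (prodT_coeffs N u) as (c' & Hc' & HL' & Hcv).
  assert (E : forall k, c k = c' k) by (apply Lau_inj; auto; intros; rewrite HL, HL'; auto).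
  unfold mu, zsum; apply Ccv_Clim.
  replace (Sol tau (u 0%nat) c 0) with (zs (fun m => c' m * phi tau (u 0%nat) m)).
  2:{ apply zs_ext; intros m; rewrite E, Cmult_0_r, ee_0; ring. }
  eapply Ccv_ext; [|apply Ccv_scal, Hcv, phi_bounded; auto].
  intros M; cbv beta; rewrite <- Csum_scal; apply Csum_ext; intros l _.
  transitivity (ee (u 0%nat / 2) * phi tau (u 0%nat) (zabs l) * Cprod (seq 1 N) (fun j =>
    tq tau (nth (j - 1) l 0%Z) * ee (zc (nth (j - 1) l 0%Z) * - u j) * / theta (u j) tau));
    [rewrite (Cprod_mult (seq 1 N) (fun j => tq tau (nth (j - 1) l 0%Z) *
       ee (zc (nth (j - 1) l 0%Z) * - u j)) (fun j => / theta (u j) tau)); ring|].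
  f_equal.
  - replace (Cexp (PI * Ci * u 0%nat)) with (ee (u 0%nat / 2))
      by (unfold ee, twopii; f_equal; field; apply two_neq0).
    rewrite qpow_ee.
    fold (zc (zabs l)) (ee (u 0%nat)); rewrite <- ee_add; reflexivity.
  - apply Cprod_ext.
    intros j _; cbv zeta; set (n := nth (j - 1) l 0%Z).
    unfold Cdiv; f_equal.
    rewrite powerRZ_m1, qpow_ee.
    replace (Cexp (- twopii * RtoC (IZR n) * u j)) with (ee (zc n * - u j))
      by (unfold ee, zc; f_equal; ring).
    unfold tq; rewrite <- !ee_add; f_equal.
    rewrite RtoC_div by lra; fold (zc (n * (n + 1))); rewrite zc_mul, zc_add.
    change (zc 1) with (RtoC 1); field; apply two_neq0.
Qed.

Definition PP (N : nat) (u : nat -> C) (v : C) : C :=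
  Cprod (seq 0 (S N)) (fun j => T tau (v - u j)).

Lemma usum_split (N : nat) (u : nat -> C) : usum N u = u 0%nat + Csum (seq 1 N) u.
Proof. reflexivity. Qed.

Lemma inv_theta_T (N : nat) (u : nat -> C) : (forall j, (j <= N)%nat -> ~ in_lattice tau (u j)) ->
  Cprod (seq 1 N) (fun j => / theta (u j) tau) * Cprod (seq 1 N) (fun j => T tau (0 - u j))
  = Cpown (Ci / ee (tau / 8)) N * ee (Csum (seq 1 N) u / 2).
Proof.
  intros Hu.
  rewrite <- Cprod_mult, <- Cprod_const.
  replace (Csum (seq 1 N) u / 2) with (Csum (seq 1 N) (fun j => / 2 * u j))
    by (rewrite Csum_scal; unfold Cdiv; ring).
  rewrite <- Cprod_ee, <- Cprod_mult.
  apply Cprod_ext; intros j Hj; apply in_seq in Hj.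
  replace (0 - u j) with (- u j) by ring; rewrite theta_Tneg by auto.
  replace (/ 2 * u j) with (u j / 2) by (unfold Cdiv; ring).
  field; split; [apply ee_neq0 | apply theta_neq0, Hu; lia].
Qed.

(** Since T(-u_j) / theta(u_j) = i e(u_j / 2) / e(tau / 8), multiplying by all T(-u_j) clears the
    theta functions and leaves a prefactor that sees only the sum of the u_j. *)
Lemma mu_PP (N : nat) (u : nat -> C) (c : Z -> C) :
  (forall j, (j <= N)%nat -> ~ in_lattice tau (u j)) -> RD c ->
  (forall v, Lau c v = Cprod (seq 1 N) (fun j => T tau (v - u j))) ->
  PP N u 0 * mu N u tau = Cpown (Ci / ee (tau / 8)) N * ee (usum N u / 2) *
    (T tau (- u 0%nat) * Sol tau (u 0%nat) c 0).
Proof.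
  intros Hu Hc HL.
  rewrite (mu_Sol N u c); auto; [|apply Hu; lia].
  rewrite usum_split.
  replace ((u 0%nat + Csum (seq 1 N) u) / 2) with (u 0%nat / 2 + Csum (seq 1 N) u / 2)
    by (field; apply two_neq0).
  rewrite ee_add.
  transitivity (ee (u 0%nat / 2) * (Cpown (Ci / ee (tau / 8)) N * ee (Csum (seq 1 N) u / 2))
    * (T tau (- u 0%nat) * Sol tau (u 0%nat) c 0)); [|ring].
  rewrite <- inv_theta_T by auto.
  unfold PP; simpl; replace (0 - u 0%nat) with (- u 0%nat) by ring; ring.
Qed.

Lemma PP_neq0 (N : nat) (u : nat -> C) :
  (forall j, (j <= N)%nat -> ~ in_lattice tau (u j)) -> PP N u 0 <> 0.
Proof.
  intros Hu; apply Cprod_neq0; intros j Hj; apply in_seq in Hj.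
  apply T_neq0; auto; intros H; apply (Hu j); [lia|].
  replace (u j) with (- (0 - u j)) by ring; apply lattice_opp; auto.
Qed.

(** Equal sums make the prefactors in [mu_PP] agree, [Sol_sym] handles the rest, and the nonzero
    product at v = 0 is cancelled. *)
Lemma mu_inv (N : nat) (u u' : nat -> C) (k k' : C) :
  (forall j, (j <= N)%nat -> ~ in_lattice tau (u j)) ->
  (forall j, (j <= N)%nat -> ~ in_lattice tau (u' j)) ->
  k <> 0 -> (forall v, k * PP N u v = k' * PP N u' v) -> usum N u = usum N u' ->
  mu N u tau = mu N u' tau.
Proof.
  intros Hu Hu' Hk H Hs.
  destruct (prodT_coeffs N u) as (c & Hc & HL & _).
  destruct (prodT_coeffs N u') as (c' & Hc' & HL' & _).
  assert (S := Sol_sym tau Htau (u 0%nat) (u' 0%nat) k k' c c'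
    (Hu 0%nat ltac:(lia)) (Hu' 0%nat ltac:(lia)) Hc Hc').
  assert (M := mu_PP N u c Hu Hc HL); assert (M' := mu_PP N u' c' Hu' Hc' HL').
  assert (H0 : k * (PP N u 0 * mu N u tau) = k' * (PP N u' 0 * mu N u' tau)).
  { rewrite M, M', Hs.
    transitivity (Cpown (Ci / ee (tau / 8)) N * ee (usum N u' / 2) *
      (k * (T tau (- u 0%nat) * Sol tau (u 0%nat) c 0))); [ring|].
    rewrite S; [ring|].
    intros v; rewrite HL, HL'; exact (H v). }
  assert (HP : k * PP N u 0 <> 0) by (apply Cmult_neq_0; auto; apply PP_neq0; auto).
  transitivity (/ (k * PP N u 0) * (k * (PP N u 0 * mu N u tau))).
  - field; split; [apply PP_neq0 |]; auto.
  - rewrite H0.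
    transitivity (/ (k * PP N u 0) * (k' * PP N u' 0 * mu N u' tau)); [ring|].
    rewrite <- H; field; split; [apply PP_neq0 |]; auto.
Qed.

(** The exponent k adds up under successive moves of parameters by multiples of tau, and two vectors
    with the same k relative to a common one have proportional products, as [mu_inv] demands. *)
Definition PP_rel (N : nat) (k : Z) (u u' : nat -> C) : Prop :=
  exists a : C, a <> 0 /\ forall v, PP N u' v = a * ee (zc k * v) * PP N u v.

Lemma PP_rel_trans (N : nat) (k l : Z) (u u' u'' : nat -> C) :
  PP_rel N k u u' -> PP_rel N l u' u'' -> PP_rel N (k + l) u u''.
Proof.
  intros (a & Ha & E) (b & Hb & F); exists (Cmult a b); split; [apply Cmult_neq_0; auto|].
  intros v; rewrite F, E, zc_add, Cmult_plus_distr_r, ee_add; ring.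
Qed.

Lemma PP_rel_upd (N r : nat) (k : Z) (u : nat -> C) : (r <= N)%nat ->
  PP_rel N k u (upd u r (u r + zc k * tau)).
Proof.
  intros Hr; exists (ee (zc k / 2 - zc k * u r + (zc k - zc k * zc k) / 2 * tau)).
  split; [apply ee_neq0|]; intros v; rewrite <- ee_add.
  apply Cprod_change with r; [apply seq_NoDup | apply in_seq; lia | |].
  - intros j Hj; unfold upd; rewrite (proj2 (Nat.eqb_neq j r) Hj); auto.
  - unfold upd; rewrite Nat.eqb_refl.
    replace (v - (u r + zc k * tau)) with (v - u r - zc k * tau) by ring.
    rewrite T_shift by auto; do 2 f_equal; ring.
Qed.

Lemma mu_PP_rel (N : nat) (k : Z) (u a b : nat -> C) :
  (forall j, (j <= N)%nat -> ~ in_lattice tau (a j)) ->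
  (forall j, (j <= N)%nat -> ~ in_lattice tau (b j)) ->
  PP_rel N k u a -> PP_rel N k u b -> usum N a = usum N b -> mu N a tau = mu N b tau.
Proof.
  intros Ha Hb (x & Hx & E) (y & Hy & F) Hs.
  apply mu_inv with y x; auto.
  intros v; rewrite E, F; ring.
Qed.

Lemma usum_upd (N r : nat) (u : nat -> C) (w : C) : (r <= N)%nat ->
  usum N (upd u r w) = w - u r + usum N u.
Proof.
  intros Hr; apply (Csum_change _ r); [apply seq_NoDup | apply in_seq; lia | |].
  - intros j Hj; unfold upd; rewrite (proj2 (Nat.eqb_neq j r) Hj); auto.
  - unfold upd; rewrite Nat.eqb_refl; ring.
Qed.

Lemma perm_seq (N : nat) (sigma : nat -> nat) :
  (forall i, (i <= N)%nat -> (sigma i <= N)%nat) ->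
  (forall i j, (i <= N)%nat -> (j <= N)%nat -> sigma i = sigma j -> i = j) ->
  Permutation (map sigma (seq 0 (S N))) (seq 0 (S N)).
Proof.
  intros H1 H2; apply NoDup_Permutation_bis.
  - assert (HD := seq_NoDup (S N) 0); revert HD.
    assert (HI : forall i, In i (seq 0 (S N)) -> (i <= N)%nat) by (intros i Hi; apply in_seq in Hi; lia).
    revert HI; generalize (seq 0 (S N)); intros l HI HD; induction HD as [|a l Ha HD IH]; simpl;
      constructor.
    + intros Hin; apply in_map_iff in Hin; destruct Hin as (b & Hb & Hbl).
      apply Ha; rewrite <- (H2 b a); simpl in *; auto.
    + apply IH; simpl in *; auto.
  - rewrite length_map; lia.
  - intros i Hi; apply in_map_iff in Hi; destruct Hi as (j & <- & Hj).
    apply in_seq in Hj; apply in_seq; specialize (H1 j); lia.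
Qed.

Lemma PP_rel_perm (N : nat) (u : nat -> C) (sigma : nat -> nat) :
  Permutation (map sigma (seq 0 (S N))) (seq 0 (S N)) -> PP_rel N 0 u (fun j => u (sigma j)).
Proof.
  intros H; exists 1; split; [apply C1_nz|]; intros v.
  replace (zc 0 * v) with (RtoC 0) by (unfold zc; ring); rewrite ee_0, !Cmult_1_l.
  unfold PP; rewrite <- (Cprod_perm _ _ (fun j => T tau (v - u j)) H), Cprod_map; auto.
Qed.

Lemma usum_perm (N : nat) (u : nat -> C) (sigma : nat -> nat) :
  Permutation (map sigma (seq 0 (S N))) (seq 0 (S N)) -> usum N (fun j => u (sigma j)) = usum N u.
Proof.
  intros H; unfold usum; rewrite <- (Csum_perm _ _ u H), Csum_map; auto.
Qed.

(** * Shifting u_0 by 1 and by N tau *)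

Lemma prodT_addtau (l : list nat) (u : nat -> C) (v : C) :
  Cprod l (fun j => T tau (v + tau - u j)) =
  ee (Csum l (fun j => / 2 - v - tau + u j)) * Cprod l (fun j => T tau (v - u j)).
Proof.
  rewrite <- Cprod_ee, <- Cprod_mult; apply Cprod_ext; intros j _.
  replace (v + tau - u j) with (v - u j + tau) by ring; rewrite T_addtau by auto.
  replace (/ 2 - v - tau + u j) with (/ 2 + (- (v - u j) - tau)) by ring.
  rewrite ee_add, ee_half; ring.
Qed.

Lemma Csum_seq_affine (N : nat) (u : nat -> C) (x : C) :
  Csum (seq 1 N) (fun j => x + u j) = zc (Z.of_nat N) * x + Csum (seq 1 N) u.
Proof.
  revert u; induction N as [|N IH]; intros u; [simpl; unfold zc; simpl; ring|].
  rewrite !Csum_seq_cons, (IH (fun j => u (S j))), Nat2Z.inj_succ.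
  unfold Z.succ; rewrite zc_add; unfold zc; ring.
Qed.

(** The N factors give c_m q^m = k c_{m+N}. Hence replacing w by w + N tau reindexes the kernel, the
    value at v = tau is k times the old value at 0, and [Sol_eq] at v = 0 leads back to 0 with the
    inhomogeneous term F(0). *)
Lemma Sol_addNtau (N : nat) (u : nat -> C) (c : Z -> C) (w : C) :
  ~ in_lattice tau w -> RD c ->
  (forall v, Lau c v = Cprod (seq 1 N) (fun j => T tau (v - u j))) ->
  Sol tau (w + zc (Z.of_nat N) * tau) c 0 =
  ee (zc (Z.of_nat N) / 2 + (w + Csum (seq 1 N) u)) * Sol tau w c 0
  + Cprod (seq 1 N) (fun j => T tau (0 - u j)).
Proof.
  intros Hw Hc HL; set (p := Z.of_nat N); set (w' := w + zc p * tau).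
  assert (Hw' : ~ in_lattice tau w') by (apply lattice_add; auto).
  set (k := ee (zc p / 2 - zc p * tau + Csum (seq 1 N) u)).
  assert (E : forall m, c m * ee (zc m * tau) = k * c (m + p)%Z).
  { apply (Lau_inj (fun m => c m * ee (zc m * tau)) (fun m => k * c (m + p)%Z)).
    - apply RD_ee; auto.
    - apply RD_scal, RD_shift; auto.
    - intros v; rewrite <- Lau_trans, HL, prodT_addtau, <- HL.
      rewrite Csum_seq_affine; fold p.
      transitivity (k * Lau (fun m => c (m + p)%Z) v).
      + rewrite Lau_shift, Cmult_assoc by auto; f_equal.
        unfold k; rewrite <- ee_add; f_equal; field; apply two_neq0.
      + unfold Lau; rewrite <- (proj2 (summ_scal k _ (Lau_summ _ v (RD_shift c p Hc)))).
        apply zs_ext; intros; ring. }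
  assert (S1 : Sol tau w' c (0 + tau) = k * Sol tau w c 0).
  { assert (H0 := Lau_summ _ 0 (RD_Sol tau Htau w c Hw Hc)).
    assert (H1 := summ_shift _ p H0).
    unfold Sol, Lau; rewrite <- (proj2 H1), <- (proj2 (summ_scal k _ (proj1 H1))).
    apply zs_ext; intros m.
    replace (zc m * (0 + tau)) with (zc m * tau) by ring.
    rewrite Cmult_0_r, ee_0.
    transitivity (phi tau w' m * (c m * ee (zc m * tau))); [ring|].
    rewrite E; unfold w', phi; rewrite zc_add.
    replace (w + zc p * tau + zc m * tau) with (w + (zc m + zc p) * tau) by ring; ring. }
  assert (S2 := Sol_eq tau Htau w' c 0 Hw' Hc).
  rewrite S1, HL in S2.
  replace (ee (zc p / 2 + (w + Csum (seq 1 N) u))) with (ee w' * k)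
    by (unfold w', k; rewrite <- ee_add; f_equal; ring).
  rewrite <- Cmult_assoc, S2; ring.
Qed.

Lemma Cprod_upd0 (N : nat) (u : nat -> C) (w : C) (f : C -> C) :
  Cprod (seq 1 N) (fun j => f (upd u 0 w j)) = Cprod (seq 1 N) (fun j => f (u j)).
Proof.
  apply Cprod_ext; intros [|j] Hj; [apply in_seq in Hj; lia | reflexivity].
Qed.

(** The kernel sees u_0 only through e(u_0); the sign comes from e(u_0 / 2). *)
Lemma mu_add1 (N : nat) (u : nat -> C) : ~ in_lattice tau (u 0%nat) ->
  mu N (upd u 0 (u 0%nat + 1)) tau = - mu N u tau.
Proof.
  intros Hu; destruct (prodT_coeffs N u) as (c & Hc & HL & _).
  assert (Hu' : ~ in_lattice tau (u 0%nat + 1)).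
  { intros (a & b & E); apply Hu; exists (a - 1)%Z, b.
    fold (zc a) (zc b) in E; fold (zc (a - 1)) (zc b); rewrite zc_sub.
    transitivity (u 0%nat + 1 - 1); [ring | rewrite E; unfold zc; ring]. }
  rewrite (mu_Sol N u c), (mu_Sol N (upd u 0 (u 0%nat + 1)) c); auto.
  - rewrite (Cprod_upd0 N u _ (fun x => / theta x tau)); unfold upd; simpl.
    replace ((u 0%nat + 1) / 2) with (/ 2 + u 0%nat / 2) by (field; apply two_neq0).
    rewrite ee_add, ee_half.
    replace (Sol tau (u 0%nat + 1) c 0) with (Sol tau (u 0%nat) c 0); [ring|].
    apply zs_ext; intros m; unfold phi.
    replace (u 0%nat + 1 + zc m * tau) with (u 0%nat + zc m * tau + zc 1) by (unfold zc; ring).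
    rewrite ee_addZ; auto.
  - intros v; rewrite HL, (Cprod_upd0 N u _ (fun x => T tau (v - x))); auto.
Qed.

Lemma Cpown_mult (a b : C) (n : nat) : Cpown (a * b) n = Cpown a n * Cpown b n.
Proof. induction n as [|n IH]; simpl; [ring | rewrite IH; ring]. Qed.

Lemma Cpown_ee (z : C) (n : nat) : Cpown (ee z) n = ee (zc (Z.of_nat n) * z).
Proof.
  induction n as [|n IH]; simpl Cpown.
  - rewrite <- ee_0; f_equal; unfold zc; simpl; ring.
  - rewrite IH, <- ee_add, Nat2Z.inj_succ; unfold Z.succ; rewrite zc_add.
    f_equal; unfold zc; ring.
Qed.

(** The inhomogeneous term of [Sol_addNtau] becomes elementary by [inv_theta_T]: the T(-u_j) cancel
    the theta denominators. *)
Lemma mu_addNtau (N : nat) (u : nat -> C) :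
  (forall j, (j <= N)%nat -> ~ in_lattice tau (u j)) ->
  mu N (upd u 0 (u 0%nat + zc (Z.of_nat N) * tau)) tau =
  ee (zc (Z.of_nat N) * tau / 2) *
  (ee (zc (Z.of_nat N) / 2 + usum N u) * mu N u tau +
   Cpown Ci N * ee (- (zc (Z.of_nat N) * tau / 8)) * ee (usum N u / 2)).
Proof.
  intros Hu; destruct (prodT_coeffs N u) as (c & Hc & HL & _).
  assert (Hu0 := Hu 0%nat ltac:(lia)).
  rewrite (mu_Sol N u c), (mu_Sol N (upd u 0 (u 0%nat + zc (Z.of_nat N) * tau)) c); auto.
  - rewrite (Cprod_upd0 N u _ (fun x => / theta x tau)); unfold upd at 1 2; simpl Nat.eqb; cbv iota.
    rewrite (Sol_addNtau N u c); auto; fold (usum N u).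
    assert (I := inv_theta_T N u Hu).
    set (A := Cprod _ _) in *; set (B := Cprod (seq 1 N) (fun j => T tau (0 - u j))) in *.
    replace ((u 0%nat + zc (Z.of_nat N) * tau) / 2) with
      (zc (Z.of_nat N) * tau / 2 + u 0%nat / 2) by (field; apply two_neq0).
    rewrite ee_add.
    rewrite <- usum_split.
    assert (I' : ee (u 0%nat / 2) * (A * B) =
      Cpown Ci N * ee (- (zc (Z.of_nat N) * tau / 8)) * ee (usum N u / 2)).
    { rewrite I, usum_split.
      replace ((u 0%nat + Csum (seq 1 N) u) / 2) with (u 0%nat / 2 + Csum (seq 1 N) u / 2)
        by (field; apply two_neq0).
      replace (Ci / ee (tau / 8)) with (Ci * ee (- (tau / 8))) by (rewrite ee_opp; auto).
      rewrite Cpown_mult, Cpown_ee, ee_add.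
      replace (zc (Z.of_nat N) * - (tau / 8)) with (- (zc (Z.of_nat N) * tau / 8))
        by (unfold Cdiv; ring).
      ring. }
    rewrite <- I'; ring.
  - unfold upd; simpl; apply lattice_add; auto.
  - intros v; rewrite HL, (Cprod_upd0 N u _ (fun x => T tau (v - x))); auto.
Qed.

End Tau.

(** * The transformation formulas *)

Lemma Cprod_inv {A} (l : list A) (f : A -> C) : (forall a, In a l -> f a <> 0) ->
  Cprod l (fun a => / f a) = / Cprod l f.
Proof.
  induction l as [|a l IH]; simpl; intros H; [field; apply C1_nz|].
  rewrite IH by auto; field; split; [apply Cprod_neq0|]; auto.
Qed.

Lemma RtoC_sum {A} (l : list A) (f : A -> R) :
  RtoC (fold_right (fun j acc => (f j + acc)%R) 0%R l) = Csum l (fun j => RtoC (f j)).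
Proof. induction l as [|a l IH]; simpl; auto; rewrite RtoC_plus, IH; auto. Qed.

Lemma zc_nat (n : nat) : zc (Z.of_nat n) = RtoC (INR n).
Proof. unfold zc; rewrite <- INR_IZR_INZ; auto. Qed.

Lemma Csum_sq_add {A} (l : list A) (f : A -> C) (k : C) :
  Csum l (fun j => (f j + k) * (f j + k)) =
  Csum l (fun j => f j * f j) + 2 * k * Csum l f + RtoC (INR (length l)) * (k * k).
Proof.
  induction l as [|a l IH]; simpl length; [simpl; ring|].
  rewrite S_INR, RtoC_plus; simpl; rewrite IH; ring.
Qed.

Lemma Csum_add_const {A} (l : list A) (f : A -> C) (k : C) :
  Csum l (fun j => f j + k) = Csum l f + RtoC (INR (length l)) * k.
Proof.
  induction l as [|a l IH]; simpl length; [simpl; ring|].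
  rewrite S_INR, RtoC_plus; simpl; rewrite IH; ring.
Qed.

Lemma zbox_length (n M : nat) (l : list Z) : In l (zbox n M) -> length l = n.
Proof.
  revert l; induction n as [|n IH]; simpl; intros l H.
  - destruct H as [<-|[]]; auto.
  - apply in_flat_map in H; destruct H as (z & _ & H).
    apply in_map_iff in H; destruct H as (l' & <- & H); simpl; auto.
Qed.

Lemma zc_zabs (l : list Z) :
  zc (zabs l) = Csum (seq 1 (length l)) (fun j => zc (nth (j - 1) l 0%Z)).
Proof.
  induction l as [|z l IH]; [reflexivity|].
  change (zabs (z :: l)) with (z + zabs l)%Z; rewrite zc_add, IH.
  change (length (z :: l)) with (S (length l)); rewrite Csum_seq_cons; simpl; f_equal.
  apply Csum_ext; intros [|j] Hj; [apply in_seq in Hj; lia|].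
  simpl; rewrite !Nat.sub_0_r; auto.
Qed.

Section Tau.

Context (tau : C) (Htau : (0 < Im tau)%R).

(** (-1)^s e(sp) q^(s(s-1)/2), the multiplier of the one-variable sum E under u to u + s tau
    ([Sol_tq_addtau]); it is the source of the square of |m| in the quadratic form. *)
Definition psi (p : C) (s : Z) : C :=
  ee (zc s / 2 + zc s * p + (zc s * zc s - zc s) / 2 * tau).

(* The summand of nu_{N,0} at u_0 = p, N = n + 1, with each half of the quadratic form and the
   sign (-1)^(2|m|) = 1 distributed over psi and the tq factors. *)
Definition nu_base (n : nat) (p : C) (u : nat -> C) (m : list Z) : C :=
  psi p (zabs m) * Cprod (seq 1 n) (fun j =>
    tq tau (nth (j - 1) m 0%Z) * ee (zc (nth (j - 1) m 0%Z) * (u 1%nat - u (S j)))).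

Lemma nu_base_ee (n : nat) (p : C) (u : nat -> C) (m : list Z) : length m = n ->
  let x := fun j => zc (nth (j - 1) m 0%Z) in
  let B := Csum (seq 1 n) x in
  nu_base n p u m = ee ((Csum (seq 1 n) (fun j => x j * x j) + B * B) / 2 * tau +
    ((p - u 0%nat) * B + Csum (seq 1 n) (fun j => (u 0%nat + u 1%nat - u (S j)) * x j))).
Proof.
  intros Hm x B; unfold nu_base, psi, tq.
  rewrite (Cprod_ext _ _ (fun j => ee (x j / 2 + x j * (x j + 1) / 2 * tau
    + x j * (u 1%nat - u (S j))))) by (intros; rewrite <- ee_add; reflexivity).
  rewrite Cprod_ee, <- ee_add.
  assert (E : Csum (seq 1 n) (fun j => x j / 2 + x j * (x j + 1) / 2 * tau
    + x j * (u 1%nat - u (S j))) =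
    B / 2 + (Csum (seq 1 n) (fun j => x j * x j) + B) / 2 * tau
    + (Csum (seq 1 n) (fun j => (u 0%nat + u 1%nat - u (S j)) * x j) - u 0%nat * B)).
  { unfold B; generalize (seq 1 n); intros l; induction l as [|a l IH]; simpl;
      [|rewrite IH]; field; apply two_neq0. }
  rewrite E; fold B.
  assert (HB : zc (zabs m) = B) by (rewrite zc_zabs, Hm; reflexivity).
  (* The exponents differ by the integer |m|, half of it from [psi] and half from the [tq]
     factors. *)
  match goal with |- _ = ee ?r => rewrite <- (ee_addZ r (zabs m)) end; rewrite HB.
  f_equal; field; apply two_neq0.
Qed.

(** With N = n + 1, half the quadratic form at m + e_k is half the form at m, plus k |m|, plus n N
    [ka]^2 / 2: the middle term moves u_0 by k tau, the last one goes into the prefactor. *)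
Lemma nuN_limit (n k : nat) (u : nat -> C) (L : C) :
  let ka := RtoC (INR k) / RtoC (INR (S n)) in
  Ccv (fun M => Csum (zbox n M) (nu_base n (u 0%nat + RtoC (INR k) * tau) u)) L ->
  nuN (S n) u tau k =
  ee (RtoC (INR n) * RtoC (INR (S n)) * (ka * ka) / 2 * tau
      + ka * Csum (seq 1 n) (fun j => u 0%nat + u 1%nat - u (S j))) * L.
Proof.
  intros ka HL.
  assert (HN : RtoC (INR (S n)) <> 0) by (apply INR_C_neq0; lia).
  unfold nuN; destruct (Nat.eqb_spec (S n) 1) as [E|E].
  (* For N = 1 the box consists of the empty list alone and both sides are 1, in agreement with the
     separate clause of [nuN]. *)
  - assert (n = 0)%nat by lia; subst n.
    assert (HL1 : L = 1).
    { apply (Ccv_unique _ _ _ HL), Ccv_ext with (fun _ => 1); [|apply Ccv_const].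
      intros M; simpl; unfold nu_base, psi; simpl.
      match goal with |- _ = ee ?z * _ + _ => replace z with (RtoC 0) end;
        [rewrite ee_0; ring|].
      unfold zc; field; apply two_neq0. }
    rewrite HL1, Cmult_1_r; simpl Csum; change (INR 0) with 0%R.
    match goal with |- _ = ee ?z => replace z with (RtoC 0) end; [rewrite ee_0; auto|].
    field; apply two_neq0.
  - replace (S n - 1)%nat with n by lia.
    unfold zsum; apply Ccv_Clim.
    eapply Ccv_ext; [|apply Ccv_scal, HL].
    intros M; cbv beta; rewrite <- Csum_scal; apply Csum_ext; intros m Hm.
    apply zbox_length in Hm.
    rewrite nu_base_ee by auto; cbv zeta; rewrite <- ee_add.
    set (x := fun j => zc (nth (j - 1) m 0%Z)).
    assert (HX : forall j, RtoC (IZR (nth (j - 1) m 0%Z) + INR k / INR (S n)) = x j + ka).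
    { intros j; rewrite RtoC_plus, RtoC_div by (apply not_0_INR; lia); reflexivity. }
    rewrite RtoC_plus, RtoC_pow, !RtoC_sum.
    rewrite (Csum_ext _ (fun j => RtoC ((IZR (nth (j - 1) m 0%Z) + INR k / INR (S n)) ^ 2))
      (fun j => (x j + ka) * (x j + ka)))
      by (intros; rewrite RtoC_pow, HX; simpl; ring).
    rewrite (Csum_ext _ (fun j => RtoC (IZR (nth (j - 1) m 0%Z) + INR k / INR (S n)))
      (fun j => x j + ka)) by (intros; apply HX).
    rewrite (Csum_ext _ (fun j => (u 0%nat + u 1%nat - u (S j)) *
        RtoC (IZR (nth (j - 1) m 0%Z) + INR k / INR (S n)))
      (fun j => (u 0%nat + u 1%nat - u (S j)) * x j + ka * (u 0%nat + u 1%nat - u (S j))))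
      by (intros; rewrite HX; ring).
    rewrite Csum_sq_add, Csum_add_const, Csum_plus, Csum_scal, length_seq.
    change (fun j : nat => zc (nth (j - 1) m 0%Z)) with x.
    change (fun j : nat => zc (nth (j - 1) m 0%Z) * zc (nth (j - 1) m 0%Z))
      with (fun j => x j * x j).
    change (fun j : nat => (u 0%nat + u 1%nat - u (S j)) * zc (nth (j - 1) m 0%Z))
      with (fun j => (u 0%nat + u 1%nat - u (S j)) * x j).
    set (A := Csum _ (fun j => x j * x j)); set (B := Csum _ x).
    set (D := Csum _ (fun j => _ * x j)); set (V := Csum _ (fun j => u 0%nat + u 1%nat - u (S j))).
    unfold ee; f_equal; unfold twopii, ka; clearbody A B D V.
    rewrite S_INR, RtoC_plus in *; field; auto using two_neq0.
Qed.

(** By [appell_const], e(u) E(u) T(u) takes the same value at u and u + n tau, so E transforms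
    inversely to e(u) T(u). *)
Lemma Sol_tq_addtau (u : C) (n : Z) : ~ in_lattice tau u ->
  Sol tau (u + zc n * tau) (tq tau) 0 = psi u n * Sol tau u (tq tau) 0.
Proof.
  intros Hu; assert (Hu' := lattice_add tau u n Hu).
  assert (A := appell_const tau Htau u Hu); assert (B := appell_const tau Htau _ Hu').
  rewrite <- A in B.
  replace (T tau (u + zc n * tau)) with
    (ee (zc (- n) / 2 + zc (- n) * u + (zc (- n) - zc (- n) * zc (- n)) / 2 * tau) * T tau u) in B
    by (rewrite <- T_shift by auto; f_equal; rewrite zc_opp; ring).
  assert (HT := T_neq0 tau Htau u Hu).
  set (S1 := Sol tau (u + _) _ _) in *; set (S0 := Sol tau u _ _) in *.
  set (w := ee (zc (- n) / 2 + _ + _)) in B.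
  assert (E : ee (u + zc n * tau) * w * psi u n = ee u).
  { unfold w, psi; rewrite <- !ee_add, zc_opp; f_equal; field; apply two_neq0. }
  assert (N1 := ee_neq0 u).
  transitivity (/ ee u * / T tau u * psi u n * (ee (u + zc n * tau) * S1 * (w * T tau u))).
  - transitivity (/ ee u * / T tau u * (ee (u + zc n * tau) * w * psi u n) * S1 * T tau u);
      [rewrite E; field; auto | ring].
  - rewrite B; field; auto.
Qed.

(** Up to an integer in the exponent, psi p k is a coefficient of the theta series: tq(-k) e(kp). *)
Lemma psi_bounded (p : C) : Zbounded (psi p).
Proof.
  destruct (RD_ee _ (- p) (RD_tq tau Htau) (/ 2)%R) as [c Hc]; [lra|].
  assert (H0 := dom_nonneg _ _ _ Hc).
  exists c; intros k.
  replace (psi p k) with (tq tau (- k) * ee (zc (- k) * - p)).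
  - eapply Rle_trans; [apply Hc|].
    assert ((/ 2) ^ Z.abs_nat (- k) <= 1)%R
      by (rewrite <- (pow1 (Z.abs_nat (- k))); apply pow_incr; lra).
    nra.
  - unfold psi, tq; rewrite <- ee_add, <- (ee_addZ _ k), zc_opp.
    f_equal; field; apply two_neq0.
Qed.

(** At v = u_1 the factor T(v - u_1) has the bare coefficients [tq]. Split off by [conv_sum], its
    inner sum is E(u_0 + m tau), that is [psi] times E(u_0), and [psi] is then the weight for the
    box sum over the remaining n factors. *)
Lemma Sol_nu (n : nat) (u : nat -> C) (c : Z -> C) : ~ in_lattice tau (u 0%nat) -> RD c ->
  (forall v, Lau c v = Cprod (seq 1 (S n)) (fun j => T tau (v - u j))) ->
  exists L, Ccv (fun M => Csum (zbox n M) (nu_base n (u 0%nat) u)) L /\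
  Sol tau (u 0%nat) c (u 1%nat) = Sol tau (u 0%nat) (tq tau) 0 * L.
Proof.
  intros Hu Hc HL.
  destruct (prodT_coeffs tau Htau n (fun j => u (S j) - u 1%nat)) as (c' & Hc' & HL' & Hcv).
  exists (zs (fun m => c' m * psi (u 0%nat) m)); split.
  - eapply Ccv_ext; [|apply Hcv, psi_bounded].
    intros M; apply Csum_ext; intros m _; unfold nu_base; f_equal.
    apply Cprod_ext; intros j _; do 2 f_equal; ring.
  - assert (Hq := RD_tq tau Htau).
    assert (E : forall m, conv c' (tq tau) m = c m * ee (zc m * u 1%nat)).
    { apply (Lau_inj (conv c' (tq tau)) (fun m => c m * ee (zc m * u 1%nat))).
      - apply RD_conv; auto.
      - apply RD_ee; auto.
      - intros v; rewrite Lau_conv, <- Lau_trans, HL, HL', Cprod_seq_cons by auto.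
        replace (v + u 1%nat - u 1%nat) with v by ring.
        rewrite Cmult_comm; f_equal.
        apply Cprod_ext; intros j _; f_equal; ring. }
    transitivity (zs (fun m => conv c' (tq tau) m * phi tau (u 0%nat) m)).
    { apply zs_ext; intros m; rewrite E; ring. }
    rewrite conv_sum; auto; [|apply phi_bounded; auto].
    rewrite <- (proj2 (summ_scal _ _ (RD_summ _ (RD_mult_bd _ _ (psi_bounded (u 0%nat)) Hc')))).
    apply zs_ext; intros m.
    transitivity (c' m * Sol tau (u 0%nat + zc m * tau) (tq tau) 0).
    + f_equal; apply zs_ext; intros k; rewrite Cmult_0_r, ee_0; unfold phi; rewrite zc_add.
      replace (u 0%nat + zc m * tau + zc k * tau) with (u 0%nat + (zc m + zc k) * tau) by ring.
      ring.
    + rewrite Sol_tq_addtau by auto; ring.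
Qed.

Lemma eta_qinf : Cpown (eta tau) 3 = ee (tau / 8) * (qinf tau * (qinf tau * qinf tau)).
Proof.
  assert (H8 : RtoC 8 <> 0) by (intros H; apply RtoC_inj in H; lra).
  assert (H24 : RtoC 24 <> 0) by (intros H; apply RtoC_inj in H; lra).
  replace (tau / 8) with (/ 24 * tau + (/ 24 * tau + / 24 * tau)) by (field; auto).
  rewrite !ee_add.
  unfold eta; fold (qf tau); change (Clim _) with (qinf tau).
  rewrite qpow_ee, RtoC_inv by lra; simpl Cpown; ring.
Qed.

(** Besides v = u_1, which yields l, the identity of [Sol_shift_diff] is used at v = 0, where the
    two solutions are those occurring in the two mu functions. [L] is nu_{N,0} in the form of a box
    limit. *)
Lemma mu_shift_diff (n : nat) (u : nat -> C) (z : C) :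
  (forall j, (j <= S n)%nat -> ~ in_lattice tau (u j)) ->
  ~ in_lattice tau (z - u 0%nat) -> ~ in_lattice tau (z + u 1%nat) ->
  exists L, Ccv (fun M => Csum (zbox n M) (nu_base n (u 0%nat) u)) L /\
  mu (S n) (upd (upd u 0 (u 0%nat - z)) 1 (u 1%nat + z)) tau - mu (S n) u tau =
  Ci * Cpown (eta tau) 3 * theta z tau * theta (z - u 0%nat + u 1%nat) tau
  / (theta (z - u 0%nat) tau * theta (z + u 1%nat) tau
     * Cprod (seq 0 (S (S n))) (fun j => theta (u j) tau)) * L.
Proof.
  intros Hu Hz0 Hz1.
  set (u' := upd (upd u 0 (u 0%nat - z)) 1 (u 1%nat + z)).
  assert (Hu0 := Hu 0%nat ltac:(lia)); assert (Hu1 := Hu 1%nat ltac:(lia)).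
  assert (Hu0' : ~ in_lattice tau (u 0%nat - z)).
  { intros H; apply Hz0; replace (z - u 0%nat) with (- (u 0%nat - z)) by ring.
    apply lattice_opp; auto. }
  destruct (prodT_coeffs tau Htau (S n) u) as (c & Hc & HL & _).
  destruct (prodT_coeffs tau Htau (S n) u') as (c' & Hc' & HL' & _).
  destruct (Sol_nu n u c Hu0 Hc HL) as (L & HLcv & HSol).
  exists L; split; auto.
  assert (Htail : forall f : C -> C, Cprod (seq 1 n) (fun j => f (u' (S j)))
            = Cprod (seq 1 n) (fun j => f (u (S j)))).
  { intros f; apply Cprod_ext; intros [|j] Hj; [apply in_seq in Hj; lia | reflexivity]. }
  destruct (Sol_shift_diff tau Htau (u 0%nat) (u 1%nat) z c c'
    (fun v => Cprod (seq 1 n) (fun j => T tau (v - u (S j))))) as [l Hl]; auto.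
  { intros v; rewrite HL, Cprod_seq_cons; auto. }
  { intros v; rewrite HL', Cprod_seq_cons, (Htail (fun x => T tau (v - x))); auto. }
  assert (A := Hl 0); assert (B := Hl (u 1%nat)).
  replace (u 1%nat - u 1%nat) with (RtoC 0) in B by ring.
  replace (u 1%nat - (u 1%nat + z)) with (- z) in B by ring.
  replace (u 1%nat + (u 0%nat - u 1%nat - z)) with (- (z - u 0%nat)) in B by ring.
  replace (0 - u 1%nat) with (- u 1%nat) in A by ring.
  replace (0 - (u 1%nat + z)) with (- (z + u 1%nat)) in A by ring.
  replace (0 + (u 0%nat - u 1%nat - z)) with (- (z - u 0%nat + u 1%nat)) in A by ring.
  rewrite T_0, HSol in B by auto; clear HSol Hl.
  assert (K := appell_const tau Htau _ Hu0).
  rewrite (mu_Sol tau Htau (S n) u c), (mu_Sol tau Htau (S n) u' c') by auto.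
  rewrite !Cprod_seq_cons, (Htail (fun x => / theta x tau)).
  change (u' 0%nat) with (u 0%nat - z) in *; change (u' 1%nat) with (u 1%nat + z).
  rewrite eta_qinf, (Cplus_comm (u 1%nat) z).
  change (Cprod (seq 0 (S (S n))) (fun j => theta (u j) tau)) with
    (theta (u 0%nat) tau * Cprod (seq 1 (S n)) (fun j => theta (u j) tau)).
  rewrite Cprod_seq_cons, Cprod_inv
    by (intros j Hj; apply in_seq in Hj; apply theta_neq0, Hu; auto; lia).
  assert (HR : Cprod (seq 1 n) (fun j => theta (u (S j)) tau) <> 0).
  { apply Cprod_neq0; intros j Hj; apply in_seq in Hj; apply theta_neq0, Hu; auto; lia. }
  set (R := Cprod (seq 1 n) (fun j => theta (u (S j)) tau)) in *.
  rewrite !theta_Tneg in A by auto; rewrite !theta_Tneg in B by auto.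
  assert (KT : theta (u 0%nat) tau = Ci * ee (u 0%nat / 2) * ee (tau / 8) * T tau (u 0%nat))
    by (apply theta_T; auto).
  assert (N0 := theta_neq0 tau Htau _ Hu0); assert (N1 := theta_neq0 tau Htau _ Hu1).
  assert (N2 := theta_neq0 tau Htau _ Hz0); assert (N3 := theta_neq0 tau Htau _ Hz1).
  (* Exponents are split into u_0 / 2, u_1 / 2, z / 2 and tau / 8, so that only a rational identity
     in these exponentials and the theta values remains. *)
  replace ((z - u 0%nat + u 1%nat) / 2) with (z / 2 - u 0%nat / 2 + u 1%nat / 2) in A
    by (field; apply two_neq0).
  replace ((z + u 1%nat) / 2) with (z / 2 + u 1%nat / 2) in A by (field; apply two_neq0).
  replace ((z - u 0%nat) / 2) with (z / 2 - u 0%nat / 2) in B by (field; apply two_neq0).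
  replace ((u 0%nat - z) / 2) with (u 0%nat / 2 - z / 2) by (field; apply two_neq0).
  replace (ee (u 0%nat)) with (ee (u 0%nat / 2) * ee (u 0%nat / 2)) in K
    by (rewrite <- ee_add; f_equal; field; apply two_neq0).
  rewrite !ee_add, !ee_sub in A; rewrite !ee_sub in B; rewrite !ee_sub.
  assert (M0 := ee_neq0 (u 0%nat / 2)); assert (M1 := ee_neq0 (u 1%nat / 2)).
  assert (M2 := ee_neq0 (z / 2)); assert (M3 := ee_neq0 (tau / 8)); assert (MC := Ci_nz).
  set (a := ee (u 0%nat / 2)) in *; set (b := ee (u 1%nat / 2)) in *.
  set (d := ee (z / 2)) in *; set (e := ee (tau / 8)) in *.
  set (t0 := theta (u 0%nat) tau) in *; set (t1 := theta (u 1%nat) tau) in *.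
  set (tz := theta z tau) in *; set (t2 := theta (z - u 0%nat) tau) in *.
  set (t3 := theta (z + u 1%nat) tau) in *; set (t4 := theta (z - u 0%nat + u 1%nat) tau) in *.
  set (S1 := Sol tau (u 0%nat - z) c' 0) in *; set (S0 := Sol tau (u 0%nat) c 0) in *.
  set (E0 := Sol tau (u 0%nat) (tq tau) 0) in *.
  set (q3 := qinf tau * (qinf tau * qinf tau)) in *.
  set (T0 := T tau (u 0%nat)) in *.
  clearbody a b d e t0 t1 tz t2 t3 t4 S1 S0 E0 q3 T0 R.
  (* [appell_const] solved for E(u_0); by [eta_qinf] the product of [q3] and [e] is eta^3. *)
  assert (HE : E0 = - (q3 * Ci * e) / (a * t0)).
  { assert (HT0 : T0 <> 0) by (intros H; apply N0; rewrite KT, H; ring).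
    replace q3 with (- (a * a * E0 * T0)) by (rewrite K; ring).
    rewrite KT; field; auto. }
  assert (Hl : l = q3 * Ci * e * L * tz / (t0 * t2)).
  { set (S2 := Sol tau (u 0%nat - z) c' (u 1%nat)) in B.
    assert (HB : l = (S2 * 0 - E0 * L * (Ci * d / e * tz)) / (Ci * (d / a) / e * t2))
      by (rewrite B; field; auto 10).
    rewrite HB, HE; field; auto 10. }
  assert (HS : S1 = (l * (Ci * (d / a * b) / e * t4) + S0 * (Ci * (d * b) / e * t3))
     / (Ci * b / e * t1)) by (rewrite <- A; field; auto 10).
  rewrite HS, Hl; field; auto 20.
Qed.

(** * The vector M_N, entry by entry *)

Lemma theta_shift (v : C) (k : Z) :
  theta (v - zc k * tau) tau = ee (zc k / 2 + zc k * v - zc k * zc k / 2 * tau) * theta v tau.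
Proof.
  rewrite !theta_T, T_shift by auto.
  transitivity (Ci * ee (tau / 8) * (ee ((v - zc k * tau) / 2) *
     ee (zc k / 2 + zc k * v + (zc k - zc k * zc k) / 2 * tau)) * T tau v); [ring|].
  transitivity (Ci * ee (tau / 8) * (ee (zc k / 2 + zc k * v - zc k * zc k / 2 * tau)
    * ee (v / 2)) * T tau v); [|ring].
  rewrite <- !ee_add; do 3 f_equal; field; apply two_neq0.
Qed.

Definition pre (N : nat) (s : C) (k : nat) : C :=
  RtoC ((-1) ^ k) *
  Cexp (- twopii * RtoC (INR k) * s / RtoC (INR N)
        - PI * Ci * RtoC (INR k ^ 2) * tau / RtoC (INR N)).

Lemma Mvec_pre (N : nat) (u : nat -> C) (k : nat) :
  Mvec N u tau k = pre N (usum N u) k * mu N (upd u 0 (u 0%nat + zc (Z.of_nat k) * tau)) tau.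
Proof. rewrite zc_nat; reflexivity. Qed.

Lemma pre_ee (N : nat) (s : C) (k : nat) : (1 <= N)%nat ->
  pre N s k = ee (zc (Z.of_nat k) / 2 - zc (Z.of_nat k) * s / zc (Z.of_nat N)
    - zc (Z.of_nat k) * zc (Z.of_nat k) * tau / (2 * zc (Z.of_nat N))).
Proof.
  intros HN; unfold pre; assert (H := INR_C_neq0 N HN).
  rewrite pow_powerRZ, powerRZ_m1, !zc_nat, RtoC_pow.
  match goal with |- _ * Cexp ?z = _ => replace (Cexp z) with
    (ee (- (RtoC (INR k) * s / RtoC (INR N)) - RtoC (INR k) * RtoC (INR k) * tau / (2 * RtoC (INR N)))) end.
  - rewrite <- ee_add; f_equal; field; auto using two_neq0.
  - unfold ee, twopii; f_equal; simpl; field; auto using two_neq0.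
Qed.

Lemma upd_ext (u : nat -> C) (r : nat) (w w' : C) : w = w' -> upd u r w = upd u r w'.
Proof. congruence. Qed.

Lemma upd_upd (u : nat -> C) (r : nat) (w w' : C) : upd (upd u r w) r w' = upd u r w'.
Proof.
  apply functional_extensionality; intros j; unfold upd; destruct (Nat.eqb j r); auto.
Qed.

Lemma upd_lattice (N r : nat) (u : nat -> C) (w : C) :
  (forall j, (j <= N)%nat -> ~ in_lattice tau (u j)) -> ~ in_lattice tau w ->
  forall j, (j <= N)%nat -> ~ in_lattice tau (upd u r w j).
Proof. intros H Hw j Hj; unfold upd; destruct (Nat.eqb j r); auto. Qed.

Lemma zcN_neq0 (N : nat) : (1 <= N)%nat -> zc (Z.of_nat N) <> 0.
Proof. intros H; rewrite zc_nat; apply INR_C_neq0; auto. Qed.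

(** The sum of the u_j grows by 1, so the prefactor gains e(-k/N), which zeta_N^k undoes; the sign
    is that of [mu_add1]. *)
Lemma Mvec_add1 (N : nat) (u : nat -> C) (k : nat) : (1 <= N)%nat ->
  (forall j, (j <= N)%nat -> ~ in_lattice tau (u j)) ->
  Cpown (zetaN N) k * Mvec N (upd u 0 (u 0%nat + 1)) tau k = - Mvec N u tau k.
Proof.
  intros HN Hu; assert (HN0 := zcN_neq0 N HN).
  rewrite !Mvec_pre, !pre_ee, usum_upd, upd_upd by (auto; lia).
  change (upd u 0 (u 0%nat + 1) 0%nat) with (u 0%nat + 1).
  set (w := upd u 0 (u 0%nat + zc (Z.of_nat k) * tau)).
  replace (upd u 0 (u 0%nat + 1 + zc (Z.of_nat k) * tau)) with (upd w 0 (w 0%nat + 1)).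
  2:{ unfold w; rewrite upd_upd; apply upd_ext; unfold upd; simpl; ring. }
  rewrite mu_add1.
  - unfold zetaN; replace (twopii / RtoC (INR N)) with (twopii * / zc (Z.of_nat N))
      by (rewrite zc_nat; reflexivity).
    fold (ee (/ zc (Z.of_nat N))); rewrite Cpown_ee.
    match goal with |- ?x * (?y * - ?m) = - (?y' * ?m) =>
      replace y' with (x * y); [ring|] end.
    rewrite <- ee_add; f_equal; field; auto using two_neq0.
  - auto.
  - apply lattice_add, Hu; lia.
Qed.

(** For k >= 1 both sides contain mu_N at u_0 + k tau and only prefactors are compared; for k = 0
    the left side has mu_N at u_0 + N tau and [mu_addNtau] enters. *)
Lemma Mvec_addtau (N : nat) (u : nat -> C) (k : nat) : (1 <= N)%nat -> (k < N)%nat ->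
  (forall j, (j <= N)%nat -> ~ in_lattice tau (u j)) ->
  Cexp (- twopii * usum N u / RtoC (INR N)) * qpow tau (- / (2 * INR N))
     * Mvec N (upd u 0 (u 0%nat + tau)) tau (if Nat.eqb k 0 then (N - 1)%nat else (k - 1)%nat)
     = - Mvec N u tau k
       - (if Nat.eqb k 0
          then Cpown (- Ci) N * Cexp (- PI * Ci * usum N u) * qpow tau (- INR N / 8)
          else 0).
Proof.
  intros HN Hk Hu; assert (HN0 := zcN_neq0 N HN); assert (H2 := two_neq0).
  assert (H8 : RtoC 8 <> 0) by (intros H; apply RtoC_inj in H; lra).
  assert (HNR : INR N <> 0%R) by (apply not_0_INR; lia).
  replace (Cexp (- twopii * usum N u / RtoC (INR N))) with (ee (- usum N u / zc (Z.of_nat N)))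
    by (unfold ee; rewrite zc_nat; f_equal; unfold Cdiv; ring).
  replace (qpow tau (- / (2 * INR N))) with (ee (- tau / (2 * zc (Z.of_nat N)))).
  2:{ rewrite qpow_ee, RtoC_opp, RtoC_inv, RtoC_mult, <- zc_nat by lra.
      f_equal; field; auto. }
  rewrite !Mvec_pre, !pre_ee, usum_upd, upd_upd by (auto; lia).
  change (upd u 0 (u 0%nat + tau) 0%nat) with (u 0%nat + tau).
  destruct (Nat.eqb_spec k 0) as [->|Hk0].
  - replace (u 0%nat + tau + zc (Z.of_nat (N - 1)) * tau) with
      (u 0%nat + zc (Z.of_nat N) * tau)
      by (rewrite Nat2Z.inj_sub, zc_sub by auto; unfold zc; ring).
    rewrite mu_addNtau by auto.
    replace (upd u 0 (u 0%nat + zc (Z.of_nat 0) * tau)) with u.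
    2:{ apply functional_extensionality; intros j; unfold upd.
        destruct (Nat.eqb_spec j 0) as [->|]; auto; unfold zc; simpl; ring. }
    replace (Cexp (- PI * Ci * usum N u)) with (ee (- (usum N u / 2)))
      by (unfold ee, twopii; f_equal; field; auto).
    replace (qpow tau (- INR N / 8)) with (ee (- (zc (Z.of_nat N) * tau / 8))).
    2:{ rewrite qpow_ee, RtoC_div, RtoC_opp, <- zc_nat by lra; f_equal; field; auto. }
    rewrite Nat2Z.inj_sub, zc_sub by auto.
    change (zc (Z.of_nat 1)) with (RtoC 1); change (zc (Z.of_nat 0)) with (RtoC 0).
    set (p := zc (Z.of_nat N)) in *; set (s := usum N u).
    replace (Cpown (- Ci) N) with (ee (p / 2) * Cpown Ci N).
    2:{ replace (- Ci) with (ee (/ 2) * Ci) by (rewrite ee_half; ring).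
        rewrite Cpown_mult, Cpown_ee; reflexivity. }
    replace (0 / 2 - 0 * s / p - 0 * 0 * tau / (2 * p)) with (RtoC 0) by (field; auto).
    rewrite ee_0.
    match goal with |- ee ?x * ee ?y * (ee ?z * (ee ?w * _)) = _ =>
      assert (E : ee x * ee y * (ee z * ee w) = - ee (- (p / 2) - s)) end.
    { replace (- ee (- (p / 2) - s)) with (ee (/ 2) * ee (- (p / 2) - s))
        by (rewrite ee_half; ring).
      rewrite <- !ee_add.
      (* The sign is (-1)^(N-1) on the left and -(-1)^N on the right; as exponents they differ by
         the integer N - 1. *)
      rewrite <- (ee_addZ (/ 2 + _) (Z.of_nat N - 1)), zc_sub; fold p; f_equal.
      unfold zc; field; auto. }
    transitivity (- ee (- (p / 2) - s) * (ee (p / 2 + s) * mu N u tau +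
      Cpown Ci N * ee (- (p * tau / 8)) * ee (s / 2))); [rewrite <- E; ring|].
    assert (E1 : ee (- (p / 2) - s) * ee (p / 2 + s) = 1)
      by (rewrite <- ee_add, <- ee_0; f_equal; ring).
    assert (E2 : ee (- (p / 2) - s) * ee (s / 2) = ee (p / 2) * ee (- (s / 2))).
    { rewrite <- !ee_add, <- (ee_addZ (- (p / 2) - s + s / 2) (Z.of_nat N)); fold p.
      f_equal; field; auto. }
    transitivity (- (ee (- (p / 2) - s) * ee (p / 2 + s)) * mu N u tau
      - ee (- (p / 2) - s) * ee (s / 2) * (Cpown Ci N * ee (- (p * tau / 8)))); [ring|].
    rewrite E1, E2; ring.
  - replace (u 0%nat + tau + zc (Z.of_nat (k - 1)) * tau) with
      (u 0%nat + zc (Z.of_nat k) * tau)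
      by (rewrite Nat2Z.inj_sub, zc_sub by lia; unfold zc; ring).
    rewrite Nat2Z.inj_sub, zc_sub by lia; change (zc (Z.of_nat 1)) with (RtoC 1).
    set (m := mu _ _ _).
    match goal with |- ee ?x * ee ?y * (ee ?z * m) = - (ee ?w * m) - _ =>
      assert (E : ee x * ee y * ee z = - ee w) end.
    { match goal with |- _ = - ?w => replace (- w) with (ee (/ 2) * w)
        by (rewrite ee_half; ring) end.
      rewrite <- !ee_add, <- (ee_addZ (_ + _ + _) 1); f_equal; change (zc 1) with (RtoC 1).
      field; auto. }
    match goal with |- ?x * (?y * m) = _ => transitivity (x * y * m); [ring|] end.
    rewrite E; ring.
Qed.

(** This is [mu_shift_diff] at u_0 + k tau. [theta_shift] turns the shift in each theta into an
    exponential, and these combine with the prefactor of M_N into that of [nuN_limit]. *)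
Lemma Mvec_shift_diff (N : nat) (u : nat -> C) (z : C) (k : nat) : (1 <= N)%nat ->
  (forall j, (j <= N)%nat -> ~ in_lattice tau (u j)) ->
  ~ in_lattice tau (z - u 0%nat) -> ~ in_lattice tau (z + u 1%nat) ->
  Mvec N (upd (upd u 0 (u 0%nat - z)) 1 (u 1%nat + z)) tau k - Mvec N u tau k
       = PhiN N u z tau k.
Proof.
  intros HN Hu Hz0 Hz1; destruct N as [|n]; [lia|].
  assert (HN0 := zcN_neq0 (S n) HN); assert (H2 := two_neq0).
  rewrite !Mvec_pre.
  rewrite usum_upd, usum_upd by lia.
  change (upd u 0 (u 0%nat - z) 1%nat) with (u 1%nat).
  change (upd (upd u 0 (u 0%nat - z)) 1 (u 1%nat + z) 0%nat) with (u 0%nat - z).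
  replace (u 1%nat + z - u 1%nat + (u 0%nat - z - u 0%nat + usum (S n) u)) with (usum (S n) u)
    by ring.
  set (p := zc (Z.of_nat k)) in *.
  set (w := upd u 0 (u 0%nat + p * tau)).
  replace (upd (upd (upd u 0 (u 0%nat - z)) 1 (u 1%nat + z)) 0 (u 0%nat - z + p * tau)) with
    (upd (upd w 0 (w 0%nat - z)) 1 (w 1%nat + z)).
  2:{ apply functional_extensionality; intros [|[|j]]; unfold w, upd; simpl; auto; ring. }
  assert (Hw : forall j, (j <= S n)%nat -> ~ in_lattice tau (w j))
    by (apply upd_lattice; auto; apply lattice_add, Hu; lia).
  destruct (mu_shift_diff n w z Hw) as (L & HL & E); auto.
  { unfold w, upd; simpl.
    replace (z - (u 0%nat + p * tau)) with (z - u 0%nat + zc (- Z.of_nat k) * tau)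
      by (rewrite zc_opp; fold p; ring).
    apply lattice_add; auto. }
  match goal with |- ?x * ?y - ?x * ?y' = _ => transitivity (x * (y - y')); [ring|] end.
  rewrite E; unfold PhiN.
  rewrite (nuN_limit n k u L).
  2:{ rewrite <- zc_nat; fold p; exact HL. }
  change (w 0%nat) with (u 0%nat + p * tau); change (w 1%nat) with (u 1%nat).
  (* Only the factor j = 0 changes; u_0 + k tau is read as u_0 - (-k) tau to fit [theta_shift]. *)
  rewrite (Cprod_change (seq 0 (S (S n))) 0%nat
    (ee (zc (- Z.of_nat k) / 2 + zc (- Z.of_nat k) * u 0%nat
      - zc (- Z.of_nat k) * zc (- Z.of_nat k) / 2 * tau))
    (fun j => theta (u j) tau) (fun j => theta (w j) tau)).
  - replace (z - (u 0%nat + p * tau) + u 1%nat) with (z - u 0%nat + u 1%nat - p * tau) by ring.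
    replace (z - (u 0%nat + p * tau)) with (z - u 0%nat - p * tau) by ring.
    unfold p; rewrite !theta_shift, zc_opp; fold p.
    assert (N2 := theta_neq0 tau Htau _ Hz0); assert (N3 := theta_neq0 tau Htau _ Hz1).
    assert (N4 : Cprod (seq 0 (S (S n))) (fun j => theta (u j) tau) <> 0).
    { apply Cprod_neq0; intros j Hj; apply in_seq in Hj; apply theta_neq0, Hu; auto; lia. }
    set (t1 := theta (z - u 0%nat) tau) in *; set (t2 := theta (z + u 1%nat) tau) in *.
    set (t3 := Cprod _ _) in *; set (t4 := theta (z - u 0%nat + u 1%nat) tau).
    rewrite pre_ee by auto; fold p.
    match goal with |- ee ?a * (_ * (ee ?b * _) / (ee ?c * _ * _ * (ee ?d * _)) * _) = _ * (ee ?f * _) =>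
      assert (EE : ee a * ee b / (ee c * ee d) = ee f) end.
    (* The exponents agree up to the integer k once the linear term of nu is expressed through the
       sum of the u_j. *)
    { rewrite <- !ee_add, <- ee_sub, <- (ee_addZ _ (- Z.of_nat k)), zc_opp; fold p.
      rewrite <- !zc_nat; fold p; f_equal.
      rewrite (Csum_ext _ (fun j => u 0%nat + u 1%nat - u (S j))
        (fun j => (u 0%nat + u 1%nat) + - (1) * u (S j))) by (intros; ring).
      rewrite (Csum_seq_affine n (fun j => - (1) * u (S j))), Csum_scal.
      rewrite usum_split, Csum_seq_cons, !Nat2Z.inj_succ in *; unfold Z.succ in *.
      rewrite zc_add in *; change (zc 1) with (RtoC 1) in *.
      field; auto. }
    rewrite <- EE; field; repeat split; auto using ee_neq0.
  - apply seq_NoDup.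
  - apply in_seq; lia.
  - intros j Hj; unfold w, upd; rewrite (proj2 (Nat.eqb_neq j 0) Hj); auto.
  - rewrite <- theta_shift; unfold w, upd; simpl; f_equal; rewrite zc_opp; fold p; ring.
Qed.

(** Common form of (iv) and (v): adding k tau to the zeroth parameter of either vector gives
    exponent k relative to [u], even where the two zeroth parameters are unrelated. *)
Lemma Mvec_PP_rel (N : nat) (u u' : nat -> C) (k : nat) :
  (forall j, (j <= N)%nat -> ~ in_lattice tau (u j)) ->
  (forall j, (j <= N)%nat -> ~ in_lattice tau (u' j)) ->
  PP_rel tau N 0 u u' -> usum N u' = usum N u -> Mvec N u' tau k = Mvec N u tau k.
Proof.
  intros Hu Hu' HR Hs; rewrite !Mvec_pre, Hs; f_equal.
  apply (mu_PP_rel tau Htau N (Z.of_nat k) u).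
  - apply upd_lattice; auto; apply lattice_add, Hu'; lia.
  - apply upd_lattice; auto; apply lattice_add, Hu; lia.
  - apply (PP_rel_trans tau N 0 (Z.of_nat k) u u'); auto; apply PP_rel_upd; auto; lia.
  - apply PP_rel_upd; auto; lia.
  - rewrite !usum_upd, Hs by lia; ring.
Qed.

End Tau.

Theorem theorem1p3 (N : nat) (tau : C) (u : nat -> C) :
  (1 <= N)%nat -> 0 < Im tau ->
  (forall j, (j <= N)%nat -> ~ in_lattice tau (u j)) ->
  (* (i) *)
  (forall k, (k < N)%nat ->
     Cpown (zetaN N) k * Mvec N (upd u 0 (u 0%nat + 1)) tau k = - Mvec N u tau k) /\
  (* (ii) : (P V)_0 = V_{N-1}, (P V)_k = V_{k-1} *)
  (forall k, (k < N)%nat ->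
     Cexp (- twopii * usum N u / RtoC (INR N)) * qpow tau (- / (2 * INR N))
     * Mvec N (upd u 0 (u 0%nat + tau)) tau (if Nat.eqb k 0 then (N - 1)%nat else (k - 1)%nat)
     = - Mvec N u tau k
       - (if Nat.eqb k 0
          then Cpown (- Ci) N * Cexp (- PI * Ci * usum N u) * qpow tau (- INR N / 8)
          else 0)) /\
  (* (iii) *)
  (forall z, ~ in_lattice tau (z - u 0%nat) -> ~ in_lattice tau (z + u 1%nat) ->
     forall k, (k < N)%nat ->
       Mvec N (upd (upd u 0 (u 0%nat - z)) 1 (u 1%nat + z)) tau k - Mvec N u tau k
       = PhiN N u z tau k) /\
  (* (iv) *)
  (forall sigma : nat -> nat,
     (forall i, (i <= N)%nat -> (sigma i <= N)%nat) ->
     (forall i j, (i <= N)%nat -> (j <= N)%nat -> sigma i = sigma j -> i = j) ->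
     forall k, (k < N)%nat -> Mvec N u tau k = Mvec N (fun j => u (sigma j)) tau k) /\
  (* (v) *)
  (forall r s, (r <= N)%nat -> (s <= N)%nat -> r <> s ->
     forall k, (k < N)%nat ->
       Mvec N (upd (upd u r (u r - tau)) s (u s + tau)) tau k = Mvec N u tau k).
Proof.
  intros HN Ht Hu; repeat split.
  - intros k _; apply Mvec_add1; auto.
  - intros k Hk; apply Mvec_addtau; auto.
  - intros z Hz0 Hz1 k _; apply Mvec_shift_diff; auto.
  - intros sigma H1 H2 k _; assert (HP := perm_seq N sigma H1 H2).
    symmetry; apply Mvec_PP_rel; auto using PP_rel_perm, usum_perm.
  (* The two moves have exponents -1 and 1, which add up to 0, and they leave the sum of the
     parameters unchanged. *)
  - intros r s Hr Hs Hrs k _.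
    assert (E1 : u r - tau = u r + zc (-1) * tau)
      by (replace (zc (-1)) with (- zc 1) by (rewrite <- zc_opp; auto); unfold zc; ring).
    set (w := upd u r (u r - tau)).
    assert (E2 : u s + tau = w s + zc 1 * tau).
    { unfold w, upd; rewrite (proj2 (Nat.eqb_neq s r)) by auto; unfold zc; ring. }
    apply Mvec_PP_rel; auto.
    + rewrite E2; apply upd_lattice.
      * unfold w; rewrite E1; apply upd_lattice; auto; apply lattice_add; auto.
      * rewrite <- E2; replace (u s + tau) with (u s + zc 1 * tau) by (unfold zc; ring).
        apply lattice_add; auto.
    + apply (PP_rel_trans tau N (-1) 1 u w).
      * unfold w; rewrite E1; apply PP_rel_upd; auto.
      * rewrite E2; apply PP_rel_upd; auto.
    + rewrite E2, usum_upd by auto; unfold w; rewrite usum_upd by auto; unfold zc; ring.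
Qed.
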